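(* For $n\ge 1$, let $\Omega_n=\{0,1,\dots,n\}$, $\pi_n\equiv 1/(n+1)$ and let $K_n$ be an irreducible birth and death chain on $\Omega_n$ satisfying, for $1\le i\le n$, \[ K_n(i-1,i)=K_n(i,i-1)=\begin{cases}1/2&\text{for }i\notin\{x_{n,1},\dots,x_{n,k_n}\}\\ \epsilon_n&\text{for }i=x_{n,j},\ 1\le j\le k_n\end{cases}, \] where $0\le k_n\le n$, $\epsilon_n\in(0,1/2]$, $x_{n,1},\dots,x_{n,k_n}\in\Omega_n$ are distinct, and the holding probability at each state is such that the rows of $K_n$ sum to $1$. Let $\mathcal{F}=\{(\Omega_n,K_n,\pi_n)\mid n=1,2,\dots\}$. Set $t_n=n^2+a_n/\epsilon_n$, where \[ a_n=\sum_{i=1}^{k_n}\min\{x_{n,i},\,n+1-x_{n,i}\}, \] and set \[ b_n=\max_{j:j\le n/2}\left\{(j+1)\times\left|\{1\le i\le k_n:j<x_{n,i}\le n-j\}\right|\right\}, \] where $j$ ranges over nonnegative integers. Then, for any $\epsilon\in(0,1/2)$ and $\delta\in(0,1)$, there is $C=C(\epsilon,\delta)>1$ such that \[ C^{-1}t_n\le \min\{T_{n,\mathrm{TV}}^{(c)}(\epsilon),T_{n,\mathrm{TV}}^{(\delta)}(\epsilon)\}\le\max\{T_{n,\mathrm{TV}}^{(c)}(\epsilon),T_{n,\mathrm{TV}}^{(\delta)}(\epsilon)\}\le Ct_n \] for $n$ large enough. Moreover, the following are equivalent. (1) $\mathcal{F}_c$ has a total variation cutoff. (2) For $\delta\in(0,1)$,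 $\mathcal{F}_\delta$ has a total variation cutoff. (3) $a_n/(n^2\epsilon_n)\to\infty$ and $a_n/b_n\to\infty$.
   Context: A birth and death chain on $\{0,1,\dots,n\}$ is a Markov chain whose transition matrix $K$ has $K(i,j)=0$ whenever $|i-j|>1$. The chains $K_n$ in the statement have the uniform distribution $\pi_n$ as stationary distribution. For a transition matrix $K$ with stationary distribution $\pi$, the continuous time semigroup is $H_t=e^{-t(I-K)}$ and the $\delta$-lazy chain is $K_\delta=\delta I+(1-\delta)K$. With $\|\mu-\nu\|_{\mathrm{TV}}=\sup_A\{\mu(A)-\nu(A)\}$, set $d^{(c)}_{\mathrm{TV}}(t)=\sup_x\|H_t(x,\cdot)-\pi\|_{\mathrm{TV}}$ for real $t\ge 0$, $d^{(\delta)}_{\mathrm{TV}}(m)=\sup_x\|K_\delta^m(x,\cdot)-\pi\|_{\mathrm{TV}}$ for integers $m\ge0$, $T^{(c)}_{\mathrm{TV}}(\epsilon)=\inf\{t\ge0: d^{(c)}_{\mathrm{TV}}(t)\le\epsilon\}$ and $T^{(\delta)}_{\mathrm{TV}}(\epsilon)=\inf\{m\in\mathbb{Z}_{\ge 0}: d^{(\delta)}_{\mathrm{TV}}(m)\le\epsilon\}$. The subscript $n$ refers to $K_n$. $\mathcal{F}_c$ and $\mathcal{F}_\delta$ are the families of the continuous time chains, respectively $\delta$-lazy discrete time chains, associated with $\mathcal{F}$. A family with mixing times $T_{n,\mathrm{TV}}$ has a total variation cutoff if $\lim_{n\to\infty}T_{n,\mathrm{TV}}(\epsilon)/T_{n,\mathrm{TV}}(\eta)=1$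 for all $0<\epsilon<\eta<1$ (with $T_{n,\mathrm{TV}}=T^{(c)}_{n,\mathrm{TV}}$ for $\mathcal{F}_c$ and $T^{(\delta)}_{n,\mathrm{TV}}$ for $\mathcal{F}_\delta$). *)

(* Defs.v *)
From mathcomp Require Import all_boot all_order all_algebra.
From mathcomp Require Import all_classical all_reals all_analysis.
Set Implicit Arguments.
Unset Strict Implicit.
Unset Printing Implicit Defensive.
Import Order.TTheory GRing.Theory Num.Theory.
Import numFieldNormedType.Exports.
Local Open Scope classical_set_scope.
Local Open Scope ring_scope.

(* The state space {0, ..., n} is 'I_n.+1; a Markov kernel on it is a square
   matrix of size n.+1 and a distribution is a row vector. *)

Definition transition_matrix (R : realType) n (K : 'M[R]_n.+1) : Prop :=
  (forall i j, 0 <= K i j) /\ (forall i, \sum_j K i j = 1).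

Definition birth_death (R : realType) n (K : 'M[R]_n.+1) : Prop :=
  forall i j : 'I_n.+1, ((i.+1 < j) || (j.+1 < i))%N -> K i j = 0.

Definition irreducible (R : realType) n (K : 'M[R]_n.+1) : Prop :=
  forall i j, exists m, 0 < (K ^+ m) i j.

Definition unif_dist (R : realType) n : 'rV[R]_n.+1 := const_mx n.+1%:R^-1.

Definition tv_dist (R : realType) n (mu nu : 'rV[R]_n.+1) : R :=
  sup [set \sum_(i in A) mu ord0 i - \sum_(i in A) nu ord0 i
      | A in [set: {set 'I_n.+1}]].

(* The exponential series of a matrix, summed entry by entry. *)
Definition expmx (R : realType) n (A : 'M[R]_n.+1) : 'M[R]_n.+1 :=
  \matrix_(i, j) limn (series (fun m => (A ^+ m) i j / m`!%:R)).

Definition heat_kernel (R : realType) n (K : 'M[R]_n.+1) (t : R) :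
  'M[R]_n.+1 := expmx ((- t) *: (1%:M - K)).

Definition lazy_kernel (R : realType) n (delta : R) (K : 'M[R]_n.+1) :
  'M[R]_n.+1 := delta%:M + (1 - delta) *: K.

Definition max_tv (R : realType) n (P : 'M[R]_n.+1) (pi : 'rV[R]_n.+1) : R :=
  sup [set tv_dist (row x P) pi | x in [set: 'I_n.+1]].

Definition dTV_c (R : realType) n (K : 'M[R]_n.+1) (pi : 'rV[R]_n.+1)
  (t : R) : R := max_tv (heat_kernel K t) pi.

Definition dTV_lazy (R : realType) n (delta : R) (K : 'M[R]_n.+1)
  (pi : 'rV[R]_n.+1) (m : nat) : R := max_tv (lazy_kernel delta K ^+ m) pi.

(* [inf] is the real infimum, equal to 0 on the empty set. For an irreducible
   K with stationary distribution pi, delta in (0, 1) and e > 0, the sets below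
   are nonempty since the chains converge to pi. *)
Definition TTV_c (R : realType) n (K : 'M[R]_n.+1) (pi : 'rV[R]_n.+1)
  (e : R) : R := inf [set t | 0 <= t /\ dTV_c K pi t <= e].

Definition TTV_lazy (R : realType) n (delta : R) (K : 'M[R]_n.+1)
  (pi : 'rV[R]_n.+1) (e : R) : R :=
  inf [set m%:R | m in [set m : nat | dTV_lazy delta K pi m <= e]].

(* T n e is the mixing time of the n-th chain at level e. *)
Definition tv_cutoff (R : realType) (T : nat -> R -> R) : Prop :=
  forall e h : R, 0 < e -> e < h -> h < 1 ->
    (T n e / T n h) @[n --> \oo] --> (1 : R).

(* The site i >= 1 stands for the edge {i - 1, i}; the sites x_1, ..., x_k are
   enumerated by 'I_k. *)
Definition bottleneck_chain (R : realType) n (K : 'M[R]_n.+1) (k : nat)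
    (eps : R) (x : 'I_k -> 'I_n.+1) : Prop :=
  [/\ transition_matrix K, birth_death K, irreducible K &
      forall i j : 'I_n.+1, j = i.+1 :> nat ->
        let w := if j \in codom x then eps else 2^-1 in
        K i j = w /\ K j i = w]
  /\ [/\ (k <= n)%N, 0 < eps, eps <= 2^-1 & injective x].

Definition a_coef n k (x : 'I_k -> 'I_n.+1) : nat :=
  (\sum_(l < k) minn (x l) (n.+1 - x l))%N.

Definition b_coef n k (x : 'I_k -> 'I_n.+1) : nat :=
  (\max_(j < n.+1 | j.*2 <= n)
     (j.+1 * #|[pred l : 'I_k | j < x l <= n - j]|))%N.

Definition t_coef (R : realType) n k (eps : R) (x : 'I_k -> 'I_n.+1) : R :=
  n%:R ^+ 2 + (a_coef x)%:R / eps.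

(* Main.v *)
(** Let [P] be the [delta]-lazy chain, [p i] its transition probability across the
    edge [{i - 1, i}], [r i = 1 / p i], and [m i = min (i, n + 1 - i)]. Two
    quantities govern mixing: [M], the larger of the mean times to reach the
    middle of the segment from its two ends, which is of order [sum m i * r i],
    that is [t_n]; and [B], a bound for [s * sum_(m i >= s) r i] over all [s],
    which is of order [n^2 + b_n / eps_n], that is of the relaxation time.

    The hitting time of [z] from [0] has mean [h = sum_(i <= z) i * r i] and
    variance at most [2 W h], where [W] is the maximum over [j] of
    [j * sum_(j <= i <= z) r i]; by Chebyshev's inequality it lies within
    [O(sqrt (M B))] of its mean. As [P] is monotone, this controls the distribution
    function of the chain from every starting point, and [O(B)] further steps
    smooth observables enough to pass to total variation. So the distance is near
    [1] well before [M] and near [0] well after [M], on the scale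
    [B + sqrt (M B)], and there is a cutoff when [M / B] tends to infinity.
    Conversely, an explicit monotone function whose gradient is contracted by [P]
    by a factor at least [1 - O(1 / B)] at each edge shows that the distance at
    time [m] is at least [(1 - O(1 / B))^m / 2], which excludes a cutoff when [M] is
    not much larger than [B].

    The continuous time chain is the mixture of the [P^m] under the Poisson law
    of mean [t / (1 - delta)]. The tail probabilities from the two ends are monotone
    in [m], so Chebyshev's inequality for the Poisson law transfers all the
    estimates from [P]. *)
Require Import Defs.
From mathcomp Require Import all_boot all_order all_algebra.
From mathcomp Require Import all_classical all_reals all_analysis.
From mathcomp Require Import ring lra zify.
Set Implicit Arguments.
Unset Strict Implicit.
Unset Printing Implicit Defensive.
Import Order.TTheory GRing.Theory Num.Theory.
Import numFieldNormedType.Exports.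
Local Open Scope classical_set_scope.
Local Open Scope ring_scope.

(** * Birth and death operators *)

Section Operator.
Variable R : realFieldType.
Implicit Types (f g p : nat -> R).

(** There is no path space: the chain is the operator [bd_op], and a statement about a hitting time
    becomes an induction on the number of remaining steps, comparing [bd_iter] with an explicit
    potential by positivity. The mean [i * r i] of the passage from [i - 1] to [i] solves
    [p i * u i = 1 + p (i - 1) * u (i - 1)].

    The far end is a bad target: an edge near [n] costs about [n * r i] in the mean, whereas [M]
    charges it only [m i * r i]. The target therefore stays at a distance [l] from the end, with [l]
    a small fixed fraction of [n]. Up to there the mean exceeds [M] by at most [O(B)], and the
    omitted strip costs [O(l / n)] in probability. Smoothing makes a similar cut, since [B / l]
    bounds the sum of the [r i] at distance [l] from both ends. This is why the constants depend on
    the error level.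

    In the converse, the monotone function is a nonnegative combination of indicators of initial
    segments, so at least one indicator relaxes as slowly as the function does, and an indicator is
    an event that total variation sees. *)

Definition bd_op p f (y : nat) : R :=
  f y + p y * (f y.-1 - f y) + p y.+1 * (f y.+1 - f y).

Definition bd_iter p (m : nat) f : nat -> R := iter m (bd_op p) f.

(* [p i] is the probability of crossing the edge [{i - 1, i}] in one step. The
   zero weights at [0] and beyond [n] confine the chain to [{0, ..., n}], so
   that observables can be functions on [nat]; their values beyond [n] do not
   matter. The bound [p i <= 1/2] makes the chain stochastically monotone. *)
Definition bd_weights (n : nat) (delta : R) p :=
  [/\ p 0%N = 0, forall i, (n < i)%N -> p i = 0,
      forall i, (0 < i <= n)%N -> 0 < p i &
      0 < delta /\ forall i, 0 <= p i <= (1 - delta) / 2].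

Definition below (z y : nat) : R := (y < z)%N%:R.

Lemma bd_iterS p m f y : bd_iter p m.+1 f y = bd_op p (bd_iter p m f) y.
Proof. by []. Qed.

Lemma bd_iterSr p m f : bd_iter p m.+1 f = bd_iter p m (bd_op p f).
Proof. exact: iterSr. Qed.

Lemma bd_iterD p s t f : bd_iter p (s + t) f = bd_iter p s (bd_iter p t f).
Proof. exact: iterD. Qed.

Lemma eq_bd_iter p m f g : f =1 g -> bd_iter p m f =1 bd_iter p m g.
Proof.
move=> fg; elim: m => [|m IHm] y //.
by rewrite !bd_iterS /bd_op !IHm.
Qed.

Lemma bd_iter_lin p m (a b : R) f g y :
  bd_iter p m (fun y => a * f y + b * g y) y
  = a * bd_iter p m f y + b * bd_iter p m g y.
Proof.
elim: m y => [|m IHm] y //.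
by rewrite !bd_iterS /bd_op !IHm; ring.
Qed.

Lemma bd_iter_cst p m (a : R) y : bd_iter p m (fun=> a) y = a.
Proof.
elim: m y => [|m IHm] y //.
by rewrite bd_iterS /bd_op !IHm; ring.
Qed.

Lemma bd_iterB p m f g y :
  bd_iter p m (fun y => f y - g y) y = bd_iter p m f y - bd_iter p m g y.
Proof.
elim: m y => [|m IHm] y //.
by rewrite !bd_iterS /bd_op !IHm; ring.
Qed.

Lemma bd_iter_sum p m (s : seq nat) (c : nat -> R) (F : nat -> nat -> R) y :
  bd_iter p m (fun y => \sum_(i <- s) c i * F i y) y
  = \sum_(i <- s) c i * bd_iter p m (F i) y.
Proof.
elim: s => [|i s IHs].
  by under eq_bd_iter do rewrite big_nil; rewrite bd_iter_cst big_nil.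
rewrite big_cons -IHs.
have -> : bd_iter p m (fun y => \sum_(i <- i :: s) c i * F i y) y =
  bd_iter p m (fun y => c i * F i y + 1 * (\sum_(i <- s) c i * F i y)) y.
  by apply: eq_bd_iter => z; rewrite big_cons mul1r.
by rewrite bd_iter_lin mul1r.
Qed.

Section Weights.
Variables (n : nat) (delta : R) (p : nat -> R).
Hypothesis wp : bd_weights n delta p.

Lemma weights_ge0 i : 0 <= p i.
Proof. by case: wp => _ _ _ [_ /(_ i) /andP[]]. Qed.

Lemma weights_le i : p i <= (1 - delta) / 2.
Proof. by case: wp => _ _ _ [_ /(_ i) /andP[]]. Qed.

Lemma weights_delta : 0 < delta <= 1.
Proof.
have := weights_ge0 0; have := weights_le 0.
by case: wp => _ _ _ [d0 _] *; apply/andP; split => //; lra.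
Qed.

Lemma weights_lt_half i : 2 * p i <= 1.
Proof. have := weights_le i; have /andP[] := weights_delta; lra. Qed.

Lemma weights_mulV i : (0 < i <= n)%N -> p i * (p i)^-1 = 1.
Proof. by move=> i_n; rewrite divff // gt_eqF//; case: wp => _ _ ->. Qed.

Lemma weights_inv_ge0 i : 0 <= (p i)^-1.
Proof. by rewrite invr_ge0 weights_ge0. Qed.

Lemma bd_op_le f g y : f y.-1 <= g y.-1 -> f y <= g y -> f y.+1 <= g y.+1 ->
  bd_op p f y <= bd_op p g y.
Proof.
move=> h1 h2 h3; rewrite /bd_op.
have -> : f y + p y * (f y.-1 - f y) + p y.+1 * (f y.+1 - f y) =
  p y * f y.-1 + p y.+1 * f y.+1 + (1 - p y - p y.+1) * f y by ring.
have -> : g y + p y * (g y.-1 - g y) + p y.+1 * (g y.+1 - g y) =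
  p y * g y.-1 + p y.+1 * g y.+1 + (1 - p y - p y.+1) * g y by ring.
rewrite !lerD// ler_wpM2l ?weights_ge0//.
by have := weights_lt_half y; have := weights_lt_half y.+1; lra.
Qed.

Lemma bd_iter_le m f g : (forall y, f y <= g y) ->
  forall y, bd_iter p m f y <= bd_iter p m g y.
Proof.
move=> fg; elim: m => [//|m IHm] y.
by rewrite !bd_iterS bd_op_le.
Qed.

Lemma bd_iter_le_n m f g : (forall y, (y <= n)%N -> f y <= g y) ->
  forall y, (y <= n)%N -> bd_iter p m f y <= bd_iter p m g y.
Proof.
move=> fg; elim: m => [//|m IHm] y yn.
rewrite !bd_iterS.
have [yn'|yn'] := ltnP y n.
  by apply: bd_op_le; apply: IHm => //; lia.
(* At the last state the weight of the next edge vanishes, so the value at [n.+1], about which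
   nothing is assumed, drops out. *)
have pn : p y.+1 = 0 by case: wp => _ -> //.
rewrite /bd_op pn !mul0r !addr0.
have h1 := IHm y yn; have h2 := IHm y.-1 (leq_trans (leq_pred y) yn).
have := weights_ge0 y; have := weights_lt_half y; nra.
Qed.

Lemma bd_iter_ge0 m f : (forall y, 0 <= f y) -> forall y, 0 <= bd_iter p m f y.
Proof.
by move=> f0 y; rewrite -[leLHS](bd_iter_cst p m 0 y); exact: bd_iter_le.
Qed.

Lemma bd_iter_le1 m f : (forall y, f y <= 1) -> forall y, bd_iter p m f y <= 1.
Proof.
by move=> f0 y; rewrite -[leRHS](bd_iter_cst p m 1 y); exact: bd_iter_le.
Qed.

Definition decr_on f := forall y, (y < n)%N -> f y.+1 <= f y.

Lemma decr_on_le f : decr_on f -> forall x y, (x <= y <= n)%N -> f y <= f x.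
Proof.
move=> df x y /andP[]; elim: y => [|y IHy].
  by rewrite leqn0 => /eqP ->.
rewrite leq_eqVlt => /orP[/eqP -> //|xy yn].
by apply: le_trans (df y yn) (IHy xy (ltnW yn)).
Qed.

(** The decrement of [bd_op p f] across an edge combines the decrements of [f] across that edge and
    its two neighbours, with coefficients [1 - 2 * p y.+1], [p y] and [p y.+2]. The bound [p <= 1/2]
    makes the first one nonnegative. *)
Lemma bd_op_decr f : decr_on f -> decr_on (bd_op p f).
Proof.
move=> df y yn; rewrite /bd_op /=.
have h1 : 0 <= p y.+2 * (f y.+1 - f y.+2).
  have [yn'|yn'] := ltnP y.+1 n.
    by rewrite mulr_ge0 ?weights_ge0// subr_ge0 df.
  by case: wp => _ -> //; rewrite mul0r.
have h2 : 0 <= p y * (f y.-1 - f y).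
  case: y {h1} yn => [|y] yn; first by case: wp => -> *; rewrite mul0r.
  by rewrite mulr_ge0 ?weights_ge0// subr_ge0 df// ltnW.
have h3 : 0 <= (1 - 2 * p y.+1) * (f y - f y.+1).
  by rewrite mulr_ge0 ?subr_ge0 ?weights_lt_half ?df.
lra.
Qed.

Lemma bd_iter_decr m f : decr_on f -> decr_on (bd_iter p m f).
Proof. by move=> df; elim: m => [//|m IHm]; apply: bd_op_decr. Qed.

Lemma below_decr z : decr_on (below z).
Proof. by move=> y _; rewrite /below ler_nat; lia. Qed.

Lemma bd_iter_decr_time f : decr_on f ->
  forall m1 m2, (m1 <= m2)%N -> bd_iter p m2 f 0 <= bd_iter p m1 f 0.
Proof.
move=> df m1 m2; elim: m2 => [|m IHm].
  by rewrite leqn0 => /eqP ->.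
rewrite leq_eqVlt => /orP[/eqP -> //|/IHm]; apply: le_trans.
rewrite bd_iterS /bd_op; case: wp => -> hn _ _; rewrite mul0r addr0.
have [n0|n0] := posnP n; first by rewrite hn ?n0// mul0r addr0.
have := bd_iter_decr m df n0; have := weights_ge0 1.
by move=> ? ?; nra.
Qed.

(* Summation by parts: the Dirichlet form of the operator. *)
Lemma dirichlet f g :
  \sum_(0 <= y < n.+1) f y * (g y - bd_op p g y) =
  \sum_(1 <= i < n.+1) p i * ((f i - f i.-1) * (g i - g i.-1)).
Proof.
have H k : \sum_(0 <= y < k.+1) f y * (g y - bd_op p g y) =
  \sum_(1 <= i < k.+1) p i * ((f i - f i.-1) * (g i - g i.-1))
  - f k * (p k.+1 * (g k.+1 - g k)).
  elim: k => [|k IHk].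
    rewrite big_nat1 big_geq// /bd_op; case: wp => -> _ _ _; ring.
  rewrite big_nat_recr//= IHk [in RHS]big_nat_recr//= /bd_op; ring.
by rewrite H; case: wp => _ ->// _ _; ring.
Qed.

Lemma bd_op_sym f g : \sum_(0 <= y < n.+1) f y * bd_op p g y =
  \sum_(0 <= y < n.+1) bd_op p f y * g y.
Proof.
have h1 := dirichlet f g; have h2 := dirichlet g f.
have h3 : \sum_(0 <= y < n.+1) f y * (g y - bd_op p g y) =
  \sum_(0 <= y < n.+1) g y * (f y - bd_op p f y).
  by rewrite h1 h2; apply: eq_bigr => i _; ring.
have e1 : \sum_(0 <= y < n.+1) f y * (g y - bd_op p g y) =
 \sum_(0 <= y < n.+1) f y * g y - \sum_(0 <= y < n.+1) f y * bd_op p g y.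
  by rewrite -sumrB; apply: eq_bigr => y _; rewrite mulrBr.
have e2 : \sum_(0 <= y < n.+1) g y * (f y - bd_op p f y) =
 \sum_(0 <= y < n.+1) f y * g y - \sum_(0 <= y < n.+1) bd_op p f y * g y.
  by rewrite -sumrB; apply: eq_bigr => y _; ring.
rewrite e1 e2 in h3; lra.
Qed.

(** Symmetry tested against the constant function: the uniform law is stationary. *)
Lemma bd_op_total g : \sum_(0 <= y < n.+1) bd_op p g y =
  \sum_(0 <= y < n.+1) g y.
Proof.
have := bd_op_sym (fun=> 1) g.
under eq_bigr do rewrite mul1r.
move=> ->; apply: eq_bigr => y _.
by rewrite -[bd_op p _ y]/(bd_iter p 1 (fun=> 1) y) bd_iter_cst mul1r.
Qed.

Lemma bd_iter_total m g : \sum_(0 <= y < n.+1) bd_iter p m g y =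
  \sum_(0 <= y < n.+1) g y.
Proof. by elim: m => [//|m IHm]; rewrite -IHm; exact: bd_op_total. Qed.

End Weights.
End Operator.

(** * Hitting times *)

Section Hitting.
Variable R : realFieldType.
Implicit Types (f g p : nat -> R).

Definition hit_mean p (z y : nat) : R :=
  \sum_(y.+1 <= i < z.+1) i%:R * (p i)^-1.

(** The mean squared increment of [hit_mean] in one step from [y]: the increments have sizes
    [y / p y] and [y.+1 / p y.+1], with probabilities [p y] and [p y.+1]. *)
Definition hit_gamma p (y : nat) : R :=
  y%:R ^+ 2 * (p y)^-1 + y.+1%:R ^+ 2 * (p y.+1)^-1.

(** The solution of [v - bd_op p v = hit_gamma p] below [z] with [v z = 0], obtained by summing the
    equation from [0] upwards. *)
Definition hit_var p (z y : nat) : R :=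
  \sum_(y.+1 <= i < z.+1) (p i)^-1 * \sum_(0 <= j < i) hit_gamma p j.

Section Weights.
Variables (n : nat) (delta : R) (p : nat -> R).
Hypothesis wp : bd_weights n delta p.

Let rge0 i : 0 <= (p i)^-1 := weights_inv_ge0 wp i.

Lemma hit_meanS z y : (y < z)%N ->
  hit_mean p z y = y.+1%:R * (p y.+1)^-1 + hit_mean p z y.+1.
Proof. by move=> yz; rewrite /hit_mean big_ltn. Qed.

Lemma hit_varS z y : (y < z)%N ->
  hit_var p z y = (p y.+1)^-1 * (\sum_(0 <= j < y.+1) hit_gamma p j)
                  + hit_var p z y.+1.
Proof. by move=> yz; rewrite /hit_var big_ltn. Qed.

Lemma hit_mean_ge0 z y : 0 <= hit_mean p z y.
Proof. by apply: sumr_ge0 => i _; rewrite mulr_ge0 ?ler0n. Qed.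

Lemma hit_gamma_ge0 j : 0 <= hit_gamma p j.
Proof. by rewrite addr_ge0// mulr_ge0 ?exprn_ge0. Qed.

Lemma hit_var_ge0 z y : 0 <= hit_var p z y.
Proof.
apply: sumr_ge0 => i _; rewrite mulr_ge0 ?sumr_ge0// => j _.
exact: hit_gamma_ge0.
Qed.

Lemma weights_neq0 i : (0 < i <= n)%N -> p i != 0.
Proof. by move=> i_n; rewrite gt_eqF//; case: wp => _ _ ->. Qed.

Lemma hit_mean_op z y : (y < z <= n)%N ->
  bd_op p (hit_mean p z) y = hit_mean p z y - 1.
Proof.
move=> /andP[yz zn].
have e2 : p y.+1 != 0 by apply: weights_neq0; lia.
rewrite /bd_op (hit_meanS yz).
case: y yz e2 => [|y] yz e2 /=.
  by case: wp => -> _ _ _; field.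
have e1 : p y.+1 != 0 by apply: weights_neq0; lia.
rewrite (hit_meanS (ltnW yz)) (hit_meanS yz) -[y.+2%:R]natr1.
by field; apply/andP.
Qed.

(* [(k + h y - M)^2 + v y] is the conditional second moment of [tau - M], where
   [tau] is the hitting time of [z], given that the chain is at [y] at time
   [k]; [hit_var] overestimates its variance. *)
Definition hit_moment2 z (M k : R) (y : nat) : R :=
  (k + hit_mean p z y - M) ^+ 2 + hit_var p z y.

Lemma hit_moment2_op z (M k : R) y : (y < z <= n)%N ->
  bd_op p (hit_moment2 z M (k + 1)) y <= hit_moment2 z M k y.
Proof.
move=> /andP[yz zn]; rewrite -subr_ge0.
have e2 : p y.+1 != 0 by apply: weights_neq0; lia.
(* One step adds [1] plus the increment of [hit_mean], a centred variable of variance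
   [hit_gamma - 1], to the centred term, while [hit_var] drops by the full [hit_gamma]; the
   difference is [1]. *)
suff -> : hit_moment2 z M k y - bd_op p (hit_moment2 z M (k + 1)) y = 1 by [].
rewrite /bd_op /hit_moment2.
case: y yz e2 => [|y] yz e2 /=.
  rewrite (hit_meanS yz) (hit_varS yz) big_nat1 /hit_gamma.
  by case: wp => -> _ _ _; rewrite expr0n /= !mul0r; field.
have e1 : p y.+1 != 0 by apply: weights_neq0; lia.
rewrite (hit_meanS (ltnW yz)) (hit_varS (ltnW yz)) (hit_meanS yz) (hit_varS yz).
have eg : hit_gamma p y.+1 =
  y.+1%:R ^+ 2 * (p y.+1)^-1 + (y.+1%:R + 1) ^+ 2 * (p y.+2)^-1.
  by rewrite natr1.
rewrite (big_nat_recr y.+1)//= eg -[y.+2%:R]natr1.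
set c := bigop _ _ _.
by field; apply/andP.
Qed.

Lemma sum_hit_gamma i : \sum_(0 <= j < i) hit_gamma p j
  <= 2 * \sum_(1 <= j < i.+1) j%:R ^+ 2 * (p j)^-1.
Proof.
have -> : 2 * \sum_(1 <= j < i.+1) j%:R ^+ 2 * (p j)^-1 =
  \sum_(0 <= j < i) hit_gamma p j + i%:R ^+ 2 * (p i)^-1.
  elim: i => [|i IHi]; first by rewrite !big_geq// expr0n !(mulr0, mul0r, addr0).
  rewrite big_nat_recr//= mulrDr IHi [in RHS]big_nat_recr//= /hit_gamma.
  by set c := bigop _ _ _; ring.
by rewrite lerDl mulr_ge0 ?exprn_ge0.
Qed.

Lemma sum_triangle (a b : nat -> R) z :
  \sum_(1 <= i < z.+1) a i * (\sum_(1 <= j < i.+1) b j)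
  = \sum_(1 <= j < z.+1) b j * \sum_(j <= i < z.+1) a i.
Proof.
elim: z => [|z IHz]; first by rewrite !big_geq.
rewrite big_nat_recr//= IHz.
have -> : \sum_(1 <= j < z.+2) b j * \sum_(j <= i < z.+2) a i =
  \sum_(1 <= j < z.+2) (b j * (\sum_(j <= i < z.+1) a i) + b j * a z.+1).
  by apply: eq_big_nat => j /andP[j1 jz]; rewrite big_nat_recr//= mulrDr.
rewrite big_split/= -mulr_suml [in RHS]mulrC; congr (_ + _).
rewrite [RHS]big_nat_recr//= [X in _ = _ + X](_ : _ = 0) ?addr0//.
by rewrite big_geq// mulr0.
Qed.

(** After the sums are exchanged, the [j]-th term is the product of [j * \sum_(j <= i) (p i)^-1], at
    most [W], and [j / p j], which sums to [hit_mean]. *)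
Lemma hit_var_le z W :
  (forall j, (0 < j <= z)%N -> j%:R * (\sum_(j <= i < z.+1) (p i)^-1) <= W) ->
  hit_var p z 0 <= 2 * W * hit_mean p z 0.
Proof.
move=> HW; apply: (@le_trans _ _ (2 * \sum_(1 <= i < z.+1)
    (p i)^-1 * \sum_(1 <= j < i.+1) j%:R ^+ 2 * (p j)^-1)).
  rewrite mulr_sumr; apply: ler_sum => i _.
  by rewrite mulrCA ler_wpM2l// sum_hit_gamma.
rewrite -mulrA ler_wpM2l// sum_triangle /hit_mean mulr_sumr.
apply: ler_sum_nat => j j_z; rewrite expr2 -!mulrA mulrCA mulrA.
rewrite [leLHS](_ : _ = (j%:R * \sum_(j <= i < z.+1) (p i)^-1)
  * (j%:R * (p j)^-1)); last by ring.
by rewrite ler_wpM2r ?mulr_ge0// HW.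
Qed.

(* Strong Markov property at the hitting time [tau] of [z]: after [tau] the bound
   [S] applies, before it [f <= 1], so that [bd_iter p t f 0 <= S + P (tau > t)];
   then Chebyshev's inequality. *)
Lemma hit_upper z (t : nat) f S :
  (z <= n)%N -> (forall y, f y <= 1) -> 0 <= S ->
  (forall m, bd_iter p m f z <= S) -> hit_mean p z 0 <= t%:R ->
  (bd_iter p t f 0 - S) * (t%:R - hit_mean p z 0) ^+ 2 <= hit_var p z 0.
Proof.
move=> zn f1 S0 fS; set M := hit_mean p z 0 => Mt.
suff H j y : (j <= t)%N -> (y <= z)%N -> (bd_iter p j f y - S) * (t%:R - M) ^+ 2
    <= hit_moment2 z M (t%:R - j%:R) y.
  apply: le_trans (H t 0%N (leqnn t) (leq0n z)) _.
  by rewrite /hit_moment2 subrr add0r /M subrr expr0n add0r.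
elim: j y => [|j IHj] y jt yz; move: (yz);
    rewrite leq_eqVlt => /orP[/eqP yz'|yz'].
- rewrite yz'; apply: (@le_trans _ _ 0).
    by rewrite mulr_le0_ge0 ?sqr_ge0// subr_le0 fS.
  by rewrite /hit_moment2 addr_ge0 ?sqr_ge0 ?hit_var_ge0.
- rewrite subr0 /=; apply: (@le_trans _ _ ((t%:R - M) ^+ 2)).
    by rewrite ler_piMl ?sqr_ge0//; have := f1 y; lra.
  rewrite /hit_moment2 -[leLHS]addr0 lerD ?hit_var_ge0//.
  have := hit_mean_ge0 z y; set h := hit_mean p z y => h0.
  by rewrite ler_pXn2r// ?nnegrE; lra.
- rewrite yz'; apply: (@le_trans _ _ 0).
    by rewrite mulr_le0_ge0 ?sqr_ge0// subr_le0 fS.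
  by rewrite /hit_moment2 addr_ge0 ?sqr_ge0 ?hit_var_ge0.
- have -> : (bd_iter p j.+1 f y - S) * (t%:R - M) ^+ 2 =
      bd_op p (fun y => (bd_iter p j f y - S) * (t%:R - M) ^+ 2) y.
    by rewrite bd_iterS /bd_op; ring.
  apply: le_trans (hit_moment2_op M (t%:R - j.+1%:R) _); last by rewrite yz'.
  rewrite -natr1 opprD addrA subrK.
  by apply: (bd_op_le wp); apply: IHj; lia.
Qed.

(** The chain is at or above [z] at time [t] only if it has hit [z] by then; Chebyshev's inequality
    bounds the probability of so early a hit. *)
Lemma hit_lower z (t : nat) :
  (z <= n)%N -> t%:R <= hit_mean p z 0 ->
  (1 - bd_iter p t (below R z) 0) * (hit_mean p z 0 - t%:R) ^+ 2
    <= hit_var p z 0.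
Proof.
move=> zn; set M := hit_mean p z 0 => Mt.
suff H j y : (j <= t)%N -> (y <= z)%N ->
    (1 - bd_iter p j (below R z) y) * (M - t%:R) ^+ 2
    <= hit_moment2 z M (t%:R - j%:R) y.
  apply: le_trans (H t 0%N (leqnn t) (leq0n z)) _.
  by rewrite /hit_moment2 subrr add0r /M subrr expr0n add0r.
have b0 m y' : 0 <= bd_iter p m (below R z) y'.
  by apply: (bd_iter_ge0 wp) => ?; rewrite /below ler0n.
(* With [m] steps left the clock shows [t - m], which lies below [M] by at least [M - t]. *)
have Hz m : (m <= t)%N -> (1 - bd_iter p m (below R z) z) * (M - t%:R) ^+ 2
    <= hit_moment2 z M (t%:R - m%:R) z.
  move=> mt; apply: (@le_trans _ _ ((M - t%:R) ^+ 2)).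
    by rewrite ler_piMl ?sqr_ge0//; have := b0 m z; lra.
  rewrite /hit_moment2 /hit_mean /hit_var !big_geq// !addr0.
  have : 0 <= m%:R :> R by [].
  have : m%:R <= t%:R :> R by rewrite ler_nat.
  by nra.
elim: j y => [|j IHj] y jt yz; move: (yz);
    rewrite leq_eqVlt => /orP[/eqP yz'|yz'].
- by rewrite yz'; exact: Hz.
- rewrite /= /below yz' subrr mul0r.
  by rewrite /hit_moment2 addr_ge0 ?sqr_ge0 ?hit_var_ge0.
- by rewrite yz'; exact: Hz.
- have -> : (1 - bd_iter p j.+1 (below R z) y) * (M - t%:R) ^+ 2 =
      bd_op p (fun y => (1 - bd_iter p j (below R z) y) * (M - t%:R) ^+ 2) y.
    by rewrite bd_iterS /bd_op; ring.
  apply: le_trans (hit_moment2_op M (t%:R - j.+1%:R) _); last by rewrite yz'.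
  rewrite -natr1 opprD addrA subrK.
  by apply: (bd_op_le wp); apply: IHj; lia.
Qed.

Lemma hit_mean_anti z x y : (x <= y <= z)%N -> hit_mean p z y <= hit_mean p z x.
Proof.
move=> /andP[xy yz]; rewrite /hit_mean (@big_cat_nat _ _ _ y.+1 x.+1)//=.
by rewrite lerDr sumr_ge0// => i _; rewrite mulr_ge0.
Qed.

(** A first moment bound that needs no concentration: below [z] the potential [hit_mean] loses
    exactly one per step on average, and it never exceeds its value at [0], so the chain must still
    be below [z] with probability at least [1 - t / M]. *)
Lemma hit_markov z (t : nat) : (z <= n)%N ->
  hit_mean p z 0 - t%:R <= bd_iter p t (below R z) 0 * hit_mean p z 0.
Proof.
move=> zn; set M := hit_mean p z 0.
have b0 m y' : 0 <= bd_iter p m (below R z) y'.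
  by apply: (bd_iter_ge0 wp) => ?; rewrite /below ler0n.
suff H j y : (y <= z)%N ->
    hit_mean p z y - j%:R <= bd_iter p j (below R z) y * M by exact: H.
have Hz m : hit_mean p z z - m%:R <= bd_iter p m (below R z) z * M.
  apply: (@le_trans _ _ 0); last by rewrite mulr_ge0// hit_mean_ge0.
  by rewrite /hit_mean big_geq// sub0r oppr_le0.
elim: j y => [|j IHj] y; rewrite leq_eqVlt => /orP[/eqP ->|yz]//.
  by rewrite subr0 /= /below yz mul1r hit_mean_anti//= ltnW.
have -> : bd_iter p j.+1 (below R z) y * M =
    bd_op p (fun y => bd_iter p j (below R z) y * M) y.
  by rewrite bd_iterS /bd_op; ring.
have -> : hit_mean p z y - j.+1%:R =
    bd_op p (fun y => hit_mean p z y - j%:R) y.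
  transitivity (bd_op p (hit_mean p z) y - j%:R); last by rewrite /bd_op; ring.
  by rewrite hit_mean_op ?yz// -natr1; ring.
by apply: (bd_op_le wp); apply: IHj; lia.
Qed.

End Weights.
End Hitting.

(** * Reflection and smoothing *)

Section Smoothing.
Variable R : realFieldType.
Implicit Types (f g p : nat -> R).

Lemma sum_below N a : (a <= N)%N -> \sum_(0 <= y < N) below R a y = a%:R.
Proof.
move=> aN; rewrite (@big_cat_nat _ _ _ a)//= (@eq_big_nat _ _ _ 0 a _ (fun=> 1)).
  rewrite big_const_nat subn0 iter_addr_0 [X in _ + X]big1_seq ?addr0//.
  by move=> i; rewrite mem_index_iota /below => /andP[_ /andP[ai _]]; rewrite ltnNge ai.
by move=> i /andP[_ ia]; rewrite /below ia.
Qed.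

Lemma eq_bd_iter_n n delta p (wp : bd_weights n delta p) m f g :
  (forall y, (y <= n)%N -> f y = g y) ->
  forall y, (y <= n)%N -> bd_iter p m f y = bd_iter p m g y.
Proof.
move=> fg y yn; apply/eqP; rewrite eq_le.
by rewrite !(bd_iter_le_n wp)// => z zn; rewrite fg.
Qed.

Section Weights.
Variables (n : nat) (delta : R) (p : nat -> R).
Hypothesis wp : bd_weights n delta p.

Definition rev_weights (i : nat) := p (n.+1 - i).

Lemma rev_weightsP : bd_weights n delta rev_weights.
Proof.
case: wp => p0 pn pgt [d0 ple]; rewrite /rev_weights; split=> [|i ni|i i_n|].
- by rewrite subn0 pn.
- by rewrite (eqP ni).
- by rewrite pgt; lia.
- by split.
Qed.

Lemma bd_iter_rev m f y : (y <= n)%N ->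
  bd_iter rev_weights m (fun y => f (n - y)%N) y = bd_iter p m f (n - y)%N.
Proof.
elim: m y => [//|m IHm] y yn; rewrite !bd_iterS /bd_op /rev_weights.
rewrite (IHm _ yn) (IHm y.-1); last by lia.
have -> : (n.+1 - y.+1 = n - y)%N by lia.
rewrite [in LHS]addrAC; congr (_ + _ + _).
  have [yn'|yn'] := ltnP y n; first by rewrite IHm// subnS.
  have -> : (n - y = 0)%N by lia.
  by case: wp => -> _ _ _; rewrite !mul0r.
have [->|y0] := posnP y.
  by rewrite !subn0; case: wp => _ -> // _ _; rewrite !mul0r.
have -> : (n.+1 - y = (n - y).+1)%N by lia.
by have -> : (n - y.-1 = (n - y).+1)%N by lia.
Qed.

(** Monotonicity places the distribution function from [x] between those from [n] and from [0]. The
    upper bound comes from [0]; the lower bound from [n] is the upper bound for the reflected chain,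
    applied to the complementary segment. *)
Lemma kolmogorov (t : nat) (eta : R) :
  (forall a, (a <= n.+1)%N ->
     bd_iter p t (below R a) 0 <= a%:R / n.+1%:R + eta) ->
  (forall a, (a <= n.+1)%N ->
     bd_iter rev_weights t (below R a) 0 <= a%:R / n.+1%:R + eta) ->
  forall x a, (x <= n)%N -> (a <= n.+1)%N ->
    `|bd_iter p t (below R a) x - a%:R / n.+1%:R| <= eta.
Proof.
move=> H0 H1 x a xn an.
have d : decr_on n (bd_iter p t (below R a)).
  by apply: (bd_iter_decr wp); exact: below_decr.
have le0 : bd_iter p t (below R a) x <= bd_iter p t (below R a) 0.
  by apply: (decr_on_le d); lia.
have ge0 : bd_iter p t (below R a) n <= bd_iter p t (below R a) x.
  by apply: (decr_on_le d); lia.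
have := H0 a an; have := H1 (n.+1 - a)%N (leq_subr _ _).
have -> : bd_iter rev_weights t (below R (n.+1 - a)) 0 =
    1 - bd_iter p t (below R a) n.
  transitivity (bd_iter p t (fun y => 1 - below R a y) (n - 0)%N); last first.
    by rewrite subn0 bd_iterB bd_iter_cst.
  rewrite -bd_iter_rev//; apply: (eq_bd_iter_n rev_weightsP) => // y yn.
  rewrite /below; have [h|h] := ltnP y (n.+1 - a)%N.
    by (have -> : (n - y < a)%N = false by lia); rewrite /= subr0.
  by (have -> : (n - y < a)%N by lia); rewrite /= subrr.
rewrite natrB// mulrBl divff ?pnatr_eq0//.
set w := a%:R / _ => h1 h2.
by rewrite ler_norml; apply/andP; split; lra.
Qed.

(* With [q i = p i * (g i - g (i - 1))], [g - bd_op p g] is the divergence of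
   [q], whence the squared norm of [g - bd_op p g] is at most twice
   [2 * sum q^2 <= (1 - delta) * sum q * grad g]. *)
Lemma bd_op_energy g :
  2 * delta * \sum_(1 <= i < n.+1) p i * (g i - g i.-1) ^+ 2
  <= \sum_(0 <= y < n.+1) g y ^+ 2 - \sum_(0 <= y < n.+1) bd_op p g y ^+ 2.
Proof.
set q := fun i => p i * (g i - g i.-1).
have q0 : q 0%N = 0 by rewrite /q; case: wp => ->; rewrite mul0r.
have qn : q n.+1 = 0 by rewrite /q; case: wp => _ -> //; rewrite mul0r.
have lE y : g y - bd_op p g y = q y - q y.+1 by rewrite /q /bd_op /=; ring.
set S := \sum_(1 <= i < n.+1) _.
have e1 : \sum_(0 <= y < n.+1) g y * (g y - bd_op p g y) = S.
  by rewrite (dirichlet wp); apply: eq_bigr => i _; rewrite expr2.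
have e2 : \sum_(0 <= y < n.+1) (g y - bd_op p g y) ^+ 2 <=
    2 * (1 - delta) * S.
  apply: (@le_trans _ _ (\sum_(0 <= y < n.+1) (2 * q y ^+ 2 + 2 * q y.+1 ^+ 2))).
    apply: ler_sum => y _; rewrite lE.
    by have := sqr_ge0 (q y + q y.+1); nra.
  have e3 : \sum_(0 <= y < n.+1) q y ^+ 2 = \sum_(1 <= y < n.+1) q y ^+ 2.
    by rewrite big_ltn// q0 expr0n add0r.
  have e4 : \sum_(0 <= y < n.+1) q y.+1 ^+ 2 = \sum_(1 <= y < n.+1) q y ^+ 2.
    rewrite -(big_add1 _ _ 0 n.+2 xpredT (fun y => q y ^+ 2)).
    by rewrite big_nat_recr//= qn expr0n addr0.
  rewrite big_split/= -!mulr_sumr e3 e4 -mulrDl !mulr_sumr.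
  apply: ler_sum => i _; rewrite /q exprMn.
  have := weights_le wp i; have := weights_ge0 wp i.
  have := sqr_ge0 (g i - g i.-1); set D := (_ ^+ 2).
  move=> D0 p0 pl; rewrite -subr_ge0.
  rewrite [X in 0 <= X](_ : _ = 2 * (p i * ((1 - delta) - 2 * p i)) * D); last by ring.
  by rewrite mulr_ge0// mulr_ge0// mulr_ge0//; lra.
have -> : \sum_(0 <= y < n.+1) g y ^+ 2 - \sum_(0 <= y < n.+1) bd_op p g y ^+ 2
  = 2 * \sum_(0 <= y < n.+1) g y * (g y - bd_op p g y)
    - \sum_(0 <= y < n.+1) (g y - bd_op p g y) ^+ 2.
  by rewrite mulr_sumr -!sumrB; apply: eq_bigr => y _; ring.
by rewrite e1; lra.
Qed.

Let sqnorm m f := \sum_(0 <= y < n.+1) bd_iter p m f y ^+ 2.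

(** With [g] the [m]-th iterate, self-adjointness turns the second difference into the squared norm
    of [g - bd_op p (bd_op p g)]. *)
Lemma sqnorm_convex m f : sqnorm m.+1 f - sqnorm m.+2 f <= sqnorm m f - sqnorm m.+1 f.
Proof.
pose g := bd_iter p m f.
have -> : sqnorm m f = \sum_(0 <= y < n.+1) g y ^+ 2 by [].
have -> : sqnorm m.+1 f = \sum_(0 <= y < n.+1) bd_op p g y ^+ 2 by [].
have -> : sqnorm m.+2 f = \sum_(0 <= y < n.+1) bd_op p (bd_op p g) y ^+ 2 by [].
have e : \sum_(0 <= y < n.+1) bd_op p g y ^+ 2 =
    \sum_(0 <= y < n.+1) g y * bd_op p (bd_op p g) y.
  by rewrite (bd_op_sym wp); apply: eq_bigr => y _; rewrite expr2.
rewrite -subr_ge0 e -!sumrB sumr_ge0// => y _.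
have := sqr_ge0 (g y - bd_op p (bd_op p g) y); nra.
Qed.

(** By convexity the last drop of the squared norm is at most each of the [s] previous ones, whose
    total is at most [n.+1]; laziness converts that drop into energy. *)
Lemma smoothing_energy s f : (forall y, 0 <= f y <= 1) ->
  2 * delta * s%:R *
    \sum_(1 <= i < n.+1) p i * (bd_iter p s f i - bd_iter p s f i.-1) ^+ 2
  <= n.+1%:R.
Proof.
move=> f01.
have a0 : sqnorm 0 f <= n.+1%:R.
  rewrite /sqnorm /=; apply: (@le_trans _ _ (\sum_(0 <= y < n.+1) 1)).
    by apply: ler_sum => y _; have /andP[] := f01 y; nra.
  by rewrite big_const_nat subn0 iter_addr_0.
have as0 : 0 <= sqnorm s f by apply: sumr_ge0 => y _; exact: sqr_ge0.
have H k : (k <= s)%N ->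
    k%:R * (sqnorm s f - sqnorm s.+1 f) <= sqnorm (s - k)%N f - sqnorm s f.
  have D j : (j <= s)%N -> sqnorm s f - sqnorm s.+1 f <=
      sqnorm (s - j)%N f - sqnorm (s - j).+1 f.
    elim: j => [|j IHj] js; first by rewrite subn0.
    apply: le_trans (IHj (ltnW js)) _.
    have -> : (s - j = (s - j.+1).+1)%N by lia.
    exact: sqnorm_convex.
  elim: k => [|k IHk] ks; first by rewrite mul0r subn0 subrr.
  have := D _ ks; have := IHk (ltnW ks); rewrite -natr1 mulrDl mul1r.
  have -> : ((s - k.+1).+1 = s - k)%N by lia.
  lra.
have := H s (leqnn s); rewrite subnn => Hs.
have := bd_op_energy (bd_iter p s f); rewrite -/(sqnorm s f).
rewrite -[X in _ - X]/(sqnorm s.+1 f).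
set E := bigop _ _ _; set a := sqnorm s f in Hs as0 *; set b := sqnorm s.+1 f in Hs *.
move=> h; have : s%:R * (2 * delta * E) <= s%:R * (a - b) by rewrite ler_wpM2l.
lra.
Qed.

(** Variation is controlled by energy and resistance: after [s] steps the energy is at most
    [n.+1 / C], and the resistance of the window at most [C / l], so [C] cancels. *)
Lemma variation_le l (s : nat) (C : R) f : (forall y, 0 <= f y <= 1) ->
  (0 < l)%N -> 0 < C ->
  l%:R * (\sum_(l <= i < (n.+1 - l).+1) (p i)^-1) <= C -> C <= delta * s%:R ->
  \sum_(l.+1 <= i < (n - l).+1) `|bd_iter p s f i - bd_iter p s f i.-1|
  <= n.+1%:R / l%:R + 1.
Proof.
move=> f01 l0 C0 RC Cs; set g := bd_iter p s f.
set N : R := n.+1%:R; have N0 : 0 < N by rewrite ltr0n.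
set k := N / C; have k0 : 0 < k by rewrite divr_gt0.
(* AM-GM: [2 |D| <= k / p i + p i D^2 / k]. *)
have step i : (l.+1 <= i < (n - l).+1)%N -> `|g i - g i.-1| <=
    2^-1 * (k * (p i)^-1 + k^-1 * (p i * (g i - g i.-1) ^+ 2)).
  move=> il; set D := `|_|; rewrite -[(g i - _) ^+ 2]real_normK ?num_real// -/D.
  have p0 : 0 < p i by case: wp => _ _ -> //; lia.
  rewrite -subr_ge0 (_ : _ - _ = (2 * k * p i)^-1 * (k - p i * D) ^+ 2).
    rewrite mulr_ge0 ?sqr_ge0// invr_ge0 ltW//.
    by apply: mulr_gt0 => //; apply: mulr_gt0.
  by field; rewrite !gt_eqF.
apply: le_trans (ler_sum_nat step) _.
rewrite -mulr_sumr big_split/= -!mulr_sumr.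
have h1 : \sum_(l.+1 <= i < (n - l).+1) (p i)^-1 <= C / l%:R.
  rewrite ler_pdivlMr ?ltr0n// mulrC; apply: le_trans RC; rewrite ler_wpM2l//.
  have [nl|nl] := leqP (n - l).+1 l.+1.
    by rewrite big_geq// sumr_ge0// => i _; exact: (weights_inv_ge0 wp i).
  rewrite [leRHS](@big_cat_nat _ _ _ l.+1)//=; last by lia.
  rewrite [X in _ <= _ + X](@big_cat_nat _ _ _ (n - l).+1)//=; [|lia|lia].
  rewrite addrCA lerDl addr_ge0// sumr_ge0// => i _; exact: (weights_inv_ge0 wp i).
have h2 : \sum_(l.+1 <= i < (n - l).+1) p i * (g i - g i.-1) ^+ 2 <= N / C.
  apply: (@le_trans _ _ (\sum_(1 <= i < n.+1) p i * (g i - g i.-1) ^+ 2)).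
    have P i : 0 <= p i * (g i - g i.-1) ^+ 2.
      by rewrite mulr_ge0 ?sqr_ge0 ?(weights_ge0 wp).
    have [nl|nl] := leqP (n - l).+1 l.+1.
      by rewrite big_geq// sumr_ge0.
    rewrite [leRHS](@big_cat_nat _ _ _ l.+1)//=; last by lia.
    rewrite [X in _ <= _ + X](@big_cat_nat _ _ _ (n - l).+1)//=; [|lia|lia].
    by rewrite addrCA lerDl addr_ge0// sumr_ge0.
  rewrite ler_pdivlMr//; have := smoothing_energy s f01; rewrite -/g -/N.
  set E := bigop _ _ _ => h; apply: le_trans h.
  have E0 : 0 <= E.
    by apply: sumr_ge0 => i _; rewrite mulr_ge0 ?sqr_ge0 ?(weights_ge0 wp).
  by nra.
have h1' : k * (\sum_(l.+1 <= i < (n - l).+1) (p i)^-1) <= N / l%:R.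
  apply: le_trans (ler_wpM2l (ltW k0) h1) _.
  by rewrite /k mulrA mulfVK ?gt_eqF.
have h2' : k^-1 * (\sum_(l.+1 <= i < (n - l).+1) p i * (g i - g i.-1) ^+ 2) <= 1.
  by rewrite mulrC ler_pdivrMr// mul1r.
have : 0 <= N / l%:R by rewrite divr_ge0// ltW.
lra.
Qed.

Lemma sum_steps_below g l u y : (l <= u)%N ->
  \sum_(l.+1 <= i < u.+1) (g i - g i.-1) * (1 - below R i y) =
  g (maxn l (minn u y)) - g l.
Proof.
elim: u => [|u IHu].
  by rewrite leqn0 => /eqP ->; rewrite big_geq// min0n maxnn subrr.
rewrite leq_eqVlt => /orP[/eqP <-|lu].
  by rewrite big_geq// (maxn_idPl _) ?subrr// geq_minl.
rewrite big_nat_recr//= IHu// /below; have [yu|yu] := ltnP y u.+1.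
  rewrite subrr mulr0 addr0; congr (g _ - _); lia.
rewrite subr0 mulr1; have -> : maxn l (minn u y) = u by lia.
have -> : maxn l u.+1 = u.+1 by lia.
by ring.
Qed.

(* Closeness of the distribution functions becomes closeness in total variation
   after [s] more steps: [bd_iter p s f] has bounded variation on [[l, n - l]],
   and the two end pieces carry little mass. *)
Lemma smoothing l (t s : nat) (C eta : R) f : (forall y, 0 <= f y <= 1) ->
  (0 < l)%N -> (l.*2 <= n)%N -> 0 < C ->
  l%:R * (\sum_(l <= i < (n.+1 - l).+1) (p i)^-1) <= C -> C <= delta * s%:R ->
  (forall x a, (x <= n)%N -> (a <= n.+1)%N ->
    `|bd_iter p t (below R a) x - a%:R / n.+1%:R| <= eta) ->
  forall x, (x <= n)%N ->
  bd_iter p (t + s) f x - (\sum_(0 <= y < n.+1) f y) / n.+1%:R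
  <= eta * (n.+1%:R / l%:R + 3) + 4 * (l%:R / n.+1%:R).
Proof.
move=> f01 l0 ln C0 RC Cs K x xn.
rewrite bd_iterD -(bd_iter_total wp s f); have := variation_le f01 l0 C0 RC Cs.
set g := bd_iter p s f; set N : R := n.+1%:R.
have N0 : 0 < N by rewrite ltr0n.
have g0 y : 0 <= g y by apply: (bd_iter_ge0 wp) => z; have /andP[] := f01 z.
have g1 y : g y <= 1 by apply: (bd_iter_le1 wp) => z; have /andP[] := f01 z.
set u := (n - l)%N; have lu : (l <= u)%N by lia.
have lN : (l <= n.+1)%N by clear -ln; lia.
have uN : u.+1 = (n.+1 - l)%N by rewrite /u; clear -ln; lia.
set s1 := index_iota l.+1 u.+1.
set V := bigop _ _ _ => HV.
(* This is [g] clamped to [[l, u]], minus [g l]. Its mean under any law involves only distribution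
   functions, so their error enters multiplied by the variation [V]; outside the window
   [0 <= g <= 1] suffices. *)
set gt := fun y => \sum_(i <- s1) (g i - g i.-1) * (1 - below R i y).
have gtE y : gt y = g (maxn l (minn u y)) - g l by exact: sum_steps_below.
have hT : bd_iter p t g x <= g l + \sum_(i <- s1) (g i - g i.-1) *
    (1 - bd_iter p t (below R i) x) + bd_iter p t (below R l) x
    + (1 - bd_iter p t (below R u.+1) x).
  have -> : \sum_(i <- s1) (g i - g i.-1) * (1 - bd_iter p t (below R i) x) =
      bd_iter p t gt x.
    rewrite /gt bd_iter_sum; apply: eq_bigr => i _.
    by rewrite bd_iterB bd_iter_cst.
  have -> : g l + bd_iter p t gt x + bd_iter p t (below R l) x
     + (1 - bd_iter p t (below R u.+1) x) = bd_iter p t (fun y =>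
     1 * (1 * (1 * g l + 1 * gt y) + 1 * below R l y) + 1 * (1 - below R u.+1 y)) x.
    by rewrite !bd_iter_lin bd_iterB !bd_iter_cst; ring.
  apply: (bd_iter_le wp) => y; rewrite gtE /below.
  have := g1 y; have := g0 (maxn l (minn u y)).
  have [yl|yl] := ltnP y l; first by (have -> : (y < u.+1)%N by lia); lra.
  have [yu|yu] := ltnP y u.+1; last by lra.
  by (have -> : maxn l (minn u y) = y by lia); rewrite /=; lra.
have hA : N * g l + \sum_(i <- s1) (g i - g i.-1) * (N - i%:R)
     - l%:R - (N - u.+1%:R) <= \sum_(0 <= y < n.+1) g y.
  have -> : \sum_(i <- s1) (g i - g i.-1) * (N - i%:R) =
      \sum_(0 <= y < n.+1) gt y.
    rewrite exchange_big/= !big_seq; apply: eq_bigr => i.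
    rewrite mem_index_iota => i1; rewrite -mulr_sumr sumrB sum_below ?big_const_nat.
      by rewrite subn0 iter_addr_0.
    lia.
  have -> : N * g l = \sum_(0 <= y < n.+1) g l.
    by rewrite big_const_nat subn0 iter_addr_0 mulr_natl.
  have -> : N - u.+1%:R = \sum_(0 <= y < n.+1) (1 - below R u.+1 y).
    rewrite sumrB sum_below ?big_const_nat ?subn0 ?iter_addr_0//; lia.
  have -> : l%:R = \sum_(0 <= y < n.+1) below R l y.
    by rewrite sum_below//; lia.
  rewrite -big_split/= -!sumrB; apply: ler_sum => y _; rewrite gtE /below.
  have := g0 y; have := g1 (maxn l (minn u y)).
  have [yl|yl] := ltnP y l; first by (have -> : (y < u.+1)%N by lia); lra.
  have [yu|yu] := ltnP y u.+1; last by lra.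
  by (have -> : maxn l (minn u y) = y by lia); rewrite /=; lra.
have hS : \sum_(i <- s1) (g i - g i.-1) * (i%:R / N - bd_iter p t (below R i) x)
    <= V * eta.
  rewrite /V mulr_suml !big_seq; apply: ler_sum => i.
  rewrite mem_index_iota => i1; apply: le_trans (ler_norm _) _.
  by rewrite normrM ler_wpM2l// distrC K//; lia.
have hS' : \sum_(i <- s1) (g i - g i.-1) * (1 - bd_iter p t (below R i) x)
   - (\sum_(i <- s1) (g i - g i.-1) * (N - i%:R)) / N =
   \sum_(i <- s1) (g i - g i.-1) * (i%:R / N - bd_iter p t (below R i) x).
  rewrite mulr_suml -sumrB; apply: eq_bigr => i _.
  by field; rewrite nat1r pnatr_eq0.
have hl : `|bd_iter p t (below R l) x - l%:R / N| <= eta by apply: K.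
have hu : `|bd_iter p t (below R u.+1) x - u.+1%:R / N| <= eta.
  by apply: K => //; rewrite uN leq_subr.
move: hl hu; rewrite !ler_norml => /andP[_ hl] /andP[hu _].
have uE : u.+1%:R = N - l%:R :> R by rewrite uN natrB.
have eta0 : 0 <= eta by apply: le_trans (K 0%N 0%N _ _).
have hA' : g l + (\sum_(i <- s1) (g i - g i.-1) * (N - i%:R)) / N - l%:R / N
   - l%:R / N <= (\sum_(0 <= y < n.+1) g y) / N.
  rewrite ler_pdivlMr//; apply: le_trans hA; rewrite uE le_eqVlt; apply/orP; left.
  by apply/eqP; field; rewrite nat1r pnatr_eq0.
have hV : V * eta <= (N / l%:R + 1) * eta by rewrite ler_wpM2r.
move: hu; rewrite uE mulrBl divff ?gt_eqF//.
set a1 := \sum_(i <- s1) _ in hT hS'; set a2 := (bigop _ _ _ / N) in hS' hA'.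
set a3 := bigop _ _ _ in hS hS'; set q := N / l%:R in hV *.
set w := l%:R / N in hA' hl *.
set av := (_ / N) in hA' *.
move: hS hS' hT hA' hl hV eta0.
move: a1 a2 a3 q w av (V * eta) (bd_iter p t g x) (bd_iter p t (below R l) x)
  (bd_iter p t (below R u.+1) x) (g l) => *.
by nra.
Qed.

End Weights.
End Smoothing.

(** * Slow modes *)

Section SlowMode.
Variable R : realFieldType.
Variables (n : nat) (delta : R) (p : nat -> R).
Hypothesis wp : bd_weights n delta p.

Let N : R := n.+1%:R.

(* Green function (times [N]) of the second difference on [{0, ..., N}] with
   Dirichlet boundary conditions. *)
Definition green (i j : nat) : R :=
  if (i <= j)%N then i%:R * (N - j%:R) else j%:R * (N - i%:R).

Lemma green_ge0 i j : (i <= n.+1)%N -> (j <= n.+1)%N -> 0 <= green i j.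
Proof.
move=> iN jN; have : i%:R <= N by rewrite ler_nat.
have : j%:R <= N by rewrite ler_nat.
by move=> ? ?; rewrite /green; case: ifP => _; rewrite mulr_ge0// subr_ge0.
Qed.

Lemma green_laplace i j :
  2 * green i.+1 j - green i j - green i.+2 j = if i.+1 == j then N else 0.
Proof.
rewrite /green; have [ij|ij|<-] := ltngtP i.+1 j.
- by rewrite (ltnW (ltnW ij)) -!natr1; ring.
- have [ij'|ij'] := leqP i j; last by rewrite -!natr1; ring.
  have -> : i = j by lia.
  by rewrite -!natr1; ring.
- by rewrite leqnSn -!natr1; ring.
Qed.

Variables (I : pred nat) (i0 : nat) (sigma rho : R).
Hypothesis Ii0 : I i0.
Hypothesis Irange : forall i, I i -> (0 < i <= n)%N.
Hypothesis sigma0 : 0 < sigma.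
Hypothesis Igreen : forall i j, I i -> I j -> N * sigma <= green i j.
Hypothesis rhoP :
  1 <= rho * (sigma * \sum_(1 <= j < n.+1 | I j) (p j)^-1) /\ rho <= 1.

Let r i := (p i)^-1.
Let r0 i : 0 <= r i := weights_inv_ge0 wp i.
Let RI := \sum_(1 <= j < n.+1 | I j) r j.

Let RI0 : 0 <= RI.
Proof. by apply: sumr_ge0. Qed.

Let rho0 : 0 < rho.
Proof.
case: rhoP => h _; rewrite -/RI in h; rewrite ltNge; apply/negP => h'.
have : rho * (sigma * RI) <= 0 by rewrite mulr_le0_ge0// mulr_ge0// ltW.
lra.
Qed.

(* The slow mode has gradient [r i * flux i], where minus the second difference
   of [flux] is [N * r i] on [I] and [0] elsewhere; since [flux] is at least
   [N * sigma * sum_I r] on [I], one step of the chain contracts each gradient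
   by a factor at least [1 - rho]. *)
Definition flux (i : nat) : R := \sum_(1 <= j < n.+1 | I j) r j * green i j.

Lemma flux_ge0 i : (i <= n.+1)%N -> 0 <= flux i.
Proof.
move=> iN; rewrite /flux big_nat_cond; apply: sumr_ge0 => j /andP[/andP[_ jn] _].
by rewrite mulr_ge0// green_ge0// ltnW.
Qed.

Lemma flux0 : flux 0 = 0.
Proof. by apply: big1 => j _; rewrite /green mul0r mulr0. Qed.

Lemma fluxN : flux n.+1 = 0.
Proof.
rewrite /flux big_nat_cond; apply: big1 => j /andP[/andP[_ jn] _].
by rewrite /green leqNgt jn /= subrr !mulr0.
Qed.

Lemma flux_laplace i : (i < n)%N ->
  2 * flux i.+1 - flux i - flux i.+2 = if I i.+1 then N * r i.+1 else 0.
Proof.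
move=> i_n; rewrite /flux mulr_sumr -!sumrB.
rewrite (eq_bigr (fun j => if j == i.+1 then N * r j else 0)); last first.
  move=> j _; rewrite eq_sym -(mulr0 (r j)) [N * _]mulrC -fun_if -green_laplace.
  by ring.
rewrite -big_mkcondr /= (eq_bigl (fun j => (j == i.+1) && I i.+1)); last first.
  by move=> j; rewrite andbC; case: eqP => [->|].
rewrite big_nat_cond; case: ifP => Ii; last first.
  by rewrite big1// => j /andP[_ /andP[]].
rewrite (eq_bigl (fun j => (j == i.+1))); last first.
  by move=> j; rewrite andbT; case: eqP => [->|_]; rewrite ?andbF// andbT; lia.
by rewrite -big_filter filter_pred1_uniq ?iota_uniq ?mem_index_iota// big_seq1.
Qed.

Lemma flux_lower i : I i -> N * sigma * RI <= flux i.
Proof.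
move=> Ii; rewrite /flux mulrC mulr_suml; apply: ler_sum => j Ij.
by rewrite ler_wpM2l// Igreen.
Qed.

Definition slow_mode (y : nat) : R :=
  \sum_(1 <= i < n.+1) (r i * flux i) * below R i y.

Lemma slow_modeS y : (y < n)%N ->
  slow_mode y = r y.+1 * flux y.+1 + slow_mode y.+1.
Proof.
have E z : (z <= n)%N -> slow_mode z = \sum_(z.+1 <= i < n.+1) r i * flux i.
  move=> zn; rewrite /slow_mode (@big_cat_nat _ _ _ z.+1)//=.
  rewrite [X in X + _]big_nat [X in X + _]big1 ?add0r; last first.
    by move=> i /andP[_ iz]; rewrite /below ltnNge -ltnS iz mulr0.
  by apply: eq_big_nat => i /andP[zi _]; rewrite /below zi mulr1.
by move=> yn; rewrite !E// ?(ltnW yn)// big_ltn.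
Qed.

Lemma slow_mode_n : slow_mode n = 0.
Proof.
rewrite /slow_mode big_nat big1// => i /andP[_ iN].
by rewrite /below ltnNge -ltnS iN mulr0.
Qed.

Lemma slow_mode_op y : (y <= n)%N ->
  bd_op p slow_mode y = slow_mode y + flux y - flux y.+1.
Proof.
move=> yn; rewrite /bd_op.
have e1 : p y * (slow_mode y.-1 - slow_mode y) = flux y.
  case: y yn => [|y] yn; first by case: wp => -> _ _ _; rewrite mul0r flux0.
  by rewrite slow_modeS// addrK mulrA (weights_mulV wp)// mul1r.
have e2 : p y.+1 * (slow_mode y.+1 - slow_mode y) = - flux y.+1.
  move: yn; rewrite leq_eqVlt => /orP[/eqP ->|yn].
    by case: wp => _ -> // _ _; rewrite mul0r fluxN oppr0.
  rewrite [slow_mode y]slow_modeS// opprD addrCA subrr addr0 mulrN mulrA.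
  by rewrite (weights_mulV wp)// mul1r.
by rewrite e1 e2.
Qed.

(** For one step, the decrement of [bd_op p slow_mode - (1 - rho) * slow_mode] is [rho * r * flux]
    minus the Laplacian term [N * r] on [I], and [rho * flux >= N] there. The induction applies
    [bd_op], which preserves monotonicity, to the previous difference. *)
Lemma slow_mode_decr m :
  decr_on n (fun y => bd_iter p m slow_mode y - (1 - rho) ^+ m * slow_mode y).
Proof.
elim: m => [|m IHm].
  move=> y _; by rewrite /= !mul1r !subrr.
have D1 : decr_on n (fun y => bd_op p slow_mode y - (1 - rho) * slow_mode y).
  move=> y yn; rewrite !slow_mode_op// ?(ltnW yn)// (slow_modeS yn) -subr_ge0.
  set J := flux y; set J1 := flux y.+1; set J2 := flux y.+2.
  rewrite [X in 0 <= X](_ : _ = rho * (r y.+1 * J1) - (2 * J1 - J - J2)); last by ring.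
  rewrite flux_laplace// subr_ge0; case: ifP => Iy; last first.
    rewrite mulr_ge0 ?(ltW rho0)// mulr_ge0//; apply: flux_ge0; lia.
  rewrite mulrCA [leLHS]mulrC ler_wpM2l//.
  apply: (@le_trans _ _ (rho * (N * sigma * RI))); last first.
    by rewrite ler_wpM2l ?flux_lower// ltW.
  have [h _] := rhoP; rewrite -/RI in h.
  have : 0 <= N by []. nra.
have D2 := bd_op_decr wp IHm.
move=> y yn; have := D1 y yn; have := D2 y yn.
have E z : bd_iter p m.+1 slow_mode z - (1 - rho) ^+ m.+1 * slow_mode z =
  bd_op p (fun y => bd_iter p m slow_mode y - (1 - rho) ^+ m * slow_mode y) z
  + (1 - rho) ^+ m * (bd_op p slow_mode z - (1 - rho) * slow_mode z).
  by rewrite exprS bd_iterS /bd_op; ring.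
rewrite !E => h1 h2; apply: lerD => //.
by rewrite ler_wpM2l// exprn_ge0// subr_ge0; case: rhoP.
Qed.

(** Comparing the two ends in [slow_mode_decr] bounds a weighted sum over the indicators
    [below R z]; if each of them fell short of [(1 - rho) ^+ m], so would the sum. *)
Lemma slow_relaxation m : exists z, [/\ (0 < z)%N, (z <= n)%N &
  (1 - rho) ^+ m <= bd_iter p m (below R z) 0 - bd_iter p m (below R z) n].
Proof.
set q := _ ^+ m; pose g z := bd_iter p m (below R z) 0 - bd_iter p m (below R z) n.
have [/hasP[z]|/hasPn H] := boolP (has (fun z => q <= g z) (index_iota 1 n.+1)).
  by rewrite mem_index_iota => /andP[z0 zn] qz; exists z.
exfalso.
have D : \sum_(1 <= i < n.+1) (r i * flux i) * (q - g i) <= 0.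
  have := decr_on_le (slow_mode_decr m) (x := 0) (y := n).
  rewrite leqnn leq0n => /(_ isT); rewrite slow_mode_n mulr0 subr0 /slow_mode.
  rewrite !bd_iter_sum -/q mulr_sumr -sumrB -subr_ge0 -sumrB => h.
  rewrite -oppr_ge0 -sumrN; apply: le_trans h _; rewrite le_eqVlt; apply/orP; left.
  apply/eqP; apply: eq_big_nat => i /andP[i0' _].
  by rewrite /g /below i0'; rewrite /=; ring.
(* The edge [i0] has a positive weight, which makes the contradiction strict. *)
have i0n : i0 \in index_iota 1 n.+1 by rewrite mem_index_iota Irange.
move: D; rewrite (bigD1_seq i0) ?iota_uniq//= leNgt => /negP; apply.
apply: ltr_wpDr.
  rewrite big_seq_cond; apply: sumr_ge0 => i /andP[i_in _].
  have := H i i_in; rewrite -ltNge => /ltW qi.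
  have iN : (i <= n.+1)%N by move: i_in; rewrite mem_index_iota; lia.
  by rewrite mulr_ge0 ?mulr_ge0 ?flux_ge0 ?subr_ge0.
have := H i0 i0n; rewrite -ltNge => qi.
rewrite mulr_gt0 ?subr_gt0// mulr_gt0//.
  by rewrite /r invr_gt0; case: wp => _ _ -> //; exact: Irange.
apply: lt_le_trans (flux_lower Ii0).
have [h _] := rhoP; rewrite -/RI in h.
have RIpos : 0 < RI.
  by rewrite lt_neqAle RI0 andbT; apply/eqP => h'; move: h; rewrite -h' !mulr0; lra.
by rewrite !mulr_gt0// /N ltr0n.
Qed.

End SlowMode.

(** * Mixing of the discrete time chain *)

Lemma sum_nat_sub (R : realFieldType) (r : nat -> R) a b c d :
  (forall i, 0 <= r i) -> (a <= b)%N -> (c <= d)%N ->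
  \sum_(b <= i < c) r i <= \sum_(a <= i < d) r i.
Proof.
move=> r0 ab cd; have [cb|bc] := leqP c b.
  by rewrite big_geq// sumr_ge0.
rewrite [leRHS](@big_cat_nat _ _ _ b)//=; last by lia.
rewrite [X in _ <= _ + X](@big_cat_nat _ _ _ c)//=; last by lia.
by rewrite addrCA lerDl addr_ge0// sumr_ge0.
Qed.

Definition edge_bound (R : realFieldType) (n : nat) (p : nat -> R) (C : R) :=
  forall s, (0 < s)%N ->
    s%:R * (\sum_(s <= i < (n.+1 - s).+1) (p i)^-1) <= C.

Definition half_mean (R : realFieldType) (n : nat) (p : nat -> R) :=
  hit_mean p n.+1./2 0.

Section Bounds.
Variable R : realFieldType.
Variables (n : nat) (delta : R) (p : nat -> R) (C : R).
Hypothesis wp : bd_weights n delta p.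
Hypothesis Cp : edge_bound n p C.
Hypothesis C0 : 0 < C.

Let N : R := n.+1%:R.
Let r0 i : 0 <= (p i)^-1 := weights_inv_ge0 wp i.
Let N0 : 0 < N. Proof. by rewrite ltr0n. Qed.

Lemma edge_bound_rev : edge_bound n (rev_weights n p) C.
Proof.
move=> s s0; have [sn|sn] := leqP s n.+1; last first.
  by rewrite big_geq ?mulr0 ?ltW//; lia.
rewrite big_nat_rev/=; apply: le_trans (Cp s0).
rewrite ler_wpM2l// le_eqVlt; apply/orP; left; apply/eqP.
apply: eq_big_nat => i /andP[si iN]; rewrite /rev_weights.
by congr (p _)^-1; lia.
Qed.

Lemma edge_window l a b : (0 < l <= a)%N -> (b <= n.+1 - l)%N ->
  \sum_(a <= i < b.+1) (p i)^-1 <= C / l%:R.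
Proof.
move=> /andP[l0 la] bl; rewrite ler_pdivlMr ?ltr0n// mulrC.
by apply: le_trans (Cp l0); rewrite ler_wpM2l//; apply: sum_nat_sub => //; lia.
Qed.

(** Moving a target inside the window at distance [l] from both ends changes the mean hitting time
    by [O(C)] when [l] is a fixed fraction of [n]. *)
Lemma mean_window l a b : (0 < l <= a)%N -> (b <= n.+1 - l)%N ->
  \sum_(a <= i < b.+1) i%:R * (p i)^-1 <= N / l%:R * C.
Proof.
move=> la bl; apply: (@le_trans _ _ (\sum_(a <= i < b.+1) N * (p i)^-1)).
  apply: ler_sum_nat => i ib; rewrite ler_wpM2r// ler_nat; lia.
by rewrite -mulr_sumr -mulrA ler_wpM2l ?(ltW N0)// mulrC edge_window.
Qed.

Lemma hit_mean_split z1 z2 : (z1 <= z2)%N ->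
  hit_mean p z2 0 = hit_mean p z1 0 + \sum_(z1.+1 <= i < z2.+1) i%:R * (p i)^-1.
Proof. by move=> z12; rewrite /hit_mean (@big_cat_nat _ _ _ z1.+1). Qed.

Lemma hit_mean_far l : (0 < l)%N -> (l.*2 <= n)%N ->
  hit_mean p (n.+1 - l) 0 <= half_mean n p + N / l%:R * C.
Proof.
move=> l0 ln; rewrite (@hit_mean_split n.+1./2); last by lia.
by rewrite lerD2l mean_window//; lia.
Qed.

Lemma hit_mean_near l : (0 < l)%N -> (l.*2 <= n)%N ->
  half_mean n p - N / l%:R * C <= hit_mean p l 0 <= half_mean n p.
Proof.
move=> l0 ln; rewrite /half_mean (@hit_mean_split l n.+1./2); last by lia.
rewrite lerDl sumr_ge0 ?andbT; last by move=> i _; rewrite mulr_ge0.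
by rewrite lerBlDr lerD2l mean_window//; lia.
Qed.

Lemma below_mass l : (0 < l)%N -> (l.*2 <= n)%N -> 1 <= N / l%:R.
Proof. by move=> l0 ln; rewrite ler_pdivlMr ?ltr0n// mul1r ler_nat; lia. Qed.

(** Here [W] is [N / l * C]: for [j < l] the edge bound at [j] already gives [C], and for [j >= l]
    the window sum is at most [C / l] while [j <= N]. *)
Lemma hit_var_far l : (0 < l)%N -> (l.*2 <= n)%N ->
  hit_var p (n.+1 - l) 0 <=
    2 * (N / l%:R * C) * (half_mean n p + N / l%:R * C).
Proof.
move=> l0 ln; have h1 := below_mass l0 ln.
have W0 : 0 <= N / l%:R * C by rewrite mulr_ge0 ?ltW// (lt_le_trans ltr01).
apply: (@le_trans _ _ (2 * (N / l%:R * C) * hit_mean p (n.+1 - l) 0)).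
  apply: (hit_var_le wp) => j /andP[j0 jz]; have [jl|lj] := ltnP j l.
    apply: (@le_trans _ _ C); last by rewrite ler_peMl// ltW.
    apply: le_trans (Cp j0); rewrite ler_wpM2l//; apply: sum_nat_sub => //; lia.
  rewrite -mulrA ler_pM ?sumr_ge0//; first by rewrite ler_nat; lia.
  by rewrite mulrC edge_window//; lia.
apply: ler_wpM2l; last exact: hit_mean_far.
by rewrite mulr_ge0.
Qed.

Lemma hit_var_near l : (0 < l)%N -> (l.*2 <= n)%N ->
  hit_var p l 0 <= 2 * C * half_mean n p.
Proof.
move=> l0 ln; apply: (@le_trans _ _ (2 * C * hit_mean p l 0)).
  apply: (hit_var_le wp) => j /andP[j0 jz].
  by apply: le_trans (Cp j0); rewrite ler_wpM2l//; apply: sum_nat_sub => //; lia.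
by rewrite ler_wpM2l ?mulr_ge0 ?(ltW C0)//; case/andP: (hit_mean_near l0 ln).
Qed.

Lemma half_mean_ge0 : 0 <= half_mean n p.
Proof. exact: (hit_mean_ge0 wp). Qed.

(** By monotonicity the probability from [z] is at most its average over the starting points
    [0, ..., z], and by stationarity the sum over all starting points is [a]. *)
Lemma below_far z a m : (z <= n)%N -> (a <= n.+1)%N ->
  bd_iter p m (below R a) z <= a%:R / z.+1%:R.
Proof.
move=> zn an; rewrite ler_pdivlMr ?ltr0n//.
have b0 y : 0 <= bd_iter p m (below R a) y.
  by apply: (bd_iter_ge0 wp) => ?; rewrite /below.
rewrite -(@sum_below R n.+1 a an) -(bd_iter_total wp m).
apply: (@le_trans _ _ (\sum_(0 <= y < z.+1) bd_iter p m (below R a) y)).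
  apply: (@le_trans _ _ (\sum_(0 <= y < z.+1) bd_iter p m (below R a) z)).
    by rewrite big_const_nat subn0 iter_addr_0 mulr_natr.
  apply: ler_sum_nat => y yz.
  apply: (decr_on_le (bd_iter_decr wp m (@below_decr R n a))); lia.
exact: sum_nat_sub.
Qed.

(** By time [t] the state [n.+1 - l] has been hit except with probability [theta], and from there
    [below_far] is off the uniform value by at most [2 * l / N]. *)
Lemma tail_upper l (t : nat) (theta D : R) : (0 < l)%N -> (l.*2 <= n)%N ->
  0 < D -> half_mean n p + N / l%:R * C + D <= t%:R ->
  2 * (N / l%:R * C) * (half_mean n p + N / l%:R * C) <= theta * D ^+ 2 ->
  forall a, (a <= n.+1)%N ->
  bd_iter p t (below R a) 0 <= a%:R / N + (theta + 2 * (l%:R / N)).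
Proof.
move=> l0 ln D0 Dt hD a an; set z := (n.+1 - l)%N.
have ln1 : (l <= n.+1)%N by clear -ln; lia.
have zn : (z <= n)%N by rewrite /z; clear -ln l0; lia.
have := hit_mean_far l0 ln; rewrite -/z => hM.
have tD : D <= t%:R - hit_mean p z 0 by lra.
have Mt : hit_mean p z 0 <= t%:R by lra.
have b1 y : below R a y <= 1 by rewrite /below lern1 leq_b1.
have S0 : 0 <= a%:R / z.+1%:R :> R by rewrite divr_ge0.
have := hit_upper wp zn b1 S0 (fun m => below_far m zn an) Mt.
move=> /le_trans /(_ (hit_var_far l0 ln)) /le_trans /(_ hD).
set E := bd_iter p t _ 0 - _; set G := _ - hit_mean _ _ _ in tD * => hE.
have theta0 : 0 <= theta.
  have W0 : 0 <= N / l%:R * C by rewrite mulr_ge0 ?divr_ge0// ltW.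
  have : 0 <= 2 * (N / l%:R * C) * (half_mean n p + N / l%:R * C).
    by apply: mulr_ge0; [rewrite mulr_ge0 | rewrite addr_ge0 ?half_mean_ge0].
  by move=> /le_trans /(_ hD); rewrite pmulr_lge0// exprn_gt0.
have Eth : E <= theta.
  have : E * G ^+ 2 <= theta * G ^+ 2.
    apply: le_trans hE _; rewrite ler_wpM2l//.
    by rewrite ler_pXn2r// ?nnegrE; lra.
  by rewrite ler_pM2r// exprn_gt0//; lra.
have : a%:R / z.+1%:R <= a%:R / N + 2 * (l%:R / N).
  have zR : z.+1%:R = N - l%:R + 1 by rewrite -natr1 /z natrB.
  have z0 : 0 < z.+1%:R :> R by rewrite ltr0n.
  have lN : 2 * l%:R <= N.
    by rewrite -natrM ler_nat mul2n leqW.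
  have aN : a%:R <= N by rewrite ler_nat.
  have a0 : 0 <= a%:R :> R by [].
  have l1 : 1 <= l%:R :> R by rewrite ler1n.
  rewrite ler_pdivrMr// mulrA -mulrDl mulrAC ler_pdivlMr// zR.
  have h1 : 0 <= (N - a%:R) * (l%:R - 1) by rewrite mulr_ge0// subr_ge0.
  have h2 : 0 <= l%:R * (N - 2 * l%:R) by rewrite mulr_ge0// subr_ge0.
  move: h1 h2 l1 N0; move: N (a%:R : R) (l%:R : R) => *; lra.
move: Eth; rewrite /E lerBlDr => h1 h2; apply: le_trans h1 _.
by rewrite [leRHS]addrCA lerD2l.
Qed.

Lemma tail_lower l (t : nat) (theta D : R) : (0 < l)%N -> (l.*2 <= n)%N ->
  0 < D -> t%:R + N / l%:R * C + D <= half_mean n p ->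
  2 * C * half_mean n p <= theta * D ^+ 2 ->
  1 - theta <= bd_iter p t (below R l) 0.
Proof.
move=> l0 ln D0 Dt hD; have /andP[hM hM'] := hit_mean_near l0 ln.
have tD : D <= hit_mean p l 0 - t%:R by lra.
have tM : t%:R <= hit_mean p l 0 by lra.
have lnn : (l <= n)%N by clear -ln; lia.
have := hit_lower wp lnn tM.
move=> /le_trans /(_ (hit_var_near l0 ln)) /le_trans /(_ hD).
set G := hit_mean _ _ _ - _ in tD *; set E := 1 - _ => hE.
have theta0 : 0 <= theta.
  have : 0 <= 2 * C * half_mean n p.
    by rewrite !mulr_ge0 ?(ltW C0)// half_mean_ge0.
  by move=> /le_trans /(_ hD); rewrite pmulr_lge0// exprn_gt0.
have : E <= theta.
  have : E * G ^+ 2 <= theta * G ^+ 2.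
    apply: le_trans hE _; rewrite ler_wpM2l//.
    by rewrite ler_pXn2r// ?nnegrE; lra.
  by rewrite ler_pM2r// exprn_gt0//; lra.
by rewrite /E; lra.
Qed.

End Bounds.

Section Main.
Variable R : archiRealFieldType.

Definition unif_dev (n : nat) (p : nat -> R) (m : nat) (f : nat -> R) (x : nat) :=
  bd_iter p m f x - (\sum_(0 <= y < n.+1) f y) / n.+1%:R.

Lemma frac_window (q n : nat) : (2 < q)%N -> (q.*2 <= n)%N ->
  let l := (n.+1 %/ q)%N in
  (0 < l)%N /\ (l.*2 <= n)%N /\ (l%:R / n.+1%:R <= q%:R^-1 :> R) /\
  (n.+1%:R / l%:R <= 2 * q%:R :> R).
Proof.
move=> q2 qn l; have q0 : (0 < q)%N by lia.
have l0 : (0 < l)%N by rewrite divn_gt0//; lia.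
have h1 : (l * q <= n.+1)%N by exact: leq_trunc_div.
have h2 : (n.+1 < l.+1 * q)%N by exact: ltn_ceil.
split=> //; split; first by clear h2; nia.
split; first by rewrite ler_pdivrMr ?ltr0n// ler_pdivlMl ?ltr0n// -natrM ler_nat mulnC.
rewrite ler_pdivrMr ?ltr0n// -!natrM ler_nat; nia.
Qed.

Lemma ex_nat_above (x : R) : exists q : nat, (2 < q)%N /\ x <= q%:R.
Proof.
have /andP[_ h] := truncn_itv (normr_ge0 x).
exists (Num.truncn `|x|).+3; split=> //.
apply: le_trans (ler_norm x) _; apply: le_trans (ltW h) _.
by rewrite ler_nat !ltnS leqW // leqW.
Qed.

Lemma div_nat_le (c e : R) (q : nat) : 0 < e -> (0 < q)%N -> c / e <= q%:R ->
  c / q%:R <= e.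
Proof.
by move=> e0 q0; rewrite ler_pdivrMr// ler_pdivrMr ?ltr0n// mulrC.
Qed.

Lemma discrete_upper (e delta : R) : 0 < e -> 0 < delta ->
  exists C : R, 0 < C /\ exists n0 : nat, forall n, (n0 <= n)%N ->
  forall (p : nat -> R) (B M D : R) (m : nat), bd_weights n delta p -> edge_bound n p B ->
  1 <= B -> half_mean n p <= M -> half_mean n (rev_weights n p) <= M ->
  0 < D -> C * (M + B) * B <= D ^+ 2 -> M + C * B + D <= m%:R ->
  forall (f : nat -> R) (x : nat), (forall y, 0 <= f y <= 1) -> (x <= n)%N ->
    unif_dev n p m f x <= e.
Proof.
move=> e0 d0.
(* Two windows: [n.+1 / q1] for smoothing, whose end strips cost [4 / q1 <= e / 2], and [n.+1 / q2]
   for the hitting target. The latter is chosen once [b] is known, so that the distribution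
   functions are within [2 * b], which smoothing amplifies to [e / 2]. *)
have [q1 [q1_1 q1b]] := ex_nat_above (4 / (e / 2)).
have q1e : 4 / q1%:R <= e / 2.
  by apply: div_nat_le => //; [rewrite divr_gt0 | rewrite (leq_trans _ q1_1)].
have [b bE] : exists b : R, b = e / (4 * (2 * q1%:R + 3)) by eexists.
have q1p : 0 < q1%:R :> R by rewrite ltr0n (leq_trans _ q1_1).
have b0 : 0 < b by rewrite bE divr_gt0// mulr_gt0// addr_gt0// mulr_gt0.
have [q2 [q2_1 q2b']] := ex_nat_above (2 / b).
have q2b : 2 / q2%:R <= b by apply: div_nat_le => //; rewrite (leq_trans _ q2_1).
have q21 : 1 <= q2%:R :> R by rewrite ler1n (leq_trans _ q2_1).
(* The terms pay in turn for the variance in Chebyshev's inequality, the shift of the target, and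
   the at most [B / delta + 1] smoothing steps. *)
have [C CE] : exists C, C = 8 * q2%:R ^+ 2 / b + 2 * q2%:R + delta^-1 + 1.
  by eexists.
have C1 : 8 * q2%:R ^+ 2 / b <= C.
  by rewrite CE -!addrA lerDl !addr_ge0// ?mulr_ge0// invr_ge0 ltW.
have C2 : 2 * q2%:R + delta^-1 + 1 <= C.
  by rewrite CE -!addrA lerDr divr_ge0 ?mulr_ge0 ?exprn_ge0// ltW.
have C0 : 0 < C.
  by apply: lt_le_trans C2; rewrite ltr_wpDl// addr_ge0// ?mulr_ge0// invr_ge0 ltW.
exists C; split => //; exists (q1 + q2).*2 => n n0 p B M D m wp Bp B1 M1 M2 D0 DC mC.
have B0 : 0 < B by lra.
have M0 : 0 <= M by apply: le_trans M1; exact: (half_mean_ge0 wp).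
have qn1 : (q1.*2 <= n)%N by clear -n0; lia.
have [l10 [l1n [l1a l1b]]] := frac_window q1_1 qn1.
have qn2 : (q2.*2 <= n)%N by clear -n0; lia.
have [l20 [l2n [l2a l2b]]] := frac_window q2_1 qn2.
move: l10 l1n l1a l1b; move: (n.+1 %/ q1)%N => l1 l10 l1n l1a l1b.
move: l20 l2n l2a l2b; move: (n.+1 %/ q2)%N => l2 l20 l2n l2a l2b.
have Bd0 : 0 <= B / delta by rewrite divr_ge0 ?ltW.
pose s := (Num.truncn (B / delta)).+1.
have /andP[s1 s2] := truncn_itv Bd0.
have sB : B <= delta * s%:R by rewrite mulrC -ler_pdivrMr// ltW.
have sB' : s%:R <= B / delta + 1 by rewrite /s -natr1 lerD2r.
have sm : (s <= m)%N.
  rewrite -(ler_nat R); apply: le_trans sB' _; apply: le_trans mC.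
  have : (2 * q2%:R + delta^-1 + 1) * B <= C * B by rewrite ler_wpM2r// ltW.
  have : 0 <= q2%:R * B by rewrite mulr_ge0// ltW.
  lra.
have -> : m = ((m - s) + s)%N by rewrite subnK.
move=> f x f01 xn; rewrite /unif_dev.
set W := n.+1%:R / l2%:R * B.
have W2 : W <= 2 * q2%:R * B by rewrite ler_wpM2r// ltW.
have W0 : 0 <= W by rewrite mulr_ge0 ?divr_ge0// ltW.
have tm : M + W + D <= (m - s)%:R.
  rewrite natrB//.
  have : (2 * q2%:R + delta^-1 + 1) * B <= C * B by rewrite ler_wpM2r// ltW.
  lra.
have var : 2 * W * (M + W) <= b * D ^+ 2.
  apply: (@le_trans _ _ (b * (C * (M + B) * B))); last by rewrite ler_wpM2l// ltW.
  apply: (@le_trans _ _ (8 * q2%:R ^+ 2 * (M + B) * B)); last first.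
    have : 8 * q2%:R ^+ 2 <= C * b by rewrite -ler_pdivrMr.
    move=> h; rewrite -[leLHS]mulrA.
    rewrite [leRHS](_ : _ = C * b * ((M + B) * B)); last by ring.
    by rewrite ler_wpM2r// mulr_ge0 ?addr_ge0// ltW.
  have h1 : M + W <= 2 * q2%:R * (M + B).
    have : 0 <= (q2%:R - 1) * M by rewrite mulr_ge0// subr_ge0.
    lra.
  apply: (@le_trans _ _ (2 * (2 * q2%:R * B) * (2 * q2%:R * (M + B)))).
    by apply: ler_pM => //; [apply: mulr_ge0|apply: addr_ge0|apply: ler_wpM2l].
  by rewrite le_eqVlt; apply/orP; left; apply/eqP; ring.
have K1 := @tail_upper R n delta p B wp Bp B0 l2 (m - s) b D l20 l2n D0.
have K2 := @tail_upper R n delta _ B (rev_weightsP wp) (edge_bound_rev Bp B0) B0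
  l2 (m - s) b D l20 l2n D0.
rewrite -/W in K1 K2.
have vark M' : 0 <= M' -> M' <= M -> 2 * W * (M' + W) <= b * D ^+ 2.
  move=> M'0 M'M; apply: le_trans var; apply: ler_wpM2l; [exact: mulr_ge0|].
  by rewrite lerD2r.
have tmk M' : M' <= M -> M' + W + D <= (m - s)%:R.
  by move=> M'M; apply: le_trans tm; rewrite !lerD2r.
have K1' := K1 (tmk _ M1) (vark _ (half_mean_ge0 wp) M1).
have K2' := K2 (tmk _ M2) (vark _ (half_mean_ge0 (rev_weightsP wp)) M2).
have K := kolmogorov wp K1' K2'.
apply: le_trans (smoothing wp f01 l10 l1n B0 (Bp _ l10) sB K xn) _.
apply: (@le_trans _ _ (2 * b * (2 * q1%:R + 3) + 4 / q1%:R)); last first.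
  have q3 : 2 * q1%:R + 3 != 0 :> R by rewrite gt_eqF// addr_gt0// mulr_gt0.
  suff -> : 2 * b * (2 * q1%:R + 3) = e / 2 by rewrite [leRHS]splitr lerD2l.
  by rewrite bE; field.
apply: lerD; last by rewrite ler_wpM2l.
apply: ler_pM; rewrite ?addr_ge0 ?mulr_ge0 ?divr_ge0 ?invr_ge0 ?(ltW b0)//.
  rewrite [leRHS]mulr_natl [leRHS]mulr2n lerD2l.
  by apply: le_trans q2b; rewrite ler_wpM2l.
by rewrite lerD2r.
Qed.

(** The witness is a segment of length about [n / q] at the starting end: its uniform mass is at
    most [e / 2], and Chebyshev's inequality leaves at most [e / 2] for having escaped. *)
Lemma discrete_lower (e : R) : 0 < e ->
  exists C : R, 0 < C /\ exists n0 : nat, forall n, (n0 <= n)%N ->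
  forall delta (p : nat -> R) (B D : R) (m : nat), bd_weights n delta p -> edge_bound n p B ->
  0 < B -> 0 < D -> C * half_mean n p * B <= D ^+ 2 ->
  m%:R + C * B + D <= half_mean n p ->
  exists z, (z <= n)%N /\ 1 - e <= bd_iter p m (below R z) 0 - z%:R / n.+1%:R.
Proof.
move=> e0.
have [q [q_1 qe']] := ex_nat_above (1 / (e / 2)).
have qe : q%:R^-1 <= e / 2.
  by rewrite -[leLHS]mul1r div_nat_le ?divr_gt0// (leq_trans _ q_1).
have [C CE] : exists C : R, C = 2 * q%:R + 4 / e by eexists.
have C1 : 2 * q%:R <= C by rewrite CE lerDl divr_ge0// ltW.
have C2 : 4 / e <= C by rewrite CE lerDr mulr_ge0.
have C0 : 0 < C by apply: lt_le_trans C2; rewrite divr_gt0.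
exists C; split => //; exists q.*2 => n qn delta p B D m wp Bp B0 D0 CD mD.
have [l0 [ln [la lb]]] := frac_window q_1 qn.
move: l0 ln la lb; move: (n.+1 %/ q)%N => l l0 ln la lb.
have := le_trans la qe; set w := _ / _ => wE.
exists l; split; first by clear -ln; lia.
have M0 := half_mean_ge0 wp.
have := @tail_lower R n delta p B wp Bp B0 l m (e / 2) D l0 ln D0.
suff [h1 h2] : m%:R + n.+1%:R / l%:R * B + D <= half_mean n p /\
    2 * B * half_mean n p <= e / 2 * D ^+ 2 by move=> /(_ h1 h2); rewrite -/w; lra.
split.
  have : n.+1%:R / l%:R * B <= C * B.
    by rewrite ler_wpM2r ?(ltW B0)//; lra.
  lra.
apply: (@le_trans _ _ (e / 2 * (C * half_mean n p * B))); last first.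
  by rewrite ler_wpM2l// divr_ge0// ltW.
have : 4 / e * (half_mean n p * B) <= C * (half_mean n p * B).
  by rewrite ler_wpM2r// mulr_ge0// ltW.
move=> h; have : e / 2 * (4 / e * (half_mean n p * B)) <=
    e / 2 * (C * (half_mean n p * B)) by rewrite ler_wpM2l// divr_ge0// ltW.
rewrite (_ : e / 2 * (4 / e * (half_mean n p * B)) = 2 * B * half_mean n p).
  by rewrite !mulrA.
by field; rewrite gt_eqF.
Qed.

End Main.

(** * Poisson mixtures *)

Section Poisson.
Variable R : realType.

Lemma triangle_sum (V : nmodType) (F : nat -> nat -> V) n :
  \sum_(0 <= m < n) \sum_(0 <= k < m.+1) F k (m - k)%N =
  \sum_(0 <= k < n) \sum_(0 <= l < n - k) F k l.
Proof.
elim: n => [|n IHn]; first by rewrite !big_geq.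
rewrite big_nat_recr//= IHn big_nat_recr//= [in RHS]big_nat_recr//=.
rewrite subnn subSnn big_nat1 addrA; congr (_ + _).
rewrite -big_split/=; apply: eq_big_nat => k /andP[_ kn].
by rewrite subSn ?(ltnW kn)// big_nat_recr.
Qed.

(* The difference is dominated by the same one for the exponential series, which
   tends to [expR mu * expR mu - expR (mu + mu) = 0]. *)
Lemma cauchy_cvg (mu : R) (a b : nat -> R) : 0 <= mu ->
  (forall k, `|a k| <= exp_coeff mu k) -> (forall k, `|b k| <= exp_coeff mu k) ->
  (\sum_(0 <= m < n) \sum_(0 <= k < m.+1) a k * b (m - k)%N
   - (\sum_(0 <= k < n) a k) * (\sum_(0 <= l < n) b l)) @[n --> \oo] --> (0 : R).
Proof.
move=> mu0 ha hb.
have e0 k : 0 <= exp_coeff mu k by exact: exp_coeff_ge0.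
have tri (u v : nat -> R) n : (\sum_(0 <= k < n) u k) * (\sum_(0 <= l < n) v l)
   - \sum_(0 <= m < n) \sum_(0 <= k < m.+1) u k * v (m - k)%N =
   \sum_(0 <= k < n) \sum_(n - k <= l < n) u k * v l.
  rewrite (triangle_sum (fun k l => u k * v l)) mulr_suml -sumrB.
  apply: eq_big_nat => k /andP[_ kn].
  rewrite mulr_sumr (@big_cat_nat _ _ _ (n - k) 0) ?leq_subr//=.
  by rewrite addrAC subrr add0r.
have expE n : \sum_(0 <= m < n) \sum_(0 <= k < m.+1)
    exp_coeff mu k * exp_coeff mu (m - k)%N = series (exp_coeff (mu + mu)) n.
  rewrite /series/=; apply: eq_bigr => m _; rewrite /exp_coeff/= exprDn mulr_suml.
  rewrite big_mkord; apply: eq_bigr => k _.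
  have km : (k <= m)%N by rewrite -ltnS.
  have fm : (m`!%:R : R) = 'C(m, k)%:R * (k`!%:R * (m - k)`!%:R).
    by rewrite -!natrM bin_fact.
  have fn0 i : i`!%:R != 0 :> R by rewrite pnatr_eq0 -lt0n fact_gt0.
  have cn0 : 'C(m, k)%:R != 0 :> R by rewrite pnatr_eq0 -lt0n bin_gt0.
  rewrite -mulr_natr fm; field.
  by rewrite !fn0 cn0.
have ub : (series (exp_coeff mu) n * series (exp_coeff mu) n
    - series (exp_coeff (mu + mu)) n) @[n --> \oo] --> (0 : R).
  have -> : (0 : R) = expR mu * expR mu - expR (mu + mu) by rewrite expRD subrr.
  by apply: cvgB; [apply: cvgM|]; exact: is_cvg_series_exp_coeff.
apply/cvgrPdist_le => e e_gt0; move/cvgrPdist_le: ub => /(_ e e_gt0).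
apply: filterS => n; rewrite !sub0r !normrN -expE => h; apply: le_trans h.
rewrite distrC tri tri [leRHS]ger0_norm; last first.
  by apply: sumr_ge0 => k _; apply: sumr_ge0 => l _; rewrite mulr_ge0 ?e0.
apply: le_trans (ler_norm_sum _ _ _) _; apply: ler_sum => k _.
apply: le_trans (ler_norm_sum _ _ _) _; apply: ler_sum => l _.
by rewrite normrM ler_pM.
Qed.

Lemma cvg_finsum (I : Type) (s : seq I) (u : I -> nat -> R) (l : I -> R) :
  (forall i, u i n @[n --> \oo] --> l i) ->
  (\sum_(i <- s) u i n) @[n --> \oo] --> \sum_(i <- s) l i.
Proof.
move=> ul; elim: s => [|i s IHs].
  by under eq_fun do rewrite big_nil; rewrite big_nil; exact: cvg_cst.
by under eq_fun do rewrite big_cons; rewrite big_cons; apply: cvgD.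
Qed.

(* [L] is the expectation of [phi] under the Poisson law of mean [mu]. *)
Definition poisson_mean (mu : R) (phi : nat -> R) (L : R) :=
  (expR (- mu) * \sum_(0 <= m < n) exp_coeff mu m * phi m) @[n --> \oo] --> L.

Lemma poisson_mean_quad (mu a b c : R) :
  poisson_mean mu (fun m => a + b * m%:R + c * (m%:R * (m%:R - 1)))
    (a + b * mu + c * mu ^+ 2).
Proof.
pose S := series (exp_coeff mu).
have cS : S @ \oo --> expR mu by exact: is_cvg_series_exp_coeff.
have ec1 m : exp_coeff mu m.+1 * m.+1%:R = mu * exp_coeff mu m.
  rewrite /exp_coeff/= factS natrM exprS; field.
  by rewrite nat1r !pnatr_eq0 -lt0n fact_gt0.
have h1 n : \sum_(0 <= m < n.+1) exp_coeff mu m * m%:R = mu * S n.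
  elim: n => [|n IHn]; first by rewrite big_nat1 mulr0 /S /series/= big_geq// mulr0.
  rewrite big_nat_recr//= IHn ec1 /S seriesSr; ring.
have h2 n : \sum_(0 <= m < n.+2) exp_coeff mu m * (m%:R * (m%:R - 1)) = mu ^+ 2 * S n.
  elim: n => [|n IHn].
    by rewrite !big_nat_recr//= big_geq// /S /series/= big_geq// subrr !(mulr0, mul0r, addr0).
  rewrite big_nat_recr//= IHn mulrA ec1 -[n.+2%:R]natr1 addrK -mulrA ec1 /S seriesSr; ring.
(* The partial sums of the two factorial moments lag behind the exponential series by one and two
   indices. *)
rewrite /poisson_mean -(cvg_shiftn 2).
have -> : (fun n => expR (- mu) * \sum_(0 <= m < n + 2) exp_coeff mu m *
    (a + b * m%:R + c * (m%:R * (m%:R - 1)))) = (fun n => expR (- mu) *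
    (a * S (n + 2)%N + b * (mu * S (n + 1)%N) + c * (mu ^+ 2 * S n))).
  apply/funext => n; rewrite addn2 addn1 -h1 -h2 /S /series/= !mulr_sumr -!big_split/=.
  by rewrite mulr_sumr; apply: eq_bigr => i _; ring.
have -> : a + b * mu + c * mu ^+ 2 = expR (- mu) *
   (a * expR mu + b * (mu * expR mu) + c * (mu ^+ 2 * expR mu)).
  by rewrite expRN; field; rewrite gt_eqF ?expR_gt0.
have cS1 : S (n + 1)%N @[n --> \oo] --> expR mu by rewrite (cvg_shiftn 1).
have cS2 : S (n + 2)%N @[n --> \oo] --> expR mu by rewrite (cvg_shiftn 2).
apply: cvgMr; apply: cvgD; last by apply: cvgMr; apply: cvgMr.
by apply: cvgD; [apply: cvgMr | apply: cvgMr; apply: cvgMr].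
Qed.

Lemma poisson_mean_le (mu : R) phi psi L M : 0 <= mu ->
  poisson_mean mu phi L -> poisson_mean mu psi M ->
  (forall m, phi m <= psi m) -> L <= M.
Proof.
move=> mu0 hL hM pp; apply: (ler_cvg_to hL hM); apply: nearW => n.
rewrite ler_wpM2l ?expR_ge0//; apply: ler_sum => m _.
by rewrite ler_wpM2l// exp_coeff_ge0.
Qed.

(** Domination by a quadratic, whose Poisson mean is exact because the variance is [mu]. *)
Lemma poisson_chebyshev_le (mu a c : R) phi L : 0 <= mu ->
  poisson_mean mu phi L -> (forall m, phi m <= a + c * (m%:R - mu) ^+ 2) ->
  L <= a + c * mu.
Proof.
move=> mu0 hL h.
have := @poisson_mean_quad mu (a + c * mu ^+ 2) (c * (1 - 2 * mu)) c.
move/(poisson_mean_le mu0 hL); rewrite (_ : _ + _ + _ = a + c * mu); last by ring.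
by apply=> m; apply: le_trans (h m) _; rewrite le_eqVlt; apply/orP; left; apply/eqP; ring.
Qed.

Lemma poisson_chebyshev_ge (mu a c : R) phi L : 0 <= mu ->
  poisson_mean mu phi L -> (forall m, a - c * (m%:R - mu) ^+ 2 <= phi m) ->
  a - c * mu <= L.
Proof.
move=> mu0 hL h.
have := @poisson_mean_quad mu (a - c * mu ^+ 2) (- c * (1 - 2 * mu)) (- c).
move/(poisson_mean_le mu0)/(_ hL); rewrite (_ : _ + _ + _ = a - c * mu); last by ring.
by apply=> m; apply: le_trans (h m); rewrite le_eqVlt; apply/orP; left; apply/eqP; ring.
Qed.

Lemma poisson_affine_ge (mu a b : R) phi L : 0 <= mu ->
  poisson_mean mu phi L -> (forall m, a - b * m%:R <= phi m) -> a - b * mu <= L.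
Proof.
move=> mu0 hL h; have := @poisson_mean_quad mu a (- b) 0.
move/(poisson_mean_le mu0)/(_ hL); rewrite (_ : _ + _ + _ = a - b * mu); last by ring.
by apply=> m; apply: le_trans (h m); rewrite le_eqVlt; apply/orP; left; apply/eqP; ring.
Qed.

End Poisson.

(** * Kernels as matrices *)

Section Matrices.
Variable R : realType.

Lemma fin_sup_ge (I : finType) (F : I -> R) i :
  F i <= sup [set F i | i in [set: I]].
Proof.
apply: ub_le_sup; last by exists i.
exists (\sum_j `|F j|) => _ [j _ <-]; apply: le_trans (ler_norm _) _.
by rewrite (bigD1 j)//= lerDl sumr_ge0.
Qed.

Lemma fin_sup_le (I : finType) (F : I -> R) (i0 : I) e :
  (forall i, F i <= e) -> sup [set F i | i in [set: I]] <= e.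
Proof.
by move=> Fe; apply: ge_sup; [exists (F i0), i0 | move=> _ [i _ <-]].
Qed.

Lemma sum_ord_nat n (f : nat -> R) : \sum_(j < n.+1) f j = \sum_(0 <= y < n.+1) f y.
Proof. by rewrite big_mkord. Qed.

Lemma max_tv_le n (P : 'M[R]_n.+1) (e : R) :
  (forall (f : nat -> R) x, (forall y, 0 <= f y <= 1) ->
    \sum_j P x j * f j - (\sum_(0 <= y < n.+1) f y) / n.+1%:R <= e) ->
  max_tv P (unif_dist R n) <= e.
Proof.
move=> h; apply: (fin_sup_le ord0) => x.
apply: (fin_sup_le (finset.set0 : {set 'I_n.+1})) => A.
pose f y : R := ((inord y : 'I_n.+1) \in A)%:R.
have f01 y : 0 <= f y <= 1 by rewrite /f ler0n lern1 leq_b1.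
apply: le_trans (h f x f01); rewrite le_eqVlt; apply/orP; left; apply/eqP.
rewrite -sum_ord_nat mulr_suml; congr (_ - _); rewrite big_mkcond/=;
  apply: eq_bigr => j _; rewrite /f inord_val !mxE; case: (j \in A);
  by rewrite ?(mulr1, mulr0, mul1r, mul0r).
Qed.

Lemma max_tv_ge n (P : 'M[R]_n.+1) (b : pred nat) x :
  \sum_j P x j * (b j)%:R - (\sum_(0 <= y < n.+1) (b y)%:R) / n.+1%:R
  <= max_tv P (unif_dist R n).
Proof.
apply: le_trans (fin_sup_ge (fun x => tv_dist (row x P) (unif_dist R n)) x).
pose A := [set j : 'I_n.+1 | b j]%SET.
apply: le_trans (fin_sup_ge (fun A : {set 'I_n.+1} => \sum_(i in A) row x P ord0 i
  - \sum_(i in A) unif_dist R n ord0 i) A).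
rewrite le_eqVlt; apply/orP; left; apply/eqP.
rewrite -(sum_ord_nat n (fun y => (b y)%:R)) mulr_suml; congr (_ - _);
  rewrite [RHS]big_mkcond/=;
  apply: eq_bigr => j _; rewrite inE !mxE; case: (b j);
  by rewrite ?(mulr1, mulr0, mul1r, mul0r).
Qed.

Section Kernel.
Variables (n : nat) (P : 'M[R]_n.+1) (p : nat -> R).
Hypothesis Pp : forall (f : nat -> R) (x : 'I_n.+1),
  \sum_j P x j * f j = bd_op p f x.

Lemma mx_bd_iter m (f : nat -> R) (x : 'I_n.+1) :
  \sum_j (P ^+ m) x j * f j = bd_iter p m f x.
Proof.
elim: m f x => [|m IHm] f x.
  rewrite expr0 (bigD1 x)//= mxE eqxx mul1r big1 ?addr0// => j jx.
  by rewrite mxE eq_sym (negbTE jx) mul0r.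
rewrite exprSr bd_iterSr -IHm.
under eq_bigr do rewrite -mulmxE mxE mulr_suml.
rewrite exchange_big/=; apply: eq_bigr => k _.
by rewrite -Pp mulr_sumr; apply: eq_bigr => j _; rewrite mulrA.
Qed.

Lemma mx_bd_iter_entry delta m (x j : 'I_n.+1) : bd_weights n delta p ->
  0 <= (P ^+ m) x j <= 1.
Proof.
move=> wp; have -> : (P ^+ m) x j = \sum_k (P ^+ m) x k * (k == j :> nat)%:R.
  rewrite (bigD1 j)//= eqxx mulr1 big1 ?addr0// => k /negbTE kj.
  by rewrite (_ : (k == j :> nat) = false) ?mulr0// -kj.
rewrite (mx_bd_iter m (fun y => (y == j :> nat)%:R)).
by rewrite (bd_iter_ge0 wp) ?(bd_iter_le1 wp)// => y; rewrite ?lern1 ?leq_b1.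
Qed.

End Kernel.

(* Writing [- t (1 - K) = mu (P - 1)] with [P] the lazy kernel, the exponential
   series is the Cauchy product of those of [mu P] and of [- mu]. *)
Lemma heat_kernel_poisson n (K : 'M[R]_n.+1) (delta t : R) (f : nat -> R) x :
  delta < 1 -> 0 <= t ->
  (forall m i j, `|(lazy_kernel delta K ^+ m) i j| <= 1) ->
  poisson_mean (t / (1 - delta))
    (fun m => \sum_j (lazy_kernel delta K ^+ m) x j * f j)
    (\sum_j heat_kernel K t x j * f j).
Proof.
move=> d1 t0 P1; set P := lazy_kernel delta K in P1 *.
set mu := t / (1 - delta).
have mu0 : 0 <= mu by rewrite divr_ge0// subr_ge0 ltW.
have genE : (- t) *: (1%:M - K) = mu *: (-1 + P).
  have -> : (-1 + P : 'M[R]_n.+1) = - (1 - delta) *: (1%:M - K).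
    rewrite /P /lazy_kernel -[delta%:M]scalemx1 -[1]/(1%:M).
    by apply/matrixP => i j; rewrite !mxE; ring.
  rewrite scalerA; congr (_ *: _); rewrite /mu; field.
  by rewrite subr_eq0 gt_eqF.
have pw m i j : (((- t) *: (1%:M - K)) ^+ m) i j / m`!%:R =
    \sum_(0 <= k < m.+1) (exp_coeff mu k * (P ^+ k) i j) * exp_coeff (- mu) (m - k)%N.
  rewrite genE exprZn mxE exprDn_comm; last exact/commr_sym/commrN1.
  rewrite summxE mulr_sumr mulr_suml big_mkord; apply: eq_bigr => k _.
  have km : (k <= m)%N by rewrite -ltnS.
  have fm : (m`!%:R : R) = 'C(m, k)%:R * (k`!%:R * (m - k)`!%:R).
    by rewrite -!natrM bin_fact.
  have fn0 i' : i'`!%:R != 0 :> R by rewrite pnatr_eq0 -lt0n fact_gt0.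
  have cn0 : 'C(m, k)%:R != 0 :> R by rewrite pnatr_eq0 -lt0n bin_gt0.
  have -> : (((-1 : 'M[R]_n.+1) ^+ (m - k) * P ^+ k) *+ 'C(m, k)) i j =
      'C(m, k)%:R * ((-1) ^+ (m - k) * (P ^+ k) i j).
    rewrite -scaleN1r exprZn expr1n -scalerAl mul1r -scaler_nat !mxE.
    by [].
  have -> : mu ^+ m = mu ^+ (m - k) * mu ^+ k by rewrite -exprD subnK.
  rewrite /exp_coeff/= fm [(- mu) ^+ _]exprNn.
  by field; rewrite !fn0 cn0.
have entry i j : (expR (- mu) * \sum_(0 <= m < N) exp_coeff mu m * (P ^+ m) i j)
    @[N --> \oo] --> heat_kernel K t i j.
  set a := fun k => exp_coeff mu k * (P ^+ k) i j.
  have ha k : `|a k| <= exp_coeff mu k.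
    rewrite /a normrM ger0_norm ?exp_coeff_ge0//.
    by rewrite ler_piMr ?exp_coeff_ge0.
  have hb k : `|exp_coeff (- mu) k| <= exp_coeff mu k.
    rewrite /exp_coeff/= normrM normrX normrN (ger0_norm mu0).
    by rewrite [X in _ * X <= _]ger0_norm ?invr_ge0.
  have ca : cvgn (series a).
    apply: normed_cvg; apply: (series_le_cvg (v_ := exp_coeff mu)) => [k|k|k|].
    - exact: normr_ge0.
    - exact: exp_coeff_ge0.
    - exact: ha.
    - exact: is_cvg_series_exp_coeff.
  have cb : series (exp_coeff (- mu)) @ \oo --> expR (- mu).
    exact: is_cvg_series_exp_coeff.
  have c1 : (expR (- mu) * series a N) @[N --> \oo] --> expR (- mu) * limn (series a).
    exact: cvgMr ca.
  have c2 := cauchy_cvg mu0 ha hb.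
  have c3 := cvgD c2 (cvgM ca cb).
  have -> : heat_kernel K t i j = expR (- mu) * limn (series a).
    rewrite mxE mulrC; apply/cvg_lim => //; rewrite add0r in c3.
    rewrite (_ : series _ = fun N => (\sum_(0 <= m < N) \sum_(0 <= k < m.+1)
        a k * exp_coeff (- mu) (m - k)%N - (\sum_(0 <= k < N) a k) *
        (\sum_(0 <= l < N) exp_coeff (- mu) l))
        + series a N * series (exp_coeff (- mu)) N); first exact: c3.
    apply/funext => N.
    by rewrite /series/= subrK; apply: eq_bigr => m _; rewrite pw.
  exact: c1.
rewrite /poisson_mean.
have -> : (fun N => expR (- mu) * \sum_(0 <= m < N) exp_coeff mu m *
    \sum_j (P ^+ m) x j * f j) = (fun N => \sum_j (expR (- mu) *
    \sum_(0 <= m < N) exp_coeff mu m * (P ^+ m) x j) * f j).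
  apply/funext => N; under [RHS]eq_bigr do rewrite -mulrA mulr_suml.
  rewrite -mulr_sumr exchange_big/=; congr (_ * _); apply: eq_bigr => m _.
  by rewrite mulr_sumr; apply: eq_bigr => j _; rewrite mulrA.
by apply: cvg_finsum => j; apply: cvgMl; exact: entry.
Qed.

End Matrices.

(** * Chains with bottlenecks *)

(** The window is cut at the middle because [green] is at least [N * s / 2] for two edges in the
    same half, but can be as small as [s ^ 2] across. One half carries at least half of the
    resistance; together with [sigma = s / 2] this accounts for the [4]. *)
Lemma slow_relaxation_window (R : realFieldType) (n : nat) (delta : R)
    (p : nat -> R) (s : nat) (rho : R) (m : nat) :
  bd_weights n delta p -> (0 < s)%N -> (s.*2 <= n.+1)%N -> (0 < n)%N -> rho <= 1 ->
  4 <= rho * (s%:R * \sum_(s <= i < (n.+1 - s).+1) (p i)^-1) ->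
  exists z, [/\ (0 < z)%N, (z <= n)%N &
    (1 - rho) ^+ m <= bd_iter p m (below R z) 0 - bd_iter p m (below R z) n].
Proof.
move=> wp s0 sn n0 rho1 hrho.
have r0 i : 0 <= (p i)^-1 := weights_inv_ge0 wp i.
set I1 := fun i : nat => (s <= i <= n.+1./2)%N.
set I2 := fun i : nat => (n.+1 - n.+1./2 <= i <= n.+1 - s)%N.
pose RI I := \sum_(1 <= i < n.+1 | I i) (p i)^-1.
have RIsum : \sum_(s <= i < (n.+1 - s).+1) (p i)^-1 <= RI I1 + RI I2.
  have -> : \sum_(s <= i < (n.+1 - s).+1) (p i)^-1 =
      \sum_(1 <= i < n.+1 | (s <= i <= n.+1 - s)%N) (p i)^-1.
    rewrite (big_nat_widenl _ 1)//; rewrite (big_nat_widen _ _ n.+1); last by lia.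
    by apply: eq_bigl => i; rewrite andbC ltnS.
  rewrite /RI (big_mkcond I1) (big_mkcond I2) -big_split/= big_mkcond/=.
  apply: ler_sum => i _; case: ifP => // hi; last first.
    by rewrite addr_ge0//; case: ifP.
  have [h1|h1] := boolP (I1 i); first by rewrite lerDl; case: ifP.
  have -> : I2 i by rewrite /I1 in h1; rewrite /I2; clear -hi h1; lia.
  by rewrite add0r.
have H (I : pred nat) i0 : I i0 -> (forall i, I i -> (0 < i <= n)%N) ->
  (forall i j, I i -> I j -> n.+1%:R * (s%:R / 2) <= green R n i j) ->
  2 <= rho * (s%:R * RI I) -> exists z, [/\ (0 < z)%N, (z <= n)%N &
    (1 - rho) ^+ m <= bd_iter p m (below R z) 0 - bd_iter p m (below R z) n].
  move=> Ii0 Irange Igreen h.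
  apply: (slow_relaxation wp Ii0 Irange (sigma := s%:R / 2) _ Igreen).
    by rewrite divr_gt0 ?ltr0n.
  split=> //; rewrite -/(RI I).
  by rewrite (_ : rho * _ = rho * (s%:R * RI I) / 2) ?ler_pdivlMr ?mul1r//; ring.
have sR1 : 1 <= s%:R :> R by rewrite ler1n.
have NE : n.+1%:R = (n.+1 - n.+1./2)%:R + n.+1./2%:R :> R.
  by rewrite -natrD subnK//; lia.
have hN : n.+1%:R <= 2 * (n.+1 - n.+1./2)%:R :> R.
  by rewrite -natrM ler_nat; lia.
have rs : 4 <= rho * (s%:R * RI I1) + rho * (s%:R * RI I2).
  apply: (le_trans hrho); rewrite -mulrDr -mulrDr.
  have [rho0|rho0] := leP 0 rho; first by rewrite ler_wpM2l// ler_wpM2l.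
  have S0 : 0 <= s%:R * \sum_(s <= i < (n.+1 - s).+1) (p i)^-1.
    by rewrite mulr_ge0// sumr_ge0.
  by have := le_trans hrho (mulr_le0_ge0 (ltW rho0) S0); rewrite lern0.
have [h|h] := leP 2 (rho * (s%:R * RI I1)).
  apply: (H I1 s) => //.
  - by rewrite /I1 leqnn; lia.
  - by move=> i; rewrite /I1; clear -s0 n0; lia.
  move=> i j; rewrite /I1 => /andP[si ih] /andP[sj jh]; rewrite /green.
  have a1 k : (k <= n.+1./2)%N -> n.+1%:R / 2 <= n.+1%:R - k%:R :> R.
    move=> kh; have : k%:R <= n.+1./2%:R :> R by rewrite ler_nat.
    have : 2 * n.+1./2%:R <= n.+1%:R :> R by rewrite -natrM ler_nat; clear; lia.
    lra.
  rewrite (_ : n.+1%:R * (s%:R / 2) = s%:R * (n.+1%:R / 2)); last by ring.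
  by case: ifP => _; rewrite ler_pM ?divr_ge0 ?ler_nat ?a1.
apply: (H I2 (n.+1 - n.+1./2)%N) => //.
- by rewrite /I2 leqnn; lia.
- by move=> i; rewrite /I2; clear -s0 n0; lia.
- move=> i j; rewrite /I2 => /andP[ih isn] /andP[jh js]; rewrite /green.
  have a2 k : (k <= n.+1 - s)%N -> s%:R <= n.+1%:R - k%:R :> R.
    move=> ks; rewrite -natrB; first by rewrite ler_nat; clear -ks sn; lia.
    by clear -ks; lia.
  have a3 k : (n.+1 - n.+1./2 <= k)%N -> n.+1%:R / 2 <= k%:R :> R.
    move=> kh; have : (n.+1 - n.+1./2)%:R <= k%:R :> R by rewrite ler_nat.
    lra.
  rewrite (_ : n.+1%:R * (s%:R / 2) = (n.+1%:R / 2) * s%:R); last by ring.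
  by case: ifP => _; rewrite ler_pM ?divr_ge0 ?a2 ?a3.
- lra.
Qed.

Section Chain.
Variables (R : realType) (n k : nat) (delta eps : R) (x : 'I_k -> 'I_n.+1).

(* [inord] returns the junk value [0] for [i > n]; only [0 < i <= n] is used. *)
Definition edge_weight (i : nat) : R :=
  if (inord i : 'I_n.+1) \in codom x then eps else 2^-1.

Definition lazy_weight (i : nat) : R :=
  if (0 < i <= n)%N then (1 - delta) * edge_weight i else 0.

Hypotheses (d0 : 0 < delta) (d1 : delta < 1) (n1 : (0 < n)%N).
Variable K : 'M[R]_n.+1.
Hypothesis HK : bottleneck_chain K eps x.

Let e0 : 0 < eps. Proof. by case: HK => _ []. Qed.
Let e1 : eps <= 2^-1. Proof. by case: HK => _ []. Qed.
Let xinj : injective x. Proof. by case: HK => _ []. Qed.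

Lemma edge_weight_itv i : 0 < edge_weight i <= 2^-1.
Proof. by rewrite /edge_weight; case: ifP => _; rewrite ?e0 ?e1// lexx andbT. Qed.

Lemma lazy_weightP : bd_weights n delta lazy_weight.
Proof.
have d1' : 0 < 1 - delta by rewrite subr_gt0.
split=> [//|i ni|i i_n|].
- by rewrite /lazy_weight; case: ifP => // /andP[_]; rewrite leqNgt ni.
- by rewrite /lazy_weight i_n mulr_gt0//; case/andP: (edge_weight_itv i).
- split=> // i; have /andP[w0 w1] := edge_weight_itv i; rewrite /lazy_weight.
  case: ifP => _; last by rewrite lexx divr_ge0 ?(ltW d1').
  by rewrite mulr_ge0 ?(ltW d1') ?(ltW w0)//= ler_wpM2l ?(ltW d1').
Qed.

Lemma sum_ord_single (c : R) (y : nat) :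
  \sum_(j < n.+1) (if (j == y :> nat) then c else 0) = if (y <= n)%N then c else 0.
Proof.
case: ifP => yn.
  have yn' : (y < n.+1)%N by [].
  rewrite (bigD1 (Ordinal yn'))//= eqxx big1 ?addr0// => j.
  by rewrite -val_eqE/= => /negbTE ->.
by rewrite big1// => j _; case: eqP => // jy; move: (ltn_ord j); rewrite jy ltnS yn.
Qed.

Lemma lazy_kernel_bd (f : nat -> R) (i : 'I_n.+1) :
  \sum_j lazy_kernel delta K i j * f j = bd_op lazy_weight f i.
Proof.
have [[[_ K1] Kbd _ Kw] _] := HK.
have -> : \sum_j lazy_kernel delta K i j * f j =
    f i + (1 - delta) * \sum_j K i j * (f j - f i).
  have -> : \sum_j K i j * (f j - f i) = \sum_j K i j * f j - f i.
    by under eq_bigr do rewrite mulrBr; rewrite sumrB -mulr_suml K1 mul1r.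
  rewrite mulrBr mulr_sumr.
  have -> : \sum_j lazy_kernel delta K i j * f j =
      \sum_(j < n.+1) (if (j == i :> nat) then delta * f i else 0)
      + \sum_j (1 - delta) * (K i j * f j).
    rewrite -big_split/=; apply: eq_bigr => j _; rewrite !mxE mulrDl mulrA.
    congr (_ + _); have [->|ij] := eqVneq j i; first by rewrite eqxx mulr1n.
    by rewrite (_ : (j == i :> nat) = false) ?mulr0n ?mul0r//; apply/negbTE.
  by rewrite sum_ord_single -ltnS ltn_ord; ring.
have Kup (j : 'I_n.+1) : j = i.+1 :> nat -> K i j = edge_weight j.
  by move=> ji; have [-> _] := Kw _ _ ji; rewrite /edge_weight inord_val.
have Kdown (j : 'I_n.+1) : i = j.+1 :> nat -> K i j = edge_weight i.
  by move=> ji; have [_ ->] := Kw _ _ ji; rewrite /edge_weight inord_val.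
have -> : \sum_j K i j * (f j - f i) =
   \sum_(j < n.+1) (if (j == i.+1 :> nat) then edge_weight i.+1 * (f i.+1 - f i) else 0)
   + \sum_(j < n.+1) (if (j == i.-1 :> nat) then
      (if (0 < i)%N then edge_weight i * (f i.-1 - f i) else 0) else 0).
  rewrite -big_split/=; apply: eq_bigr => j _.
  have [ji|ji] := eqVneq (j : nat) i.+1.
    have -> : (j == i.-1 :> nat) = false by rewrite ji; lia.
    by rewrite Kup// ji addr0.
  rewrite add0r; have [ji'|ji'] := eqVneq (j : nat) i.-1.
    have [i0|i0] := posnP i; last by rewrite Kdown ?ji'// prednK.
    have -> : j = i by apply/val_inj; rewrite /= ji' i0.
    by rewrite subrr mulr0.
  have [->|ij] := eqVneq j i; first by rewrite subrr mulr0.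
  rewrite Kbd ?mul0r//; move: ij; rewrite -val_eqE/=.
  by clear -ji ji'; lia.
rewrite !sum_ord_single /bd_op /lazy_weight.
have -> : (i.-1 <= n)%N by have := ltn_ord i; clear; lia.
have -> : (i <= n)%N by have := ltn_ord i.
by rewrite /= andbT; case: (i < n)%N; case: (0 < i)%N; rewrite /=; ring.
Qed.

Lemma codom_sum (F : nat -> R) u v : (v <= n.+1)%N ->
  \sum_(u <= i < v) (if (inord i : 'I_n.+1) \in codom x then F i else 0) =
  \sum_(l < k | (u <= x l < v)%N) F (x l).
Proof.
move=> vn; pose G (j : 'I_n.+1) := if (u <= j < v)%N then F j else 0.
transitivity (\sum_(l < k) G (x l)); last by rewrite [RHS]big_mkcond.
have -> : \sum_(l < k) G (x l) = \sum_(j in codom x) G j.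
  rewrite -big_uniq/=; last by rewrite map_inj_uniq// enum_uniq.
  by rewrite big_map big_enum.
rewrite (big_nat_widenl _ 0)//= (big_nat_widen _ _ n.+1)//= big_mkord.
rewrite big_mkcond [RHS]big_mkcond/=; apply: eq_bigr => j _.
rewrite inord_val /G andbC; case: (_ \in _) => //; by case: ifP.
Qed.

End Chain.

Lemma sum_nat_sub_rev (R : nmodType) (F : nat -> R) N h : (h <= N)%N ->
  \sum_(1 <= i < h.+1) F (N - i)%N = \sum_(N - h <= j < N) F j.
Proof.
elim: h => [|h IHh] hN; first by rewrite subn0 !big_geq.
rewrite big_nat_recr//= IHh; last by lia.
rewrite [RHS]big_ltn; last by lia.
by rewrite addrC (_ : (N - h = (N - h.+1).+1)%N)//; lia.
Qed.

(** * Resistance sums in terms of [a_coef] and [b_coef] *)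

Section Estimates.
Variables (R : realType) (n k : nat) (delta eps : R) (x : 'I_k -> 'I_n.+1).
Hypotheses (d0 : 0 < delta) (d1 : delta < 1) (n1 : (0 < n)%N).
Variable K : 'M[R]_n.+1.
Hypothesis HK : bottleneck_chain K eps x.

Let e0 : 0 < eps. Proof. by case: HK => _ []. Qed.
Let e1 : eps <= 2^-1. Proof. by case: HK => _ []. Qed.
Let w := lazy_weight delta eps x.
Let wp : bd_weights n delta w := lazy_weightP d0 d1 HK.
Let N : R := n.+1%:R.
Let a : R := (a_coef x)%:R.
Let b : R := (b_coef x)%:R.
Let c := (1 - delta)^-1.
(** As [eps^-1 >= 2], the quotient of [(w i)^-1] by [c] lies between the maximum and the sum of [2]
    and [ind i]. *)
Let ind i := if (inord i : 'I_n.+1) \in codom x then eps^-1 else 0.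

Let c0 : 0 < c. Proof. by rewrite invr_gt0 subr_gt0. Qed.
Let ie0 : 0 < eps^-1. Proof. by rewrite invr_gt0. Qed.
Let ie2 : 2 <= eps^-1.
Proof. by rewrite -[leLHS]invrK lef_pV2// posrE. Qed.
Let ind0 i : 0 <= ind i. Proof. by rewrite /ind; case: ifP => // _; exact: ltW. Qed.

Lemma inv_lazy_weight i : (0 < i <= n)%N ->
  (w i)^-1 = c * (if (inord i : 'I_n.+1) \in codom x then eps^-1 else 2).
Proof.
move=> i_n; rewrite /w /lazy_weight i_n invfM /edge_weight.
by congr (_ * _); case: ifP => // _; rewrite invrK.
Qed.

Let inv_lo2 i : (0 < i <= n)%N -> c * 2 <= (w i)^-1.
Proof. by move=> /inv_lazy_weight ->; rewrite ler_wpM2l ?(ltW c0)//; case: ifP. Qed.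

Let inv_loe i : (0 < i <= n)%N -> c * ind i <= (w i)^-1.
Proof.
by move=> /inv_lazy_weight ->; rewrite ler_wpM2l ?(ltW c0)// /ind; case: ifP.
Qed.

Let inv_hi i : (0 < i <= n)%N -> (w i)^-1 <= c * (2 + ind i).
Proof.
move=> /inv_lazy_weight ->; rewrite ler_wpM2l ?(ltW c0)// /ind.
by case: ifP => _; rewrite ?addr0// lerDr.
Qed.

(** The count in [b_coef] at [j = s - 1], so that [s * bottlenecks s] is one of the candidates in
    its maximum. *)
Definition bottlenecks s := #|[pred l : 'I_k | (s.-1 < x l <= n - s.-1)%N]|.

Let sum_ind s : (0 < s)%N -> (s.*2 <= n.+1)%N ->
  \sum_(s <= i < (n.+1 - s).+1) ind i = (bottlenecks s)%:R / eps.
Proof.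
move=> s0 sn; rewrite (codom_sum HK (fun=> eps^-1)); last by lia.
rewrite big_const iter_addr_0 [RHS]mulr_natl; congr (_ *+ _).
by apply: eq_card => l; rewrite !inE; lia.
Qed.

Let window_range s i : (0 < s)%N -> (s <= i < (n.+1 - s).+1)%N -> (0 < i <= n)%N.
Proof. by lia. Qed.

Let sum2 s : (s.*2 <= n.+1)%N ->
  \sum_(s <= i < (n.+1 - s).+1) 2 = 2 * (N - 2 * s%:R + 1) :> R.
Proof.
move=> sn; rewrite big_const_nat iter_addr_0 -[LHS]mulr_natr; congr (_ * _).
rewrite subSn ?natr1; last by lia.
by rewrite -natr1 -subnDA addnn natrB// -mul2n natrM.
Qed.

Lemma chain_edge_bound : edge_bound n w (c * (N ^+ 2 + b / eps)).
Proof.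
move=> s s0; have [sn|sn] := leqP s.*2 n.+1; last first.
  rewrite big_geq; last by lia.
  by rewrite mulr0 mulr_ge0 ?(ltW c0)// addr_ge0 ?exprn_ge0// divr_ge0 ?(ltW e0).
have h : \sum_(s <= i < (n.+1 - s).+1) (w i)^-1 <=
    c * (2 * (N - 2 * s%:R + 1) + (bottlenecks s)%:R / eps).
  rewrite -sum_ind// -sum2// -big_split/= mulr_sumr.
  by apply: ler_sum_nat => i /(window_range s0); exact: inv_hi.
have bs : s%:R * (bottlenecks s)%:R <= b.
  rewrite -natrM ler_nat /b_coef.
  have jn : (s.-1 < n.+1)%N by lia.
  have jP : ((Ordinal jn).*2 <= n)%N by rewrite /=; lia.
  apply: (bigop.bigmax_sup (Ordinal jn)); first exact: jP.
  by rewrite /bottlenecks /= prednK.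
apply: (le_trans (ler_wpM2l (ler0n R s) h)); rewrite mulrCA ler_wpM2l ?(ltW c0)//.
rewrite mulrDr; apply: lerD; last by rewrite mulrA ler_wpM2r ?(ltW ie0).
have s1 : 1 <= s%:R :> R by rewrite ler1n.
have sN : 2 * s%:R <= N by rewrite -natrM ler_nat mul2n.
have -> : N ^+ 2 = N * N by [].
rewrite mulrA [s%:R * 2]mulrC ler_pM//; lra.
Qed.

(** The converse of [chain_edge_bound] up to a factor [16]: the maximizer of [b_coef] serves when
    [b / eps] dominates, and about a quarter of the segment when [N ^ 2] does. *)
Lemma chain_window : (8 <= n)%N -> exists s, [/\ (0 < s)%N, (s.*2 <= n.+1)%N &
  c * (N ^+ 2 + b / eps) <= 16 * (s%:R * \sum_(s <= i < (n.+1 - s).+1) (w i)^-1)].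
Proof.
move=> n8; have [le1|le2] := leP (N ^+ 2) (b / eps).
  have A0 : (0 < #|[pred j : 'I_n.+1 | (j.*2 <= n)%N]|)%N.
    by apply/card_gt0P; exists ord0; rewrite inE.
  have [j jP jmax] := eq_bigmax_cond (fun j : 'I_n.+1 =>
    (j.+1 * #|[pred l : 'I_k | (j < x l <= n - j)%N]|)%N) A0.
  have jn : (j.*2 <= n)%N by rewrite inE in jP.
  have bE : b = j.+1%:R * (bottlenecks j.+1)%:R.
    by rewrite -natrM /b /b_coef; congr (_%:R); exact: jmax.
  (* A maximizer this close to the middle has an empty window, hence [b = 0], against the dominance
     of [b / eps]. *)
  have [jn2|jn2] := leqP j.+1.*2 n.+1; last first.
    have b0 : bottlenecks j.+1 = 0%N.
      by apply: eq_card0 => l; rewrite !inE /=; clear -jn jn2; lia.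
    move: le1; rewrite bE b0 mulr0 mul0r leNgt => /negP[].
    by rewrite exprn_gt0// ltr0n.
  exists j.+1; split=> //.
  have h : c * ((bottlenecks j.+1)%:R / eps) <=
      \sum_(j.+1 <= i < (n.+1 - j.+1).+1) (w i)^-1.
    rewrite -sum_ind// mulr_sumr; apply: ler_sum_nat => i.
    by move=> /(@window_range j.+1 i isT); exact: inv_loe.
  apply: (@le_trans _ _ (16 * (j.+1%:R * (c * ((bottlenecks j.+1)%:R / eps)))));
    last by rewrite ler_wpM2l// ler_wpM2l.
  rewrite (_ : 16 * _ = c * (16 * (b / eps))); last by rewrite bE; ring.
  rewrite ler_wpM2l ?(ltW c0)//.
  have : 0 <= N ^+ 2 by exact: sqr_ge0.
  move: le1; move: (N ^+ 2) (b / eps) => *; lra.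
pose s := n.+1./2./2.
have s0 : (0 < s)%N by rewrite /s; lia.
have sn : (s.*2 <= n.+1)%N by rewrite /s; lia.
have s4 : (4 * s <= n.+1)%N by rewrite /s; lia.
have s8 : (n.+1 <= 8 * s)%N by rewrite /s; lia.
exists s; split=> //.
have h : c * (2 * (N - 2 * s%:R + 1)) <= \sum_(s <= i < (n.+1 - s).+1) (w i)^-1.
  rewrite -sum2// mulr_sumr; apply: ler_sum_nat => i.
  by move=> /(window_range s0); exact: inv_lo2.
apply: (@le_trans _ _ (16 * (s%:R * (c * (2 * (N - 2 * s%:R + 1))))));
  last by rewrite ler_wpM2l// ler_wpM2l.
rewrite (_ : 16 * _ = c * (16 * (s%:R * (2 * (N - 2 * s%:R + 1))))); last by ring.
rewrite ler_wpM2l ?(ltW c0)//; apply: (@le_trans _ _ (2 * (N * N))).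
  by move: le2; rewrite expr2; lra.
have s4' : 4 * s%:R <= N by rewrite -natrM ler_nat.
have s8' : N <= 8 * s%:R by rewrite -natrM ler_nat.
rewrite (_ : 16 * _ = 2 * ((8 * s%:R) * (2 * (N - 2 * s%:R + 1)))); last by ring.
rewrite ler_wpM2l// ler_pM//; lra.
Qed.

Let half_leN i : (i <= n.+1./2)%N -> 2 * i%:R <= N.
Proof. by move=> ih; rewrite -natrM ler_nat; lia. Qed.

Let sum_half_le (u : nat -> nat) h : (h <= n.+1./2)%N ->
  (forall i, (0 < i <= h)%N -> (0 < u i <= n)%N) ->
  \sum_(1 <= i < h.+1) i%:R * (w (u i))^-1 <=
  c * (N ^+ 2 + \sum_(1 <= i < h.+1) i%:R * ind (u i)).
Proof.
move=> hn uP; have hN : h%:R <= N by rewrite ler_nat; lia.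
apply: (@le_trans _ _ (c * (\sum_(1 <= i < h.+1) (N + i%:R * ind (u i))))).
  rewrite mulr_sumr; apply: ler_sum_nat => i ih.
  have i2 : 2 * i%:R <= N by apply: half_leN; lia.
  have := inv_hi (uP i ih) => /(ler_wpM2l (ler0n R i)) /le_trans; apply.
  by rewrite mulrCA ler_wpM2l ?(ltW c0)// mulrDr lerD2r mulrC.
rewrite ler_wpM2l ?(ltW c0)// big_split/= lerD2r big_const_nat iter_addr_0.
by rewrite subn1/= -[leLHS]mulr_natr expr2 ler_wpM2l.
Qed.

Let left_ind h : (h <= n.+1./2)%N -> \sum_(1 <= i < h.+1) i%:R * ind i =
  (\sum_(l < k | (0 < x l <= h)%N) (x l)%:R) / eps.
Proof.
move=> hn; have hn' : (h.+1 <= n.+1)%N by clear -hn; lia.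
rewrite mulr_suml; have /= <- := codom_sum HK (fun i => i%:R * eps^-1) 1 hn'.
by apply: eq_bigr => i _; rewrite /ind; case: ifP; rewrite ?mulr0.
Qed.

Let right_ind h : (h <= n.+1./2)%N -> \sum_(1 <= i < h.+1) i%:R * ind (n.+1 - i) =
  (\sum_(l < k | (n.+1 - h <= x l < n.+1)%N) (n.+1 - x l)%:R) / eps.
Proof.
move=> hn; rewrite mulr_suml.
have /= <- := codom_sum HK (fun i => (n.+1 - i)%:R * eps^-1) (n.+1 - h) (leqnn _).
rewrite -(sum_nat_sub_rev (fun i => if inord i \in codom x then (n.+1 - i)%:R / eps else 0));
  last by lia.
apply: eq_big_nat => i ih; rewrite /ind subKn; last by lia.
by case: ifP; rewrite ?mulr0.
Qed.

Lemma chain_half_mean_le : half_mean n w <= c * (N ^+ 2 + a / eps).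
Proof.
have := @sum_half_le id n.+1./2 (leqnn _); rewrite /half_mean /hit_mean => h.
apply: le_trans (h _) _; first by lia.
rewrite ler_wpM2l ?(ltW c0)// lerD2l left_ind// ler_wpM2r ?(ltW ie0)//.
rewrite /a /a_coef -natr_sum ler_nat big_mkcond; apply: leq_sum => l _.
by case: ifP => //; clear; lia.
Qed.

Lemma chain_half_mean_rev_le :
  half_mean n (rev_weights n w) <= c * (N ^+ 2 + a / eps).
Proof.
have := @sum_half_le (fun i => n.+1 - i)%N n.+1./2 (leqnn _).
rewrite /half_mean /hit_mean => h.
apply: le_trans (h _) _; first by lia.
rewrite ler_wpM2l ?(ltW c0)// lerD2l right_ind// ler_wpM2r ?(ltW ie0)//.
rewrite /a /a_coef -natr_sum ler_nat big_mkcond; apply: leq_sum => l _.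
by case: ifP => //; clear; lia.
Qed.

Lemma chain_half_mean_ge_quad : c * (n%:R ^+ 2 / 4) <= half_mean n w.
Proof.
set h := n.+1./2.
have s2 m : 2 * \sum_(1 <= i < m.+1) i%:R = m%:R * (m%:R + 1) :> R.
  elim: m => [|m IHm]; first by rewrite big_geq// mulr0 mul0r.
  by rewrite big_nat_recr//= mulrDr IHm -natr1; ring.
apply: (@le_trans _ _ (\sum_(1 <= i < h.+1) i%:R * (c * 2))).
  rewrite -mulr_suml (_ : _ * (c * 2) = c * (2 * \sum_(1 <= i < h.+1) i%:R)); last by ring.
  rewrite s2 ler_wpM2l ?(ltW c0)//.
  have : n%:R <= 2 * h%:R :> R by rewrite -natrM ler_nat /h; lia.
  have : 0 <= n%:R :> R by [].
  have : 0 <= h%:R :> R by [].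
  by nra.
apply: ler_sum_nat => i ih; rewrite ler_wpM2l//; apply: inv_lo2.
by move: ih; rewrite /h; lia.
Qed.

(** Each term of [a_coef] is the distance to the nearer end, so each bottleneck is charged in the
    half on its own side. *)
Lemma chain_half_mean_ge_ind : c * (a / eps) <=
  half_mean n w + half_mean n (rev_weights n w).
Proof.
set h := n.+1./2.
apply: (@le_trans _ _ (c * (\sum_(1 <= i < h.+1) i%:R * ind i +
    \sum_(1 <= i < h.+1) i%:R * ind (n.+1 - i)))).
  rewrite left_ind// right_ind// -mulrDl ler_wpM2l ?(ltW c0)// ler_wpM2r ?(ltW ie0)//.
  rewrite -!natr_sum -natrD ler_nat /a_coef.
  rewrite [X in (_ <= X + _)%N]big_mkcond [X in (_ <= _ + X)%N]big_mkcond/=.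
  rewrite -big_split/=; apply: leq_sum => l _; have := ltn_ord (x l).
  by rewrite /h; case: ifP; case: ifP; clear; lia.
rewrite mulrDr /half_mean /hit_mean -/h; apply: lerD; rewrite mulr_sumr;
  apply: ler_sum_nat => i ih; rewrite mulrCA ler_wpM2l//; apply: inv_loe;
  by move: ih; rewrite /h; lia.
Qed.

(** Every bottleneck counted at [j] contributes at least [j + 1] to [a_coef]. *)
Lemma b_coef_le_a_coef : b <= a.
Proof.
rewrite ler_nat; apply/bigmax_leqP => j jn.
rewrite /a_coef mulnC -sum_nat_const [leqLHS]big_mkcond.
by apply: leq_sum => l _; rewrite inE; case: ifP => //; clear; lia.
Qed.

Lemma b_coef_gt0 : 0 < a -> 0 < b.
Proof.
rewrite !ltr0n => a0.
have [l l0] : exists l, (0 < minn (x l) (n.+1 - x l))%N.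
  apply: contrapT => h; move: a0; rewrite /a_coef big1// => l _.
  by apply/eqP; rewrite -leqn0 leqNgt; apply/negP => l0; apply: h; exists l.
have jP : ((ord0 : 'I_n.+1).*2 <= n)%N by [].
apply: (bigop.bigmax_sup ord0) => //.
rewrite mul1n; apply/card_gt0P; exists l; rewrite inE /= subn0.
by have := ltn_ord (x l); move: l0; clear; lia.
Qed.

End Estimates.

(** * Mixing times and cutoff *)

Section Profile.
Variables (R : realType) (I : Type) (valid : I -> Prop) (out : I -> R) (sc : R).
Hypothesis sc0 : 0 < sc.
Hypothesis out0 : forall i, valid i -> 0 <= out i.
Hypothesis cover : forall u : R, 0 <= u ->
  exists i, valid i /\ u <= out i / sc <= u + 1.

(* Both time scales at once: [I] indexes the admissible times, [out i] is the
   time itself and [out i / sc] its value counted in steps of the lazy chain,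
   so that [sc] is [1] in discrete and [1 - delta] in continuous time. *)
Definition mix_time (d : I -> R) (e : R) : R :=
  inf [set out i | i in [set i | valid i /\ d i <= e]].

(** One [D] is the margin for the hitting time, the other that for the Poisson number of steps. The
    upper limit on the time bounds the Poisson variance; [cover] supplies a time in this unit
    window. *)
Definition upper_bd (C e : R) (d : I -> R) (M B : R) := forall (D : R) i,
  0 < D -> C * (M + B) * B <= D ^+ 2 -> valid i ->
  M + C * B + 2 * D <= out i / sc <= M + C * B + 2 * D + 1 -> d i <= e.

Definition lower_bd (C e : R) (d : I -> R) (M B : R) := forall (D : R) i,
  0 < D -> C * M * B <= D ^+ 2 -> valid i ->
  out i / sc + C * B + 2 * D <= M -> 1 - e <= d i.

Definition half_bd (d : I -> R) (M : R) := forall i, valid i ->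
  2^-1 - out i / sc / M <= d i.

(** Half of the loss [1/4] is due to using two starting points and half to the Poisson law, for
    which [k] exceeds twice the mean number of steps. *)
Definition slow_bd (d : I -> R) (B : R) := forall i (k : nat), valid i ->
  64 <= B -> 2 * (out i / sc) + 5 <= k%:R -> (1 - 64 / B) ^+ k / 4 <= d i.

Section OneChain.
Variables (d : I -> R) (M B : R).
Hypotheses (M0 : 0 < M) (B0 : 0 < B).

Lemma ex_mixed (C e D : R) : 0 < C -> upper_bd C e d M B -> 0 < D ->
  C * (M + B) * B <= D ^+ 2 ->
  exists i, [/\ valid i, d i <= e & out i / sc <= M + C * B + 2 * D + 1].
Proof.
move=> C0 ub D0 CD.
have u0 : 0 <= M + C * B + 2 * D.
  by rewrite !addr_ge0// ?mulr_ge0// ltW.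
have [i [vi ii]] := cover u0; exists i; split=> //; first exact: (ub D).
by case/andP: ii.
Qed.

Lemma mix_time_le (e : R) i : valid i -> d i <= e -> mix_time d e <= out i.
Proof.
move=> vi di; apply: ge_inf; last by exists i.
by exists 0 => _ [j [vj _] <-]; exact: out0.
Qed.

Lemma mix_time_ge (e u : R) i0 : valid i0 -> d i0 <= e ->
  (forall i, valid i -> d i <= e -> u <= out i / sc) -> sc * u <= mix_time d e.
Proof.
move=> v0 d0 h; apply: lb_le_inf; first by exists (out i0), i0.
by move=> _ [i [vi di] <-]; rewrite mulrC -ler_pdivlMr// h.
Qed.

Lemma mix_time_anti (e h : R) i0 : valid i0 -> d i0 <= e -> e <= h ->
  mix_time d h <= mix_time d e.
Proof.
move=> v0 d0 eh; apply: lb_le_inf; first by exists (out i0), i0.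
by move=> _ [i [vi di] <-]; apply: mix_time_le => //; apply: le_trans di eh.
Qed.

(** No separation of [M] from [B] is available here, so the crude margin [D = (C + 1) * (M + B)] is
    taken; the lower bound rests on the first moment. *)
Lemma mix_time_order (C e Q : R) : 0 < C -> 1 <= B -> B <= Q * M -> 1 <= Q ->
  upper_bd C e d M B -> half_bd d M ->
  sc * ((2^-1 - e) * M) <= mix_time d e <= sc * ((5 * (C + 1) * (1 + Q)) * M).
Proof.
move=> C0 B1 BQ Q1 ub hb; have [D DE] : exists D, D = (C + 1) * (M + B) by eexists.
have D0 : 0 < D by rewrite DE mulr_gt0 ?addr_gt0.
have CD : C * (M + B) * B <= D ^+ 2.
  have -> : D ^+ 2 = (C * (M + B) * B) + ((C ^+ 2 + C + 1) * (M + B) ^+ 2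
     + C * (M + B) * M) by rewrite DE; ring.
  rewrite lerDl addr_ge0 ?mulr_ge0 ?addr_ge0 ?sqr_ge0//; exact: ltW.
have [i [vi di ii]] := ex_mixed C0 ub D0 CD.
apply/andP; split.
  apply: (mix_time_ge vi di) => j vj dj; have := le_trans (hb j vj) dj.
  by rewrite lerBlDr -lerBlDl ler_pdivlMr.
apply: le_trans (mix_time_le vi di) _; rewrite mulrC -ler_pdivrMr//.
apply: le_trans ii _.
have MB : M + B <= (1 + Q) * M by lra.
have h1 : M + C * B + 2 * D + 1 <= 5 * (C + 1) * (M + B).
  have : 0 <= C * M by rewrite mulr_ge0 ?ltW.
  have : 0 <= C * B by rewrite mulr_ge0 ?ltW.
  rewrite DE => h1 h2; lra.
by apply: le_trans h1 _; rewrite -[leRHS]mulrA ler_wpM2l// mulr_ge0// addr_ge0// ltW.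
Qed.

Lemma mix_time_upper (C e r : R) : 0 < C -> 0 < r -> r <= 1 -> 1 <= B ->
  (128 * C / r ^+ 2 + 4 * C / r + 4 / r + 1) * B <= M ->
  upper_bd C e d M B ->
  exists i, [/\ valid i, d i <= e & out i <= sc * ((1 + r) * M)].
Proof.
(* With this [D], the term [128 * C / r ^ 2] yields the variance condition, and [C * B], [2 * D] and
   [1] each stay below [r * M / 4]. *)
move=> C0 r0 r1 B1 AB ub; have [D DE] : exists D, D = r * M / 8 by eexists.
have D0 : 0 < D by rewrite DE divr_gt0// mulr_gt0.
have p1 : 0 <= 128 * C / r ^+ 2 by rewrite divr_ge0 ?exprn_ge0 ?mulr_ge0 ?ltW.
have p2 : 0 <= 4 * C / r by rewrite divr_ge0 ?mulr_ge0 ?ltW.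
have p3 : 0 <= 4 / r by rewrite divr_ge0 ?ltW.
have hM y : 0 <= y -> y <= 128 * C / r ^+ 2 + 4 * C / r + 4 / r + 1 -> y * B <= M.
  by move=> y0 yA; apply: (le_trans _ AB); rewrite ler_wpM2r ?(ltW B0).
have h1 : 128 * C / r ^+ 2 * B <= M by apply: hM => //; lra.
have h2 : 4 * C / r * B <= M by apply: hM => //; lra.
have h3 : 4 / r * B <= M by apply: hM => //; lra.
have h4 : B <= M by rewrite -[B]mul1r; apply: hM => //; lra.
have g1 : 128 * C * B <= r ^+ 2 * M.
  by move: h1; rewrite mulrAC ler_pdivrMr ?exprn_gt0// mulrC [leRHS]mulrC mulrC.
have g2 : 4 * C * B <= r * M by move: h2; rewrite mulrAC ler_pdivrMr// [leRHS]mulrC.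
have g3 : 4 * B <= r * M by move: h3; rewrite mulrAC ler_pdivrMr// [leRHS]mulrC.
have CD : C * (M + B) * B <= D ^+ 2.
  have -> : D ^+ 2 = 64^-1 * (r ^+ 2 * M) * M by rewrite DE; field.
  apply: (@le_trans _ _ (64^-1 * (128 * C * B) * M)); last first.
    by rewrite ler_wpM2r ?(ltW M0)// ler_wpM2l.
  have : 0 <= C * B * (M - B) by rewrite !mulr_ge0 ?(ltW C0) ?(ltW B0)// subr_ge0.
  lra.
have [i [vi di ii]] := ex_mixed C0 ub D0 CD.
exists i; split=> //; rewrite mulrC -ler_pdivrMr//; apply: le_trans ii _.
rewrite DE; lra.
Qed.

Lemma mix_time_lower (C e r : R) i : 0 < C -> 0 < r -> r <= 1 -> 1 <= B ->
  (128 * C / r ^+ 2 + 4 * C / r + 4 / r + 1) * B <= M ->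
  lower_bd C e d M B -> valid i -> d i < 1 - e -> (1 - r) * M <= out i / sc.
Proof.
move=> C0 r0 r1 B1 AB lb vi di; have [D DE] : exists D, D = r * M / 8 by eexists.
have D0 : 0 < D by rewrite DE divr_gt0// mulr_gt0.
have p1 : 0 <= 128 * C / r ^+ 2 by rewrite divr_ge0 ?exprn_ge0 ?mulr_ge0 ?ltW.
have p2 : 0 <= 4 * C / r by rewrite divr_ge0 ?mulr_ge0 ?ltW.
have p3 : 0 <= 4 / r by rewrite divr_ge0 ?ltW.
have hM y : 0 <= y -> y <= 128 * C / r ^+ 2 + 4 * C / r + 4 / r + 1 -> y * B <= M.
  by move=> y0 yA; apply: (le_trans _ AB); rewrite ler_wpM2r ?(ltW B0).
have h1 : 128 * C / r ^+ 2 * B <= M by apply: hM => //; lra.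
have h2 : 4 * C / r * B <= M by apply: hM => //; lra.
have g1 : 128 * C * B <= r ^+ 2 * M.
  by move: h1; rewrite mulrAC ler_pdivrMr ?exprn_gt0// mulrC [leRHS]mulrC mulrC.
have g2 : 4 * C * B <= r * M by move: h2; rewrite mulrAC ler_pdivrMr// [leRHS]mulrC.
have CD : C * M * B <= D ^+ 2.
  have -> : D ^+ 2 = 64^-1 * (r ^+ 2 * M) * M by rewrite DE; field.
  apply: (@le_trans _ _ (64^-1 * (128 * C * B) * M)); last first.
    by rewrite ler_wpM2r ?(ltW M0)// ler_wpM2l.
  have : 0 <= C * B * M by rewrite !mulr_ge0 ?ltW.
  lra.
rewrite leNgt; apply/negP => small.
have hD : out i / sc + C * B + 2 * D <= M by rewrite DE; lra.
by have := lb D i D0 CD vi hD; rewrite leNgt di.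
Qed.

End OneChain.

Lemma slow_decay (Q : R) : exists c : R, 0 < c /\ forall (B : R) (k : nat),
  128 <= B -> k%:R <= Q * B -> c <= (1 - 64 / B) ^+ k.
Proof.
(* The [k] steps fit into [q] blocks of length [m] between [B / 256] and [B / 128]; by Bernoulli's
   inequality each block loses at most a factor [2]. *)
have [q hq] : exists q : nat, 256 * Q <= q%:R.
  exists (Num.bound `|256 * Q|); apply: le_trans (ler_norm _) _.
  by apply/ltW; apply: archi_boundP.
exists (2^-1 ^+ q); split; first by rewrite exprn_gt0.
move=> B k B1 kB; have B0 : 0 < B by lra.
have [m [m1 m2 mge1]] : exists m : nat, [/\ m%:R <= B / 128,
    B / 128 < m%:R + 1 & (1 <= m)%N].
  have /andP[m1 m2] := truncn_itv (divr_ge0 (ltW B0) (ler0n R 128)).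
  by exists (Num.truncn (B / 128)); split; rewrite ?natr1 ?truncn_gt0//; lra.
have [y [yE x0 x1 yB]] : exists y, [/\ 64 / B = y, 0 <= y, y <= 2^-1 &
    B / 128 * y = 2^-1].
  exists (64 / B); split=> //; first by rewrite divr_ge0// ltW.
    by rewrite ler_pdivrMr//; lra.
  by field; rewrite gt_eqF.
rewrite yE.
have mB : B / 256 <= m%:R.
  have : 1 <= m%:R :> R by rewrite ler1n.
  lra.
have km : (k <= m * q)%N.
  rewrite -(ler_nat R) natrM; apply: le_trans kB _.
  have h1 : 0 <= (m%:R - B / 256) * q%:R.
    by apply: mulr_ge0; [rewrite subr_ge0 | exact: ler0n].
  have h2 : 0 <= (q%:R - 256 * Q) * B.
    by apply: mulr_ge0; [rewrite subr_ge0 | exact: ltW].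
  lra.
have bern j : 1 - j%:R * y <= (1 - y) ^+ j.
  elim: j => [|j IHj]; first by rewrite mul0r subr0 expr0.
  rewrite exprSr; apply: (@le_trans _ _ ((1 - j%:R * y) * (1 - y))).
    have h : 0 <= j%:R * y * y by rewrite !mulr_ge0.
    by rewrite -natr1; lra.
  by rewrite ler_wpM2r// subr_ge0; lra.
have y1 : 0 <= 1 - y by lra.
apply: (@le_trans _ _ ((1 - y) ^+ (m * q))); last first.
  by apply: ler_wiXn2l => //; lra.
rewrite exprM lerXn2r// ?nnegrE ?exprn_ge0//.
apply: le_trans (bern m); have : m%:R * y <= B / 128 * y by rewrite ler_wpM2r.
by rewrite yB; lra.
Qed.

Lemma ex_mixed_any (d : I -> R) (M B C e : R) : 0 < M -> 0 < B -> 0 < C ->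
  upper_bd C e d M B -> exists i, valid i /\ d i <= e.
Proof.
move=> M0 B0 C0 ub; have D0 : 0 < (C + 1) * (M + B) by rewrite mulr_gt0 ?addr_gt0.
have CD : C * (M + B) * B <= ((C + 1) * (M + B)) ^+ 2.
  have -> : ((C + 1) * (M + B)) ^+ 2 = (C * (M + B) * B) +
     ((C ^+ 2 + C + 1) * (M + B) ^+ 2 + C * (M + B) * M) by ring.
  by rewrite lerDl addr_ge0 ?mulr_ge0 ?addr_ge0 ?sqr_ge0//; exact: ltW.
by have [i [vi di _]] := ex_mixed M0 B0 C0 ub D0 CD; exists i.
Qed.

Section Cutoff.
Variables (d : nat -> I -> R) (M B : nat -> R) (Q : R).
Hypothesis M0 : \forall n \near \oo, 0 < M n.
Hypothesis Binf : forall A : R, \forall n \near \oo, A <= B n.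
Hypothesis Q1 : (1 : R) <= Q.
Hypothesis BQ : \forall n \near \oo, B n <= Q * M n.
Hypothesis HU : forall e : R, 0 < e -> exists C : R, 0 < C /\
  \forall n \near \oo, upper_bd C e (d n) (M n) (B n).
Hypothesis HL : forall e : R, 0 < e -> exists C : R, 0 < C /\
  \forall n \near \oo, lower_bd C e (d n) (M n) (B n).
Hypothesis HH : \forall n \near \oo, half_bd (d n) (M n).
Hypothesis HS : \forall n \near \oo, slow_bd (d n) (B n).

Lemma cutoff_sufficient :
  (forall A : R, \forall n \near \oo, A * B n <= M n) ->
  tv_cutoff (fun n => mix_time (d n)).
Proof.
move=> HA e h e0 eh h1; apply/cvgrPdist_le => /= v v0.
(* These bounds give [1 + r <= (1 + v) * (1 - r)]. *)
have [r [r0 r1 rv]] : exists r : R, [/\ 0 < r, r <= 2^-1 & 4 * r <= v].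
  exists (Num.min (2^-1) (v / 4)); split.
  - by rewrite lt_min divr_gt0// andbT invr_gt0.
  - by rewrite ge_min lexx.
  - by rewrite mulrC -ler_pdivlMr// ge_min lexx orbT.
(* With this error the lower bound is [(1 + h) / 2], above the level [h]. *)
have e'0 : 0 < (1 - h) / 2 by lra.
have [C1 [C10 HU1]] := HU e0; have [C2 [C20 HL2]] := HL e'0.
near=> n.
have Mn : 0 < M n by near: n.
have B1 : 1 <= B n by near: n; exact: Binf.
have A1 : (128 * C1 / r ^+ 2 + 4 * C1 / r + 4 / r + 1) * B n <= M n.
  by near: n; exact: HA.
have A2 : (128 * C2 / r ^+ 2 + 4 * C2 / r + 4 / r + 1) * B n <= M n.
  by near: n; exact: HA.
have Un : upper_bd C1 e (d n) (M n) (B n) by near: n.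
have Ln : lower_bd C2 ((1 - h) / 2) (d n) (M n) (B n) by near: n.
have Bn : 0 < B n by lra.
have r1' : r <= 1 by lra.
have [i [vi di ii]] := mix_time_upper Mn Bn C10 r0 r1' B1 A1 Un.
have Te := le_trans (mix_time_le vi di) ii.
have Th : sc * ((1 - r) * M n) <= mix_time (d n) h.
  apply: (mix_time_ge vi (le_trans di (ltW eh))) => j vj dj.
  apply: (mix_time_lower Mn Bn C20 r0 r1' B1 A2 Ln vj); lra.
have The := mix_time_anti vi di (ltW eh).
set x := mix_time (d n) e in Te The *; set y := mix_time (d n) h in Th The *.
have y0 : 0 < y by apply: lt_le_trans Th; rewrite !mulr_gt0//; lra.
have xy1 : 1 <= x / y by rewrite ler_pdivlMr// mul1r.
rewrite distrC ger0_norm ?subr_ge0// lerBlDl ler_pdivrMr//.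
apply: (le_trans Te); apply: (@le_trans _ _ ((1 + v) * (sc * ((1 - r) * M n)))).
  rewrite [leRHS]mulrCA ler_wpM2l ?(ltW sc0)// [leRHS]mulrA ler_wpM2r ?(ltW Mn)//.
  have g1 : 0 <= (v - 4 * r) * (1 - r) by rewrite mulr_ge0// subr_ge0//; lra.
  have g2 : 0 <= r * (2^-1 - r) by rewrite mulr_ge0// ?subr_ge0// ltW.
  lra.
by rewrite ler_wpM2l//; lra.
Unshelve. all: by end_near. Qed.

(** If [M < A * B], the mixing time at level [1/4] is at most [sc * L * M], while slow decay keeps
    the distance above a fixed [e] up to [sc * 3 * L * M]. The ratio of the two is then at least
    [3], whereas cutoff makes it at most [2] eventually. *)
Lemma cutoff_necessary : tv_cutoff (fun n => mix_time (d n)) ->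
  forall A : R, \forall n \near \oo, A * B n <= M n.
Proof.
move=> cut A0; have [A [A1 A0A]] : exists A : R, 1 <= A /\ A0 <= A.
  by exists (Num.max 1 A0); rewrite !le_max !lexx orbT.
have q0 : 0 < 4^-1 :> R by [].
have [C1 [C10 HU1]] := HU q0.
have [L [LE L1]] : exists L, 5 * (C1 + 1) * (1 + Q) = L /\ 1 <= L.
  eexists; split; first by [].
  have Q1q : 1 <= (Q : R) by exact: Q1.
  have Qp : 0 <= 1 + Q by lra.
  have h := mulr_ge0 (ltW C10) Qp.
  lra.
(* A time below [3 * L * M] requires at most [6 * L * M + 6] steps in [slow_bd], which is at most
   [(6 * L * A + 6) * B]. *)
have [c [c0 Hc]] := @slow_decay (6 * L * A + 6).
have [e [e0 ec e4]] : exists e : R, [/\ 0 < e, e < c / 4 & e < 4^-1].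
  exists (Num.min (c / 8) 8^-1); split; first by rewrite lt_min divr_gt0//=.
    by apply: (@le_lt_trans _ _ (c / 8)); [rewrite ge_min lexx | lra].
  by apply: (@le_lt_trans _ _ 8^-1); [rewrite ge_min lexx orbT | lra].
have [C2 [C20 HU2]] := HU e0.
have := cut e 4^-1 e0 e4 ltac:(lra) => /cvgrPdist_le /(_ 1 ltr01) cut1.
near=> n.
have Mn : 0 < M n by near: n.
have B1 : 128 <= B n by near: n; exact: Binf.
have Un : upper_bd C1 4^-1 (d n) (M n) (B n) by near: n.
have Un2 : upper_bd C2 e (d n) (M n) (B n) by near: n.
have Hn : half_bd (d n) (M n) by near: n.
have Sn : slow_bd (d n) (B n) by near: n.
have Qn : B n <= Q * M n by near: n.
have cn : `|1 - mix_time (d n) e / mix_time (d n) 4^-1| <= 1 by near: n.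
have Bn : 0 < B n by lra.
rewrite leNgt; apply/negP => small.
have small' : M n < A * B n.
  by apply: lt_le_trans small _; rewrite ler_wpM2r// ltW.
have B1' : 1 <= B n by lra.
have := mix_time_order Mn Bn C10 B1' Qn Q1 Un Hn; rewrite LE => /andP[T1 T2].
have [i0 [v0 d0]] := ex_mixed_any Mn Bn C20 Un2.
have T3 : sc * (3 * L * M n) <= mix_time (d n) e.
  apply: (mix_time_ge v0 d0) => i vi di; rewrite leNgt; apply/negP => ismall.
  have th0 : 0 <= out i / sc by rewrite divr_ge0 ?out0// ltW.
  have /andP[k1 k2] := truncn_itv (ltac:(lra) : 0 <= 2 * (out i / sc) + 5).
  have k3 : (Num.truncn (2 * (out i / sc) + 5)).+1%:R <= (6 * L * A + 6) * B n.
    rewrite -natr1; apply: le_trans (lerD k1 (lexx 1)) _.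
    have : L * M n <= L * (A * B n) by rewrite ler_wpM2l ?ltW//; lra.
    lra.
  have := Sn i _ vi ltac:(lra) (ltW k2); have := Hc _ _ B1 k3.
  set z := _ ^+ _; lra.
have T4 : 0 < mix_time (d n) 4^-1 by apply: lt_le_trans T1; rewrite !mulr_gt0//; lra.
move: cn; rewrite distrC => /ler_normlW; rewrite lerBlDr ler_pdivrMr// => T5.
have T6 : sc * (3 * L * M n) <= (1 + 1) * (sc * (L * M n)).
  by apply: le_trans T3 _; apply: le_trans T5 _; rewrite ler_wpM2l.
have : 0 < sc * (L * M n) by rewrite !mulr_gt0//; lra.
lra.
Unshelve. all: by end_near. Qed.

End Cutoff.

End Profile.

(** * Profiles of the lazy and the continuous time chain *)

Lemma bd_iter_incr_time (R : realFieldType) n (delta : R) p f :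
  bd_weights n delta p -> decr_on n f ->
  forall m1 m2, (m1 <= m2)%N -> bd_iter p m1 f n <= bd_iter p m2 f n.
Proof.
move=> wp df m1 m2; elim: m2 => [|m IHm].
  by rewrite leqn0 => /eqP ->.
rewrite leq_eqVlt => /orP[/eqP -> //|/IHm] /le_trans; apply.
rewrite [leRHS]bd_iterS /bd_op; have -> : p n.+1 = 0 by case: wp => _ ->.
rewrite mul0r addr0 lerDl; have [n0|n0] := posnP n.
  by rewrite [X in p X]n0; case: wp => -> _ _ _; rewrite mul0r.
rewrite mulr_ge0 ?(weights_ge0 wp)// subr_ge0.
have := bd_iter_decr wp m df; rewrite -{2}(prednK n0); apply.
by rewrite prednK.
Qed.

Lemma poisson_meanB (R : realType) (mu : R) phi psi L M :
  poisson_mean mu phi L -> poisson_mean mu psi M ->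
  poisson_mean mu (fun m => phi m - psi m) (L - M).
Proof.
move=> hL hM; rewrite /poisson_mean.
rewrite (_ : (fun n => _) = (fun n =>
  expR (- mu) * (\sum_(0 <= m < n) exp_coeff mu m * phi m)
  - expR (- mu) * (\sum_(0 <= m < n) exp_coeff mu m * psi m))); first exact: cvgB.
apply/funext => n; rewrite -mulrBr -sumrB; congr (_ * _).
by apply: eq_bigr => m _; rewrite mulrBr.
Qed.

Lemma poisson_mean_ext (R : realType) (mu : R) phi psi L :
  phi =1 psi -> poisson_mean mu phi L -> poisson_mean mu psi L.
Proof. by move=> /funext ->. Qed.

Section Profiles.
Variables (R : realType) (delta : R).
Hypotheses (d0 : 0 < delta) (d1 : delta < 1).

Section Chain.
Variables (n k : nat) (eps : R) (x : 'I_k -> 'I_n.+1) (K : 'M[R]_n.+1).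
Hypotheses (n1 : (0 < n)%N) (HK : bottleneck_chain K eps x).

Let w := lazy_weight delta eps x.
Let wp : bd_weights n delta w := lazy_weightP d0 d1 HK.
Let N : R := n.+1%:R.
Let N0 : 0 < N. Proof. by rewrite ltr0n. Qed.

Definition chain_scale : R := Num.max (half_mean n w) (half_mean n (rev_weights n w)).
Definition chain_relax : R := (1 - delta)^-1 * (N ^+ 2 + (b_coef x)%:R / eps).

Lemma lazy_bd_iter m (f : nat -> R) (i : 'I_n.+1) :
  \sum_j (lazy_kernel delta K ^+ m) i j * f j = bd_iter w m f i.
Proof. by apply: mx_bd_iter => g j; exact: (lazy_kernel_bd d0 d1 n1 HK). Qed.

Lemma heat_bd_iter (t : R) (f : nat -> R) (i : 'I_n.+1) : 0 <= t ->
  poisson_mean (t / (1 - delta)) (fun m => bd_iter w m f i)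
    (\sum_j heat_kernel K t i j * f j).
Proof.
move=> t0; have H := @heat_kernel_poisson R n K delta t f i d1 t0.
apply: (poisson_mean_ext (phi := fun m => \sum_j (lazy_kernel delta K ^+ m) i j * f j)).
  by move=> m; exact: lazy_bd_iter.
apply: H => m a b.
have := mx_bd_iter_entry (fun g j => lazy_kernel_bd d0 d1 n1 HK g j) m a b wp.
by move=> /andP[p0 p1]; rewrite ger0_norm.
Qed.

Lemma chain_relax_ge : N ^+ 2 <= chain_relax.
Proof.
have e0 : 0 < eps by case: HK => _ [].
have h : 0 <= N ^+ 2 + (b_coef x)%:R / eps by rewrite addr_ge0 ?sqr_ge0// divr_ge0// ltW.
rewrite /chain_relax; apply: (@le_trans _ _ (1 * (N ^+ 2 + (b_coef x)%:R / eps))).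
  by rewrite mul1r lerDl divr_ge0// ltW.
by rewrite ler_wpM2r// invf_ge1 ?subr_gt0// lerBlDr lerDl ltW.
Qed.

Lemma chain_relax_ge1 : 1 <= chain_relax.
Proof.
by apply: le_trans chain_relax_ge; rewrite -natrX ler1n expn_gt0.
Qed.

Lemma chain_relax_gen : n%:R <= chain_relax.
Proof.
by apply: le_trans chain_relax_ge; rewrite -natrX ler_nat; clear; nia.
Qed.

Lemma chain_scale_gt0 : 0 < chain_scale.
Proof.
apply: (@lt_le_trans _ _ (half_mean n w)); last by rewrite le_max lexx.
apply: lt_le_trans (chain_half_mean_ge_quad d1 n1 HK).
by rewrite mulr_gt0 ?invr_gt0 ?subr_gt0// divr_gt0// exprn_gt0// ltr0n.
Qed.

(* The end of the segment from which the chain takes longest to reach the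
   middle; the other end is handled by reflection. *)
Lemma slow_end : exists p', [/\ bd_weights n delta p', edge_bound n p' chain_relax,
  chain_scale = half_mean n p' & forall z, (z <= n.+1)%N ->
  exists (x0 : 'I_n.+1) (b : pred nat),
    (forall m, bd_iter w m (fun y => (b y)%:R) x0 = bd_iter p' m (below R z) 0) /\
    \sum_(0 <= y < n.+1) (b y)%:R = z%:R :> R].
Proof.
have Bp : edge_bound n w chain_relax := chain_edge_bound d1 n1 HK.
have B0 : 0 < chain_relax by apply: lt_le_trans chain_relax_ge1.
rewrite /chain_scale; case: leP => _; last first.
  exists w; split=> // z zn; exists ord0, (fun y => (y < z)%N).
  by split=> //; exact: sum_below.
exists (rev_weights n w); split=> //; [exact: rev_weightsP|exact: edge_bound_rev|].
move=> z zn; exists ord_max, (fun y => (n - y < z)%N); split=> [m|].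
  have := bd_iter_rev wp m (fun y => (n - y < z)%N%:R) (leq0n n).
  rewrite subn0 => <-; apply: (eq_bd_iter_n (rev_weightsP wp)) => // y yn.
  by rewrite /below subKn.
rewrite big_nat_rev/= -(@sum_below R n.+1 z zn); apply: eq_big_nat => y /andP[_ yn].
by rewrite /below add0n subSS subKn.
Qed.

Lemma dTV_lazy_ge m (b : pred nat) (x0 : 'I_n.+1) :
  bd_iter w m (fun y => (b y)%:R) x0 - (\sum_(0 <= y < n.+1) (b y)%:R) / N
  <= dTV_lazy delta K (unif_dist R n) m.
Proof.
have := max_tv_ge (lazy_kernel delta K ^+ m) b x0.
by rewrite (lazy_bd_iter m (fun y => (b y)%:R)).
Qed.

Lemma dTV_c_ge t (b : pred nat) (x0 : 'I_n.+1) :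
  \sum_j heat_kernel K t x0 j * (b j)%:R - (\sum_(0 <= y < n.+1) (b y)%:R) / N
  <= dTV_c K (unif_dist R n) t.
Proof. exact: max_tv_ge. Qed.

Let half_sub (u y v : R) : 1 - y <= u -> v <= 2^-1 -> 2^-1 - y <= u - v.
Proof. by move=> ? ?; lra. Qed.

Lemma half_chain_lazy : half_bd (fun=> True) (fun m : nat => m%:R) 1
  (dTV_lazy delta K (unif_dist R n)) chain_scale.
Proof.
move=> m _; rewrite divr1.
have [p' [wp' _ ME side]] := slow_end.
have [x0 [b [bE bs]]] := side n.+1./2 ltac:(lia).
apply: le_trans (dTV_lazy_ge m b x0); rewrite bE bs.
have M0 := chain_scale_gt0.
have := hit_markov wp' m (ltac:(lia) : (n.+1./2 <= n)%N).
rewrite -/(half_mean n p') -ME => h.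
have h1 : 1 - m%:R / chain_scale <= bd_iter p' m (below R n.+1./2) 0.
  by rewrite -(ler_pM2r M0) mulrBl mul1r divfK ?gt_eqF.
have h2 : n.+1./2%:R / N <= 2^-1.
  by rewrite ler_pdivrMr// ler_pdivlMl// -natrM ler_nat; lia.
exact: half_sub h1 h2.
Qed.

Lemma half_chain_c : half_bd (fun t => 0 <= t) id (1 - delta)
  (dTV_c K (unif_dist R n)) chain_scale.
Proof.
move=> t t0 /=.
have [p' [wp' _ ME side]] := slow_end.
have [x0 [b [bE bs]]] := side n.+1./2 ltac:(lia).
apply: le_trans (dTV_c_ge t b x0); rewrite bs.
have M0 := chain_scale_gt0.
have mu0 : 0 <= t / (1 - delta) by rewrite divr_ge0// subr_ge0 ltW.
have h1 m : 1 - chain_scale^-1 * m%:R <= bd_iter w m (fun y => (b y)%:R) x0.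
  rewrite bE; have := hit_markov wp' m (ltac:(lia) : (n.+1./2 <= n)%N).
  rewrite -/(half_mean n p') -ME => h.
  by rewrite -(ler_pM2r M0) mulrBl mul1r mulrAC mulVf ?gt_eqF// mul1r.
have h2 : n.+1./2%:R / N <= 2^-1.
  by rewrite ler_pdivrMr// ler_pdivlMl// -natrM ler_nat; lia.
have := poisson_affine_ge mu0 (@heat_bd_iter t (fun y => (b y)%:R) x0 t0) h1.
by rewrite [chain_scale^-1 * _]mulrC => h3; exact: half_sub h3 h2.
Qed.

(** The rate [64 / B] multiplies the [16] of [chain_window] by the [4] of
    [slow_relaxation_window]. *)
Lemma slow_chain m : (8 <= n)%N -> 64 <= chain_relax -> exists z, [/\ (z <= n)%N &
  (1 - 64 / chain_relax) ^+ m <= bd_iter w m (below R z) 0 - bd_iter w m (below R z) n].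
Proof.
move=> n8 B64; have B0 : 0 < chain_relax by lra.
have [s [s0 sn hs]] := chain_window d1 n1 HK n8.
have r1 : 64 / chain_relax <= 1 by rewrite ler_pdivrMr// mul1r.
have h4 : 4 <= 64 / chain_relax *
    (s%:R * \sum_(s <= i < (n.+1 - s).+1) (w i)^-1).
  rewrite mulrAC ler_pdivlMr//; move: hs; rewrite -/N -/chain_relax -/w.
  by move: (_ * bigop _ _ _) => y hy; lra.
have [z [_ zn hz]] := slow_relaxation_window m wp s0 sn n1 r1 h4.
by exists z.
Qed.

(** The segment is tested from [0] and its complement from [n]; the two uniform masses add up to [1]
    and cancel in the sum. *)
Let slow_dTV (u v dd : R) z : u - z%:R / N <= dd ->
  (1 - v) - (n.+1 - z)%:R / N <= dd -> (z <= n)%N -> u - v <= 2 * dd.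
Proof.
move=> h1 h2 zn; move: h2; rewrite natrB ?leqW// mulrBl divff ?gt_eqF//.
by move: (_ / _) h1 => y h1 h2; lra.
Qed.

Let sum_not_below z : (z <= n)%N ->
  \sum_(0 <= y < n.+1) (~~ (y < z)%N)%:R = (n.+1 - z)%:R :> R.
Proof.
move=> zn; rewrite natrB ?leqW//.
have -> : \sum_(0 <= y < n.+1) (~~ (y < z)%N)%:R =
  \sum_(0 <= y < n.+1) (1 - below R z y).
  by apply: eq_bigr => y _; rewrite /below; case: (y < z)%N; rewrite ?subrr ?subr0.
by rewrite sumrB sum_below ?leqW// big_const_nat subn0 iter_addr_0.
Qed.

Lemma slow_chain_lazy : (8 <= n)%N -> slow_bd (fun=> True) (fun m : nat => m%:R) 1
  (dTV_lazy delta K (unif_dist R n)) chain_relax.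
Proof.
move=> n8 m k' _ B64; rewrite divr1 => km.
have B0 : 0 < chain_relax by lra.
have [z [zn hz]] := slow_chain m n8 B64.
have r1 : 64 / chain_relax <= 1 by rewrite ler_pdivrMr// mul1r.
have r0 : 0 <= 64 / chain_relax by rewrite divr_ge0// ltW.
have h1 := dTV_lazy_ge m (fun y => (y < z)%N) ord0.
have h2 := dTV_lazy_ge m (fun y => ~~ (y < z)%N) ord_max.
have e1 : bd_iter w m (fun y => (~~ (y < z)%N)%:R) n = 1 - bd_iter w m (below R z) n.
  rewrite -[in RHS](bd_iter_cst w m 1 n) -bd_iterB; apply: eq_bd_iter => y.
  by rewrite /below; case: (y < z)%N; rewrite ?subrr ?subr0.
rewrite e1 sum_not_below// in h2.
rewrite (sum_below R (leqW zn)) in h1.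
have h3 := slow_dTV h1 h2 zn.
have h4 : (1 - 64 / chain_relax) ^+ k' <= (1 - 64 / chain_relax) ^+ m.
  apply: ler_wiXn2l; [lra|lra|].
  by rewrite -(ler_nat R); have : 0 <= m%:R :> R by []; lra.
have h5 : 0 <= (1 - 64 / chain_relax) ^+ k' by rewrite exprn_ge0// subr_ge0.
move: h3 h4 h5 hz; move: (_ ^+ k') (_ ^+ m) => X Y.
by move: (dTV_lazy _ _ _ _) => dd; lra.
Qed.

Lemma slow_chain_c : (8 <= n)%N -> slow_bd (fun t => 0 <= t) id (1 - delta)
  (dTV_c K (unif_dist R n)) chain_relax.
Proof.
move=> n8 t k' t0 B64 /= km.
have B0 : 0 < chain_relax by lra.
have [z [zn hz]] := slow_chain k' n8 B64.
have mu0 : 0 <= t / (1 - delta) by rewrite divr_ge0// subr_ge0 ltW.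
set mu := t / (1 - delta) in km mu0 *.
pose phi m := bd_iter w m (below R z) 0 - bd_iter w m (below R z) n.
have phi0 m : 0 <= phi m.
  rewrite subr_ge0.
  by apply: (decr_on_le (bd_iter_decr wp m (@below_decr R n z))); rewrite leq0n leqnn.
have phi_decr m1 m2 : (m1 <= m2)%N -> phi m2 <= phi m1.
  move=> m12; rewrite lerB//.
    exact: (bd_iter_decr_time wp (@below_decr R n z)).
  exact: (bd_iter_incr_time wp (@below_decr R n z)).
have H1 := @heat_bd_iter t (below R z) ord0 t0.
have H2 := @heat_bd_iter t (below R z) ord_max t0.
have H := poisson_meanB H1 H2.
set L0 := bigop _ _ _ in H1 H; set Ln := bigop _ _ _ in H2 H.
set g := phi k'.
have kmu : 0 < k'%:R - mu by lra.
(* A quadratic minorant: up to [k'] monotonicity gives [phi m >= g], and beyond [k'] the left side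
   is negative or zero. *)
have hq m : g - g / (k'%:R - mu) ^+ 2 * (m%:R - mu) ^+ 2 <= phi m.
  have [mk|km'] := leqP m k'.
    apply: (@le_trans _ _ g); last exact: phi_decr.
    by rewrite gerBl mulr_ge0 ?sqr_ge0// divr_ge0 ?sqr_ge0//; exact: phi0.
  apply: (le_trans _ (phi0 m)); rewrite subr_le0 mulrAC ler_pdivlMr ?exprn_gt0//.
  rewrite ler_wpM2l//; first exact: phi0.
  have : k'%:R <= m%:R :> R by rewrite ler_nat ltnW.
  by move=> km2; rewrite ler_pXn2r// ?nnegrE; lra.
have hL := poisson_chebyshev_ge mu0 H hq.
have gmu : g / (k'%:R - mu) ^+ 2 * mu <= g / 2.
  rewrite mulrAC ler_pdivrMr ?exprn_gt0// -mulrA ler_wpM2l//; first exact: phi0.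
  have h5 : mu + 5 <= k'%:R - mu by lra.
  have : (mu + 5) ^+ 2 <= (k'%:R - mu) ^+ 2 by rewrite ler_pXn2r// ?nnegrE; lra.
  have : 0 <= mu ^+ 2 by exact: sqr_ge0.
  by rewrite ler_pdivlMl//; lra.
have h1 := dTV_c_ge t (fun y => (y < z)%N) ord0.
have h2 := dTV_c_ge t (fun y => ~~ (y < z)%N) ord_max.
have e1 : \sum_j heat_kernel K t ord_max j * (~~ (j < z)%N)%:R = 1 - Ln.
  have H3 := @heat_bd_iter t (fun y => (~~ (y < z)%N)%:R) ord_max t0.
  have H4 := @poisson_mean_quad R mu 1 0 0.
  have H5 := poisson_meanB H4 H2.
  rewrite (_ : 1 + 0 * mu + 0 * mu ^+ 2 = 1) in H5; last by ring.
  move/cvg_lim: H3 => <- //; move/cvg_lim: H5 => <- //; congr (limn _).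
  apply/funext => q; congr (_ * _); apply: eq_bigr => m _; congr (_ * _).
  rewrite !mul0r !addr0 -[X in X - _](bd_iter_cst w m 1 n) -bd_iterB.
  apply: eq_bd_iter => y.
  by rewrite /below; case: (y < z)%N; rewrite ?subrr ?subr0.
rewrite e1 sum_not_below// in h2.
rewrite (sum_below R (leqW zn)) in h1.
have h3 := slow_dTV h1 h2 zn.
move: hz; rewrite -/(phi k') -/g => hz.
move: h3 hL gmu hz; move: (_ ^+ k') (_ * mu) => X Y.
rewrite -/L0; move: (dTV_c _ _ _) => dd; lra.
Qed.

End Chain.
End Profiles.

Section Profiles.
Variables (R : realType) (delta : R).
Hypotheses (d0 : 0 < delta) (d1 : delta < 1).

Let chain_prop (P : forall n k (eps : R) (x : 'I_k -> 'I_n.+1) (K : 'M[R]_n.+1), Prop) :=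
  exists n0 : nat, forall n, (n0 <= n)%N -> forall k (eps : R) (x : 'I_k -> 'I_n.+1)
    (K : 'M[R]_n.+1), bottleneck_chain K eps x -> P n k eps x K.

Lemma upper_chain_lazy (e : R) : 0 < e -> exists C : R, 0 < C /\
  chain_prop (fun n k eps x K => upper_bd (fun=> True) (fun m : nat => m%:R) 1 C e
    (dTV_lazy delta K (unif_dist R n)) (chain_scale delta eps x) (chain_relax delta eps x)).
Proof.
move=> e0; have [C [C0 [n0 H]]] := discrete_upper e0 d0.
exists C; split=> //; exists n0.+1 => n n0n k eps x K HK D m D0 CD _.
rewrite divr1 => /andP[mC _].
have n1 : (0 < n)%N by exact: leq_trans n0n.
have wp := lazy_weightP d0 d1 HK.
apply: max_tv_le => f i f01; rewrite (lazy_bd_iter d0 d1 n1 HK).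
apply: (H n (ltnW n0n) _ _ (chain_scale delta eps x) D m wp (chain_edge_bound d1 n1 HK)) => //.
- exact: (chain_relax_ge1 d0 d1 HK).
- by rewrite /chain_scale le_max lexx.
- by rewrite /chain_scale le_max lexx orbT.
- apply: le_trans mC; rewrite -/(chain_relax delta eps x) -/(chain_scale delta eps x).
  by rewrite lerD2l; lra.
- by rewrite -ltnS.
Qed.

(** When the number of steps is too small for the discrete bound, it deviates from [mu] by at least
    [D], so [(m - mu) ^ 2 / D ^ 2] dominates. Its mean [mu / D ^ 2] is at most [4 / B], since
    [mu * B <= 4 * D ^ 2]. *)
Lemma upper_chain_c (e : R) : 0 < e -> exists C : R, 0 < C /\
  chain_prop (fun n k eps x K => upper_bd (fun t : R => 0 <= t) id (1 - delta) C e
    (dTV_c K (unif_dist R n)) (chain_scale delta eps x) (chain_relax delta eps x)).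
Proof.
move=> e0; have e2 : 0 < e / 2 by rewrite divr_gt0.
have [C1 [C10 [n0 H]]] := discrete_upper e2 d0.
have [C [C0 CC1 C1']] : exists C : R, [/\ 0 < C, C1 <= C & (1 : R) <= C].
  by exists (C1 + 1); split; lra.
(* As [B >= n], this makes [4 / B <= e / 2]. *)
have [n2 hn2] : exists n2 : nat, 8 / e <= n2%:R.
  exists (Num.bound (8 / e)); apply/ltW/archi_boundP.
  by rewrite divr_ge0// ltW.
exists C; split=> //; exists (n0 + n2).+1 => n n0n k eps x K HK D t D0 CD t0.
move=> /andP[mC mC']; have n1 : (0 < n)%N by exact: leq_trans n0n.
have wp := lazy_weightP d0 d1 HK.
have B1 := chain_relax_ge1 d0 d1 HK.
have Bn := chain_relax_gen d0 d1 HK.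
have M0 := chain_scale_gt0 d1 n1 HK.
have eB : 8 / e <= chain_relax delta eps x.
  apply: le_trans hn2 _; apply: le_trans Bn; rewrite ler_nat.
  by clear -n0n; lia.
have Mw : half_mean n (lazy_weight delta eps x) <= chain_scale delta eps x.
  by rewrite /chain_scale le_max lexx.
have Mr : half_mean n (rev_weights n (lazy_weight delta eps x)) <= chain_scale delta eps x.
  by rewrite /chain_scale le_max lexx orbT.
have Bp : edge_bound n (lazy_weight delta eps x) (chain_relax delta eps x).
  exact: (chain_edge_bound d1 n1 HK).
move: B1 Bn M0 eB Mw Mr Bp CD mC mC'.
move: (chain_scale _ _ _) (chain_relax _ _ _) => M B B1 Bn M0 eB Mw Mr Bp CD mC mC'.
have mu0 : 0 <= t / (1 - delta) by rewrite divr_ge0// subr_ge0 ltW.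
apply: max_tv_le => f i f01.
have := @heat_bd_iter R delta d0 d1 n k eps x K n1 HK t f i t0.
move: mu0 mC mC'; move: (t / (1 - delta)) => mu mu0 mC mC'.
move: (\sum_(j < n.+1) heat_kernel K t i j * f j) => L hL.
have B0 : 0 < B by lra.
have av0 : 0 <= (\sum_(0 <= y < n.+1) f y) / n.+1%:R.
  rewrite divr_ge0// sumr_ge0// => y _; by case/andP: (f01 y).
have CD1 : C1 * (M + B) * B <= D ^+ 2.
  apply: le_trans CD; rewrite ler_wpM2r ?(ltW B0)// ler_wpM2r//.
  by rewrite addr_ge0 ?ltW.
have CBB : C1 * B <= C * B by rewrite ler_wpM2r ?(ltW B0).
have iN : (i <= n)%N by rewrite -ltnS.
have n0n' : (n0 <= n)%N by clear -n0n; lia.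
have Hm (m : nat) : M + C1 * B + D <= m%:R ->
    unif_dev n (lazy_weight delta eps x) m f i <= e / 2.
  move=> hm; exact: (H n n0n' _ _ _ D m wp Bp B1 Mw Mr D0 CD1 hm).
move: av0 Hm; rewrite /unif_dev; move: (_ / n.+1%:R) => av av0 Hm.
have D20 : 0 < D ^+ 2 by rewrite exprn_gt0.
have hq m : bd_iter (lazy_weight delta eps x) m f i <=
    (av + e / 2) + (D ^+ 2)^-1 * (m%:R - mu) ^+ 2.
  have q0 : 0 <= (D ^+ 2)^-1 * (m%:R - mu) ^+ 2.
    by rewrite mulr_ge0 ?sqr_ge0// invr_ge0 ltW.
  have [hm|hm] := leP (M + C1 * B + D) m%:R; first by have := Hm m hm; lra.
  have f1 : bd_iter (lazy_weight delta eps x) m f i <= 1.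
    by apply: (bd_iter_le1 wp) => y; case/andP: (f01 y).
  have : 1 <= (D ^+ 2)^-1 * (m%:R - mu) ^+ 2.
    rewrite ler_pdivlMl// mulr1 -[leRHS]sqrrN opprB.
    by rewrite ler_pXn2r// ?nnegrE; lra.
  by lra.
have := poisson_chebyshev_le mu0 hL hq.
suff : (D ^+ 2)^-1 * mu <= e / 2 by lra.
rewrite ler_pdivrMl//.
have g1 : (M + C * B + 1) * B <= 2 * D ^+ 2.
  have : 0 <= (C - 1) * (M * B) by rewrite mulr_ge0 ?subr_ge0// mulr_ge0// ltW.
  have : 0 <= (C - 1) * (B * B) by rewrite mulr_ge0 ?subr_ge0// mulr_ge0// ltW.
  have : 0 <= (B - 1) * B by rewrite mulr_ge0 ?subr_ge0// ltW.
  have : 0 <= M * B by rewrite mulr_ge0// ltW.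
  have : 0 <= C * (M * B) by rewrite mulr_ge0// ?mulr_ge0// ltW.
  move: CD; rewrite -!mulrA !mulrDl !mulrDr; lra.
have BD : B <= D.
  rewrite -(ler_pXn2r (n := 2)) ?nnegrE ?(ltW B0) ?(ltW D0)//; apply: le_trans CD.
  have : 0 <= (C - 1) * (B * B) by rewrite mulr_ge0 ?subr_ge0// mulr_ge0// ltW.
  have : 0 <= C * (M * B) by rewrite mulr_ge0// ?mulr_ge0// ltW.
  by lra.
have g2 : 2 * D * B <= 2 * D ^+ 2.
  by rewrite -mulrA ler_wpM2l// expr2 ler_wpM2l// ltW.
have g3 : mu * B <= 4 * D ^+ 2.
  have : mu * B <= (M + C * B + 2 * D + 1) * B by rewrite ler_wpM2r// ltW.
  lra.
have g4 : 8 <= e * B by rewrite -ler_pdivrMl// mulrC.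
rewrite -(ler_pM2r B0); apply: (le_trans g3).
have : 0 <= (e * B - 8) * D ^+ 2 by rewrite mulr_ge0 ?subr_ge0// ltW.
lra.
Qed.

Lemma lower_chain_lazy (e : R) : 0 < e -> exists C : R, 0 < C /\
  chain_prop (fun n k eps x K => lower_bd (fun=> True) (fun m : nat => m%:R) 1 C e
    (dTV_lazy delta K (unif_dist R n)) (chain_scale delta eps x) (chain_relax delta eps x)).
Proof.
move=> e0; have [C [C0 [n0 H]]] := discrete_lower e0.
exists C; split=> //; exists n0.+1 => n n0n k eps x K HK D m D0 CD _.
rewrite divr1 => mC; have n1 : (0 < n)%N by exact: leq_trans n0n.
have B1 := chain_relax_ge1 d0 d1 HK.
have [p' [wp' Bp' ME side]] := slow_end d0 d1 n1 HK.
have B0 : 0 < chain_relax delta eps x by lra.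
have CD' : C * half_mean n p' * chain_relax delta eps x <= D ^+ 2 by rewrite -ME.
have mC' : m%:R + C * chain_relax delta eps x + D <= half_mean n p'.
  by rewrite -ME; lra.
have [z [zn hz]] := H n (ltnW n0n) _ _ _ D m wp' Bp' B0 D0 CD' mC'.
have [x0 [b [bE bs]]] := side z (leqW zn).
apply: (le_trans hz); have := dTV_lazy_ge d0 d1 n1 HK m b x0.
by rewrite bE bs.
Qed.

(** The discrete bound is taken at [m1], the integer part of [mu + D], and holds at all earlier
    times by monotonicity; later ones cost [mu / D ^ 2 <= 1 / B]. *)
Lemma lower_chain_c (e : R) : 0 < e -> exists C : R, 0 < C /\
  chain_prop (fun n k eps x K => lower_bd (fun t : R => 0 <= t) id (1 - delta) C e
    (dTV_c K (unif_dist R n)) (chain_scale delta eps x) (chain_relax delta eps x)).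
Proof.
move=> e0; have e2 : 0 < e / 2 by rewrite divr_gt0.
have [C1 [C10 [n0 H]]] := discrete_lower e2.
have [C [C0 CC1 C1']] : exists C : R, [/\ 0 < C, C1 <= C & (1 : R) <= C].
  by exists (C1 + 1); split; lra.
have [n2 hn2] : exists n2 : nat, 2 / e <= n2%:R.
  exists (Num.bound (2 / e)); apply/ltW/archi_boundP.
  by rewrite divr_ge0// ltW.
exists C; split=> //; exists (n0 + n2).+1 => n n0n k eps x K HK D t D0 CD t0 mC.
have n1 : (0 < n)%N by exact: leq_trans n0n.
have B1 := chain_relax_ge1 d0 d1 HK.
have Bn := chain_relax_gen d0 d1 HK.
have eB : 2 / e <= chain_relax delta eps x.
  apply: le_trans hn2 _; apply: le_trans Bn; rewrite ler_nat.
  by clear -n0n; lia.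
have M0 := chain_scale_gt0 d1 n1 HK.
have [p' [wp' Bp' ME side]] := slow_end d0 d1 n1 HK.
move: B1 Bn eB M0 Bp' ME CD mC.
move: (chain_scale _ _ _) (chain_relax _ _ _) => M B B1 Bn eB M0 Bp' ME CD mC.
have B0 : 0 < B by lra.
have mu0 : 0 <= t / (1 - delta) by rewrite divr_ge0// subr_ge0 ltW.
have MB0 : 0 <= M * B by rewrite mulr_ge0 ?ltW.
have CD' : C1 * half_mean n p' * B <= D ^+ 2.
  rewrite -ME; apply: le_trans CD; rewrite -!mulrA ler_wpM2r//.
have CBB : C1 * B <= C * B by rewrite ler_wpM2r ?(ltW B0).
rewrite /= in mC.
have muD : 0 <= t / (1 - delta) + D by rewrite addr_ge0// ltW.
have [m1 [m1a m1b]] : exists m1 : nat, m1%:R <= t / (1 - delta) + D /\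
    t / (1 - delta) + D < m1.+1%:R.
  by have /andP[h1 h2] := truncn_itv muD; eexists; split; [exact: h1|exact: h2].
have mC' : m1%:R + C1 * B + D <= half_mean n p' by rewrite -ME; lra.
have n0n' : (n0 <= n)%N by clear -n0n; lia.
have [z [zn hz]] := H n n0n' _ _ _ D m1 wp' Bp' B0 D0 CD' mC'.
have [x0 [b [bE bs]]] := side z (leqW zn).
have h1 := dTV_c_ge K t b x0; rewrite bs in h1.
apply: le_trans h1.
have := @heat_bd_iter R delta d0 d1 n k eps x K n1 HK t (fun y => (b y)%:R) x0 t0.
move: (\sum_(j < n.+1) heat_kernel K t x0 j * _) => L hL.
move: mu0 hL m1a m1b mC muD; move: (t / (1 - delta)) => mu mu0 hL m1a m1b mC muD.
have D20 : 0 < D ^+ 2 by rewrite exprn_gt0.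
pose g := bd_iter p' m1 (below R z) 0.
have phi0 m : 0 <= bd_iter p' m (below R z) 0.
  by apply: (bd_iter_ge0 wp') => y; rewrite /below.
have phi1 m : bd_iter p' m (below R z) 0 <= 1.
  by apply: (bd_iter_le1 wp') => y; rewrite /below lern1 leq_b1.
have hq m : g - (D ^+ 2)^-1 * (m%:R - mu) ^+ 2 <=
    bd_iter (lazy_weight delta eps x) m (fun y => (b y)%:R) x0.
  rewrite bE; have q0 : 0 <= (D ^+ 2)^-1 * (m%:R - mu) ^+ 2.
    by rewrite mulr_ge0 ?sqr_ge0// invr_ge0 ltW.
  have [mm1|m1m] := leqP m m1.
    have : g <= bd_iter p' m (below R z) 0.
      exact: (bd_iter_decr_time wp' (@below_decr R n z)).
    by lra.
  have : 1 <= (D ^+ 2)^-1 * (m%:R - mu) ^+ 2.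
    rewrite ler_pdivlMl// mulr1; have : m1.+1%:R <= m%:R :> R by rewrite ler_nat.
    by move=> h2; rewrite ler_pXn2r// ?nnegrE; lra.
  have := phi0 m; have := phi1 m1; rewrite -/g; lra.
have h3 := poisson_chebyshev_ge mu0 hL hq.
have h4 : (D ^+ 2)^-1 * mu <= e / 2.
  have CB0 : 0 <= C * B by rewrite mulr_ge0 ?ltW.
  have muM : mu <= M by lra.
  rewrite ler_pdivrMl//.
  have h5 : M * B <= D ^+ 2.
    apply: le_trans CD; rewrite -mulrA.
    have : 0 <= (C - 1) * (M * B) by rewrite mulr_ge0// subr_ge0.
    lra.
  have h6 : mu * B <= D ^+ 2 by apply: le_trans h5; rewrite ler_wpM2r// ltW.
  have g4 : 2 <= e * B by rewrite -ler_pdivrMl// mulrC.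
  rewrite -(ler_pM2r B0); apply: (le_trans h6).
  have : 0 <= (e * B - 2) * D ^+ 2 by rewrite mulr_ge0 ?subr_ge0// ltW.
  lra.
move: hz h3 h4; rewrite -/g; move: (_ / n.+1%:R) (_ * mu) => y1 y2; lra.
Qed.

End Profiles.

(** * Orders of magnitude and the cutoff criterion *)

Section Final.
Variables (R : realType) (delta : R).
Hypotheses (d0 : 0 < delta) (d1 : delta < 1).
Let c := (1 - delta)^-1.
Let c0 : 0 < c. Proof. by rewrite invr_gt0 subr_gt0. Qed.

Lemma mix_time_cE n (K : 'M[R]_n.+1) : TTV_c K (unif_dist R n) =
  mix_time (fun t : R => 0 <= t) id (dTV_c K (unif_dist R n)).
Proof. by apply/funext => e; rewrite /mix_time image_id. Qed.

Lemma mix_time_lazyE n (K : 'M[R]_n.+1) : TTV_lazy delta K (unif_dist R n) =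
  mix_time (fun=> True) (fun m : nat => m%:R) (dTV_lazy delta K (unif_dist R n)).
Proof.
apply/funext => e; rewrite /mix_time /TTV_lazy; congr (inf (_ @` _)).
by apply/seteqP; split=> m //= [].
Qed.

Let sc0 : 0 < 1 - delta. Proof. by rewrite subr_gt0. Qed.

Lemma cover_c (u : R) : 0 <= u ->
  exists t : R, 0 <= t /\ u <= id t / (1 - delta) <= u + 1.
Proof.
move=> u0; exists (u * (1 - delta)); split; first by rewrite mulr_ge0// ltW.
by rewrite /= mulfK ?gt_eqF// lexx lerDl ler01.
Qed.

Lemma cover_lazy (u : R) : 0 <= u -> exists m : nat, True /\ u <= m%:R / 1 <= u + 1.
Proof.
move=> u0; have /andP[h1 h2] := truncn_itv u0.
by exists (Num.truncn u).+1; rewrite divr1 (ltW h2) -natr1 lerD2r.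
Qed.

Section Chain.
Variables (n k : nat) (eps : R) (x : 'I_k -> 'I_n.+1) (K : 'M[R]_n.+1).
Hypotheses (n1 : (0 < n)%N) (HK : bottleneck_chain K eps x).
Let t := t_coef eps x.
Let M := chain_scale delta eps x.
Let B := chain_relax delta eps x.
Let ie0 : 0 < eps^-1. Proof. by rewrite invr_gt0; case: HK => _ []. Qed.
Let n2 : n.+1%:R ^+ 2 <= 4 * n%:R ^+ 2 :> R.
Proof. by rewrite -!natrX -natrM ler_nat; clear -n1; nia. Qed.

Lemma scale_le : M <= c * (n.+1%:R ^+ 2 + (a_coef x)%:R / eps).
Proof.
by rewrite ge_max (chain_half_mean_le d1 n1 HK) (chain_half_mean_rev_le d1 n1 HK).
Qed.

Lemma scale_le_t : M <= 4 * (c * t).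
Proof.
apply: le_trans scale_le _; rewrite mulrCA ler_wpM2l ?(ltW c0)// /t /t_coef.
have : 0 <= (a_coef x)%:R / eps by rewrite mulr_ge0// ltW.
by move: n2; move: (_ / eps) => y; lra.
Qed.

Lemma scale_ge_a : c * ((a_coef x)%:R / eps) <= 2 * M.
Proof.
apply: le_trans (chain_half_mean_ge_ind d1 n1 HK) _.
by rewrite mulr_natl mulr2n lerD// le_max lexx ?orbT.
Qed.

Lemma t_le_scale : c * t <= 6 * M.
Proof.
have h1 := scale_ge_a.
have h2 : c * (n%:R ^+ 2 / 4) <= M.
  by apply: le_trans (chain_half_mean_ge_quad d1 n1 HK) _; rewrite le_max lexx.
rewrite /t /t_coef mulrDr; move: h1 h2.
by move: (_ / eps) (n%:R ^+ 2) => y z; lra.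
Qed.

Lemma relax_le_scale : B <= 32 * M.
Proof.
apply: (@le_trans _ _ (4 * (c * t))); last first.
  by have := t_le_scale; have := chain_scale_gt0 d1 n1 HK; rewrite -/M; lra.
rewrite mulrCA ler_wpM2l ?(ltW c0)// /t /t_coef.
have h : (b_coef x)%:R / eps <= (a_coef x)%:R / eps.
  by rewrite ler_wpM2r ?(ltW ie0)// b_coef_le_a_coef.
have : 0 <= (b_coef x)%:R / eps by rewrite mulr_ge0// ltW.
by move: n2 h; move: (_ / eps) ((a_coef x)%:R / eps) => y z; lra.
Qed.

End Chain.

Lemma half_gap_le_t n k (eps : R) (x : 'I_k -> 'I_n.+1) (K : 'M[R]_n.+1) (e : R) :
  (0 < n)%N -> bottleneck_chain K eps x -> e < 2^-1 ->
  (2^-1 - e) / 6 * t_coef eps x <= (1 - delta) * ((2^-1 - e) * chain_scale delta eps x).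
Proof.
move=> n1 HK e1; have := t_le_scale n1 HK.
rewrite /c ler_pdivrMl// => h.
rewrite mulrCA -[leLHS]mulrA ler_wpM2l ?subr_ge0 ?(ltW e1)//.
by rewrite ler_pdivrMl// mulrCA.
Qed.

Lemma mixing_order_lazy (e : R) : 0 < e -> e < 2^-1 -> exists C : R, 0 < C /\
  exists n0 : nat, forall n, (n0 <= n)%N -> forall k (eps : R) (x : 'I_k -> 'I_n.+1)
    (K : 'M[R]_n.+1), bottleneck_chain K eps x ->
  (2^-1 - e) / 6 * t_coef eps x <= TTV_lazy delta K (unif_dist R n) e
    <= C * t_coef eps x.
Proof.
move=> e0 e1; have [C [C0 [n0 H]]] := upper_chain_lazy d0 d1 e0.
have L0 : 0 < 5 * (C + 1) * (1 + 32) :> R by rewrite mulr_gt0// mulr_gt0// addr_gt0.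
exists (5 * (C + 1) * (1 + 32) * (4 * c)); split; first by rewrite mulr_gt0// mulr_gt0.
exists n0.+1 => n n0n k eps x K HK.
have n1 : (0 < n)%N by exact: leq_trans n0n.
have M0 := chain_scale_gt0 d1 n1 HK.
have q1 : (1 : R) <= 32 by rewrite ler1n.
have := mix_time_order ltr01 (fun i _ => ler0n R i) cover_lazy
  M0 (lt_le_trans ltr01 (chain_relax_ge1 d0 d1 HK)) C0
  (chain_relax_ge1 d0 d1 HK) (relax_le_scale n1 HK) q1
  (H n (ltnW n0n) _ _ _ _ HK) (half_chain_lazy d0 d1 n1 HK).
rewrite -mix_time_lazyE !mul1r => /andP[h1 h2]; apply/andP; split.
  apply: le_trans (half_gap_le_t n1 HK e1) _; apply: le_trans h1.
  rewrite ger_pMl ?lerBlDr ?lerDl ?(ltW d0)//.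
  by rewrite mulr_gt0// subr_gt0.
apply: (le_trans h2); rewrite -[leRHS]mulrA ler_wpM2l ?(ltW L0)//.
by rewrite -mulrA (scale_le_t n1 HK).
Qed.

Lemma mixing_order_c (e : R) : 0 < e -> e < 2^-1 -> exists C : R, 0 < C /\
  exists n0 : nat, forall n, (n0 <= n)%N -> forall k (eps : R) (x : 'I_k -> 'I_n.+1)
    (K : 'M[R]_n.+1), bottleneck_chain K eps x ->
  (2^-1 - e) / 6 * t_coef eps x <= TTV_c K (unif_dist R n) e <= C * t_coef eps x.
Proof.
move=> e0 e1; have [C [C0 [n0 H]]] := upper_chain_c d0 d1 e0.
have L0 : 0 < 5 * (C + 1) * (1 + 32) :> R by rewrite mulr_gt0// mulr_gt0// addr_gt0.
exists (5 * (C + 1) * (1 + 32) * (4 * c)); split; first by rewrite mulr_gt0// mulr_gt0.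
exists n0.+1 => n n0n k eps x K HK.
have n1 : (0 < n)%N by exact: leq_trans n0n.
have M0 := chain_scale_gt0 d1 n1 HK.
have q1 : (1 : R) <= 32 by rewrite ler1n.
have := mix_time_order sc0 (fun (i : R) (i0 : 0 <= i) => i0) cover_c
  M0 (lt_le_trans ltr01 (chain_relax_ge1 d0 d1 HK)) C0
  (chain_relax_ge1 d0 d1 HK) (relax_le_scale n1 HK) q1
  (H n (ltnW n0n) _ _ _ _ HK) (half_chain_c d0 d1 n1 HK).
rewrite -mix_time_cE => /andP[h1 h2]; apply/andP; split.
  exact: le_trans (half_gap_le_t n1 HK e1) h1.
apply: (le_trans h2).
have h3 : 5 * (C + 1) * (1 + 32) * chain_scale delta eps x <=
    5 * (C + 1) * (1 + 32) * (4 * c) * t_coef eps x.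
  rewrite -[leRHS]mulrA ler_wpM2l ?(ltW L0)//.
  by rewrite -mulrA (scale_le_t n1 HK).
apply: le_trans h3; rewrite ger_pMl ?lerBlDr ?lerDl ?(ltW d0)//.
by rewrite mulr_gt0.
Qed.

Section Family.
Variables (K : forall n : nat, 'M[R]_n.+1) (k : nat -> nat) (eps : nat -> R)
  (x : forall n : nat, 'I_(k n) -> 'I_n.+1).
Hypothesis HK : forall n : nat, (1 <= n)%N -> bottleneck_chain (K n) (eps n) (@x n).
Let M n := chain_scale delta (eps n) (@x n).
Let B n := chain_relax delta (eps n) (@x n).

Let near_ge (P : nat -> Prop) n0 : (forall n, (n0 <= n)%N -> P n) ->
  \forall n \near \oo, P n.
Proof. by move=> h; exists n0 => // n; exact: h. Qed.

Let M0 : \forall n \near \oo, 0 < M n.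
Proof. by apply: (near_ge (n0 := 1)) => n n1; exact: (chain_scale_gt0 d1 n1 (HK n1)). Qed.

Let Binf (A : R) : \forall n \near \oo, A <= B n.
Proof.
apply: (near_ge (n0 := (Num.bound A).+1)) => n nA.
have n1 : (0 < n)%N by exact: leq_trans nA.
apply: le_trans (chain_relax_gen d0 d1 (HK n1)).
have [A0|A0] := leP 0 A; last by apply: le_trans (ltW A0) _.
by apply: le_trans (ltW (archi_boundP A0)) _; rewrite ler_nat ltnW.
Qed.

Let q1 : (1 : R) <= 32. Proof. by rewrite ler1n. Qed.

Let BQ : \forall n \near \oo, B n <= 32 * M n.
Proof. by apply: (near_ge (n0 := 1)) => n n1; exact: (relax_le_scale n1 (HK n1)). Qed.

Let near_chain (P : forall n k (eps : R) (x : 'I_k -> 'I_n.+1) (K : 'M[R]_n.+1), Prop) :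
  (exists n0 : nat, forall n, (n0 <= n)%N -> forall k (eps : R) (x : 'I_k -> 'I_n.+1)
    (K : 'M[R]_n.+1), bottleneck_chain K eps x -> P n k eps x K) ->
  \forall n \near \oo, P n (k n) (eps n) (@x n) (K n).
Proof.
move=> [n0 h]; apply: (near_ge (n0 := n0.+1)) => n n0n; apply: h; first exact: ltnW.
by apply: HK; exact: leq_trans n0n.
Qed.

Lemma cutoff_lazy_iff : tv_cutoff (fun n => TTV_lazy delta (K n) (unif_dist R n)) <->
  (forall A : R, \forall n \near \oo, A * B n <= M n).
Proof.
have -> : (fun n => TTV_lazy delta (K n) (unif_dist R n)) = (fun n =>
   mix_time (fun=> True) (fun m : nat => m%:R) (dTV_lazy delta (K n) (unif_dist R n))).
  by apply/funext => n; exact: mix_time_lazyE.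
have U (e : R) : 0 < e -> exists C : R, 0 < C /\ \forall n \near \oo,
    upper_bd (fun=> True) (fun m : nat => m%:R) 1 C e
      (dTV_lazy delta (K n) (unif_dist R n)) (M n) (B n).
  by move=> /(upper_chain_lazy d0 d1)[C [C0 /near_chain h]]; exists C.
have W (e : R) : 0 < e -> exists C : R, 0 < C /\ \forall n \near \oo,
    lower_bd (fun=> True) (fun m : nat => m%:R) 1 C e
      (dTV_lazy delta (K n) (unif_dist R n)) (M n) (B n).
  by move=> /(lower_chain_lazy d0 d1)[C [C0 /near_chain h]]; exists C.
have Hh : \forall n \near \oo, half_bd (fun=> True) (fun m : nat => m%:R) 1
      (dTV_lazy delta (K n) (unif_dist R n)) (M n).
  by apply: (near_ge (n0 := 1)) => n n1; exact: (half_chain_lazy d0 d1 n1 (HK n1)).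
have Hs : \forall n \near \oo, slow_bd (fun=> True) (fun m : nat => m%:R) 1
      (dTV_lazy delta (K n) (unif_dist R n)) (B n).
  apply: (near_ge (n0 := 8)) => n n8; have n1 : (0 < n)%N by exact: leq_trans n8.
  exact: (slow_chain_lazy d0 d1 n1 (HK n1) n8).
have out0 (m : nat) : True -> 0 <= m%:R :> R by [].
split.
  exact: (cutoff_necessary ltr01 out0 cover_lazy M0 Binf q1 BQ U Hh Hs).
exact: (cutoff_sufficient ltr01 out0 cover_lazy M0 Binf U W).
Qed.

Lemma cutoff_c_iff : tv_cutoff (fun n => TTV_c (K n) (unif_dist R n)) <->
  (forall A : R, \forall n \near \oo, A * B n <= M n).
Proof.
have -> : (fun n => TTV_c (K n) (unif_dist R n)) = (fun n =>
   mix_time (fun t : R => 0 <= t) id (dTV_c (K n) (unif_dist R n))).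
  by apply/funext => n; exact: mix_time_cE.
have U (e : R) : 0 < e -> exists C : R, 0 < C /\ \forall n \near \oo,
    upper_bd (fun t : R => 0 <= t) id (1 - delta) C e
      (dTV_c (K n) (unif_dist R n)) (M n) (B n).
  by move=> /(upper_chain_c d0 d1)[C [C0 /near_chain h]]; exists C.
have W (e : R) : 0 < e -> exists C : R, 0 < C /\ \forall n \near \oo,
    lower_bd (fun t : R => 0 <= t) id (1 - delta) C e
      (dTV_c (K n) (unif_dist R n)) (M n) (B n).
  by move=> /(lower_chain_c d0 d1)[C [C0 /near_chain h]]; exists C.
have Hh : \forall n \near \oo, half_bd (fun t : R => 0 <= t) id (1 - delta)
      (dTV_c (K n) (unif_dist R n)) (M n).
  by apply: (near_ge (n0 := 1)) => n n1; exact: (half_chain_c d0 d1 n1 (HK n1)).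
have Hs : \forall n \near \oo, slow_bd (fun t : R => 0 <= t) id (1 - delta)
      (dTV_c (K n) (unif_dist R n)) (B n).
  apply: (near_ge (n0 := 8)) => n n8; have n1 : (0 < n)%N by exact: leq_trans n8.
  exact: (slow_chain_c d0 d1 n1 (HK n1) n8).
have out0 (t : R) : 0 <= t -> 0 <= id t by [].
split.
  exact: (cutoff_necessary sc0 out0 cover_c M0 Binf q1 BQ U Hh Hs).
exact: (cutoff_sufficient sc0 out0 cover_c M0 Binf U W).
Qed.

Let a n : R := (a_coef (@x n))%:R.
Let b n : R := (b_coef (@x n))%:R.

(** Up to constants [M] is [n ^ 2 + a / eps] and [B] is [n ^ 2 + b / eps], so [M / B] diverges
    exactly when [a / eps] outgrows both terms of [B]. *)
Lemma product_condition_iff :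
  (forall A : R, \forall n \near \oo, A * B n <= M n) <->
  (a n / (n%:R ^+ 2 * eps n) : R) @[n --> \oo] --> +oo /\
  (a n / b n : R) @[n --> \oo] --> +oo.
Proof.
split=> [h|[/cvgryPge h1 /cvgryPge h2] A].
  suff H A : \forall n \near \oo, A <= a n / (n%:R ^+ 2 * eps n) /\ A <= a n / b n.
    by split; apply/cvgryPge => A; apply: filterS (H A) => n [].
  near=> n.
  have n1 : (0 < n)%N by near: n; exists 1%N.
  (* The extra [2] absorbs the quadratic term of [M] and still leaves [a > 0], whence [b > 0] and
     the quotient by [b] is genuine. *)
  have hn : (`|A| + 2) * B n <= M n by near: n; exact: h.
  have Hn := HK n1; have e0 : 0 < eps n by case: Hn => _ [].
  have := le_trans hn (scale_le n1 Hn).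
  rewrite /B /chain_relax -/c mulrCA ler_pM2l// -/(a n) -/(b n) => h'.
  have N2 : n%:R ^+ 2 <= n.+1%:R ^+ 2 :> R by rewrite -!natrX ler_nat leq_sqr.
  have n2 : 0 < n%:R ^+ 2 :> R by rewrite exprn_gt0// ltr0n.
  have b0 : 0 <= b n / eps n by rewrite mulr_ge0// invr_ge0 ltW.
  have AA : A <= `|A| := ler_norm A; have A0 : 0 <= `|A| := normr_ge0 A.
  have g1 : A * n%:R ^+ 2 <= a n / eps n.
    have : A * n%:R ^+ 2 <= `|A| * n%:R ^+ 2 by rewrite ler_wpM2r// ltW.
    have : `|A| * n%:R ^+ 2 <= `|A| * n.+1%:R ^+ 2 by rewrite ler_wpM2l.
    have : 0 <= `|A| * (b n / eps n) by rewrite mulr_ge0.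
    move: h' N2 n2 b0 A0; move: (b n / _) (a n / _) (n%:R ^+ 2) (n.+1%:R ^+ 2) `|A|.
    by move=> u v N1 N2 A' *; lra.
  have g2 : 0 < a n / eps n /\ A * (b n / eps n) <= a n / eps n.
    have : A * (b n / eps n) <= `|A| * (b n / eps n) by rewrite ler_wpM2r.
    have : 0 <= `|A| * n.+1%:R ^+ 2 by rewrite mulr_ge0// sqr_ge0.
    have : 0 <= `|A| * (b n / eps n) by rewrite mulr_ge0.
    move: h' N2 n2 b0 A0; move: (b n / _) (a n / _) (n%:R ^+ 2) (n.+1%:R ^+ 2) `|A|.
    by move=> u v N1 N2 A' *; split; lra.
  have [g3 g4] := g2.
  have a0 : 0 < a n by move: g3; rewrite pmulr_lgt0// invr_gt0.
  have bn0 : 0 < b n := b_coef_gt0 a0.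
  split.
    rewrite ler_pdivlMr; last exact: mulr_gt0.
    by rewrite mulrA -ler_pdivlMr.
  rewrite ler_pdivlMr//; move: g4; rewrite mulrA ler_pM2r ?invr_gt0//.
near=> n.
have n1 : (0 < n)%N by near: n; exists 1%N.
have k1 : 64 * (`|A| + 1) <= a n / (n%:R ^+ 2 * eps n) by near: n; exact: h1.
have k2 : 64 * (`|A| + 1) <= a n / b n by near: n; exact: h2.
have Hn := HK n1; have e0 : 0 < eps n by case: Hn => _ [].
have n2 : 0 < n%:R ^+ 2 :> R by rewrite exprn_gt0// ltr0n.
have N2 : n.+1%:R ^+ 2 <= 4 * n%:R ^+ 2 :> R.
  by rewrite -!natrX -natrM ler_nat; clear -n1; nia.
have A0 : 0 <= `|A| := normr_ge0 A.
have b00 : 0 <= b n by [].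
(* A quotient by zero is zero, which [k2] excludes. *)
have bpos : 0 < b n.
  rewrite lt_neqAle b00 andbT; apply/eqP => b0; move: k2; rewrite -b0 invr0 mulr0; lra.
have g1 : 64 * (`|A| + 1) * n%:R ^+ 2 <= a n / eps n.
  move: k1; rewrite ler_pdivlMr; last exact: mulr_gt0.
  by rewrite mulrA -ler_pdivlMr.
have g2 : 64 * (`|A| + 1) * (b n / eps n) <= a n / eps n.
  by move: k2; rewrite ler_pdivlMr// mulrA => k2; rewrite ler_wpM2r// invr_ge0 ltW.
have b0 : 0 <= b n / eps n by rewrite mulr_ge0// invr_ge0 ltW.
have g3 := scale_ge_a n1 Hn; rewrite -/(M n) -/(a n) in g3.
apply: (@le_trans _ _ (`|A| * B n)).
  by rewrite ler_wpM2r ?ler_norm//; exact: le_trans ler01 (chain_relax_ge1 d0 d1 Hn).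
rewrite /B /chain_relax -/c -/(b n) mulrCA.
have g4 : c * (`|A| * (n.+1%:R ^+ 2 + b n / eps n)) <= c * (a n / eps n / 2).
  rewrite ler_wpM2l ?(ltW c0)//.
  have : `|A| * n.+1%:R ^+ 2 <= `|A| * (4 * n%:R ^+ 2) by rewrite ler_wpM2l.
  have : 0 <= `|A| * (b n / eps n) by rewrite mulr_ge0.
  have : 0 <= `|A| * n%:R ^+ 2 by rewrite mulr_ge0// ltW.
  move: g1 g2 n2 b0 A0; move: (b n / _) (a n / _) (n%:R ^+ 2) (n.+1%:R ^+ 2) `|A|.
  by move=> u v N1 N2' A' *; lra.
by move: g3 g4; move: (_ / eps n) => y; lra.
Unshelve. all: by end_near. Qed.

End Family.
End Final.

Theorem theorem1p4 (R : realType) :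
  (forall e delta : R, 0 < e -> e < 2^-1 -> 0 < delta -> delta < 1 ->
    exists C : R, 1 < C /\
      forall (K : forall n : nat, 'M[R]_n.+1) (k : nat -> nat)
        (eps : nat -> R) (x : forall n : nat, 'I_(k n) -> 'I_n.+1),
      (forall n : nat, (1 <= n)%N -> bottleneck_chain (K n) (eps n) (x n)) ->
      \forall n \near \oo,
        let Tc := TTV_c (K n) (unif_dist R n) e in
        let Td := TTV_lazy delta (K n) (unif_dist R n) e in
        let t := t_coef (eps n) (x n) in
        [/\ C^-1 * t <= Num.min Tc Td,
            Num.min Tc Td <= Num.max Tc Td &
            Num.max Tc Td <= C * t])
  /\
  (forall (K : forall n : nat, 'M[R]_n.+1) (k : nat -> nat)
      (eps : nat -> R) (x : forall n : nat, 'I_(k n) -> 'I_n.+1),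
    (forall n : nat, (1 <= n)%N -> bottleneck_chain (K n) (eps n) (x n)) ->
    forall delta : R, 0 < delta -> delta < 1 ->
    [<-> tv_cutoff (fun n => TTV_c (K n) (unif_dist R n));
         tv_cutoff (fun n => TTV_lazy delta (K n) (unif_dist R n));
         ((a_coef (x n))%:R / (n%:R ^+ 2 * eps n) : R) @[n --> \oo] --> +oo /\
         ((a_coef (x n))%:R / (b_coef (x n))%:R : R) @[n --> \oo] --> +oo]).
Proof.
split.
  move=> e delta e0 e1 d0 d1.
  have [C1 [C10 [n1 H1]]] := mixing_order_lazy d0 d1 e0 e1.
  have [C2 [C20 [n2 H2]]] := mixing_order_c d0 d1 e0 e1.
  have g0 : 0 < (2^-1 - e) / 6 by rewrite divr_gt0// subr_gt0.
  have [C [Cg CC1 CC2 C3]] : exists C : R, [/\ ((2^-1 - e) / 6)^-1 <= C,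
      C1 <= C, C2 <= C & 1 < C].
    have i0 : 0 < ((2^-1 - e) / 6)^-1 by rewrite invr_gt0.
    exists (((2^-1 - e) / 6)^-1 + C1 + C2 + 1).
    by move: i0; move: (_^-1) => g i0; split; lra.
  exists C; split=> // K k eps x HK; exists (n1 + n2).+1 => // n /= n12.
  have Hn : bottleneck_chain (K n) (eps n) (x n) by apply: HK; exact: leq_trans n12.
  have /andP[L1 U1] := H1 n (leq_trans (leq_addr _ _) (ltnW n12)) _ _ _ _ Hn.
  have /andP[L2 U2] := H2 n (leq_trans (leq_addl _ _) (ltnW n12)) _ _ _ _ Hn.
  have t0 : 0 <= t_coef (eps n) (x n).
    rewrite addr_ge0 ?sqr_ge0// mulr_ge0// invr_ge0 ltW//.
    by case: Hn => _ [].
  have Ci : C^-1 * t_coef (eps n) (x n) <= (2^-1 - e) / 6 * t_coef (eps n) (x n).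
    by rewrite ler_wpM2r// -[leRHS]invrK lef_pV2// posrE ?invr_gt0// (lt_trans ltr01).
  split.
  - by rewrite le_min !(le_trans Ci).
  - by rewrite ge_min !le_max !lexx.
  - by rewrite ge_max (le_trans U2) ?(le_trans U1)// ler_wpM2r.
move=> K k eps x HK delta d0 d1.
(* Continuous time is measured in steps of the lazy chain with the given [delta], so both cutoffs
   are equivalent to one condition on the same [M] and [B]. *)
have Hc := cutoff_c_iff d0 d1 HK; have Hl := cutoff_lazy_iff d0 d1 HK.
have Hp := product_condition_iff d0 d1 HK.
split; first by move=> /Hc/Hl.
split; first by move=> /Hl/Hp.
by move=> /Hp/Hc.
Qed.
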